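(* Let $\nu \in \mathbb{N}=\{0,1,2,\ldots\}$, $r,\sigma>0$, and $c:=r\sigma$. Let $f\in \mathcal{L}^2(\mathbb{R}_+)$ be supported in $[0,\sigma]$. Then the Hankel transform $h:=\mathcal{H}_\nu[f]$ restricted to $[0,r]$ uniquely determines $f$ by the formula $$ f(s) = -\frac{2\, i^{\nu}}{\sigma}\,\sqrt{s}\,\frac{d}{ds}\int_s^{\sigma} \frac{s\, T_{\nu}(t/s)}{t\,(t^2-s^2)^{1/2}}\; \mathcal{F}_c^{-1}[h_{r,\nu}](t/\sigma)\, dt,\qquad s\in(0,\sigma], $$ where $T_\nu$ is the Chebyshev polynomial of the first kind of order $\nu$ and $$ h_{r,\nu}(x) := \begin{cases} \dfrac{1}{\sqrt{rx}}\,h(rx), & x\in[0,1],\\[2mm] (-1)^{\nu}\,\dfrac{1}{\sqrt{-rx}}\,h(-rx), & x\in[-1,0).\end{cases} $$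
   Context: $\mathbb{R}_+=\{\rho\in\mathbb{R}: \rho\ge 0\}$ and $\mathbb{N}=\{0,1,2,\ldots\}$. The Hankel transform of order $\nu$ is $$\mathcal{H}_\nu[f](t)=\int_0^\infty f(s)\,J_\nu(ts)\,\sqrt{ts}\,ds,\qquad t\in\mathbb{R}_+,$$ where $J_\nu$ is the Bessel function of the first kind. For $c>0$, $\mathcal{F}_c$ is the integral operator on $\mathcal{L}^2([-1,1])$ given by $$\mathcal{F}_c[f](x)=\int_{-1}^1 e^{icxy}f(y)\,dy.$$ Its eigenfunctions $(\psi_{j,c})_{j\in\mathbb{N}}$ are the prolate spheroidal wave functions, taken real-valued and forming an orthonormal basis of $\mathcal{L}^2([-1,1])$, with corresponding eigenvalues $\mu_{j,c}$ satisfying $0<|\mu_{j+1,c}|<|\mu_{j,c}|$ for all $j\in\mathbb{N}$. The operator $\mathcal{F}_c$ is injective, and its inverse (on the range of $\mathcal{F}_c$) is $$\mathcal{F}_c^{-1}[g](y)=\sum_{j\in\mathbb{N}}\frac{1}{\mu_{j,c}}\,\psi_{j,c}(y)\int_{-1}^1\psi_{j,c}(x)\,g(x)\,dx .$$ The function $h_{r,\nu}$ has no singularity at $x=0$; its value at $0$ is understood as a limit. Since $f$ is an element of $\mathcal{L}^2$, the reconstruction formula is an equality for almost every $s$. *)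

(* Defs.v *)
From HB Require Import structures.
From mathcomp Require Import all_boot all_order all_algebra.
From mathcomp Require Import all_classical all_reals all_analysis.
From mathcomp Require Import complex.

Set Implicit Arguments.
Unset Strict Implicit.
Unset Printing Implicit Defensive.

Import Order.TTheory GRing.Theory Num.Theory.
Import numFieldNormedType.Exports.

Local Open Scope classical_set_scope.
Local Open Scope ring_scope.
Local Open Scope complex_scope.

(* MathComp-Analysis integrates and differentiates real-valued functions of a
   real variable, so the complex-valued versions are taken componentwise. *)

Definition cintegrable (R : realType) (A : set R) (f : R -> R[i]) : Prop :=
  lebesgue_measure.-integrable A (fun x => (complex.Re (f x))%:E) /\
  lebesgue_measure.-integrable A (fun x => (complex.Im (f x))%:E).

Definition cintegral (R : realType) (A : set R) (f : R -> R[i]) : R[i] :=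
  (\int[lebesgue_measure]_(x in A) complex.Re (f x)) +i*
  (\int[lebesgue_measure]_(x in A) complex.Im (f x)).

Definition cderivable (R : realType) (f : R -> R[i]) (s : R) : Prop :=
  derivable (fun x => complex.Re (f x) : R^o) s 1 /\
  derivable (fun x => complex.Im (f x) : R^o) s 1.

Definition cderive (R : realType) (f : R -> R[i]) (s : R) : R[i] :=
  (derive1 (fun x => complex.Re (f x) : R^o) s) +i*
  (derive1 (fun x => complex.Im (f x) : R^o) s).

Definition cexpi (R : realType) (x : R) : R[i] := cos x +i* sin x.

Definition L2 (R : realType) (A : set R) (f : R -> R[i]) : Prop :=
  [/\ measurable_fun A (fun x => complex.Re (f x)),
      measurable_fun A (fun x => complex.Im (f x)) &
      (\int[lebesgue_measure]_(x in A) (ComplexField.Normc.normc (f x) ^+ 2)%:E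
        < +oo)%E].

Definition cvg_L2 (R : realType) (A : set R) (F : nat -> R -> R[i])
    (f : R -> R[i]) : Prop :=
  (\int[lebesgue_measure]_(x in A)
      (ComplexField.Normc.normc (F n x - f x) ^+ 2)%:E)%E
    @[n --> \oo] --> 0%E.

Definition ae_on (R : realType) (A : set R) (P : R -> Prop) : Prop :=
  {ae lebesgue_measure, forall x : R, A x -> P x}.

Definition besselJ (R : realType) (nu : nat) (x : R) : R :=
  limn (series (fun m : nat =>
    (-1) ^+ m / (m`! * (m + nu)`!)%:R * (x / 2) ^+ (2 * m + nu))).

Fixpoint chebyshevT (R : realType) (n : nat) {struct n} : {poly R} :=
  match n with
  | 0%N => 1
  | 1%N => 'X
  | (m.+1 as k).+1 => 2%:P * 'X * chebyshevT R k - chebyshevT R m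
  end.

Definition Rplus (R : realType) : set R := `[0, +oo[%classic.
Arguments Rplus : clear implicits.

Definition hankel (R : realType) (nu : nat) (f : R -> R[i]) (t : R) : R[i] :=
  cintegral (Rplus R)
    (fun s => f s * (besselJ nu (t * s) * Num.sqrt (t * s))%:C).

Definition Icc11 (R : realType) : set R := `[-1, 1]%classic.
Arguments Icc11 : clear implicits.

Definition Fc (R : realType) (c : R) (f : R -> R[i]) (x : R) : R[i] :=
  cintegral (Icc11 R) (fun y => cexpi (c * x * y) * f y).

Definition in_range_Fc (R : realType) (c : R) (g : R -> R[i]) : Prop :=
  exists2 v, L2 (Icc11 R) v & ae_on (Icc11 R) (fun x => g x = Fc c v x).

Definition coef11 (R : realType) (p : R -> R) (g : R -> R[i]) : R[i] :=
  cintegral (Icc11 R) (fun x => (p x)%:C * g x).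

(* The prolate spheroidal wave functions psi and eigenvalues mu of F_c; each
   psi j is real-valued and fixed only up to its sign and a null set. *)
Record is_pswf (R : realType) (c : R) (psi : nat -> R -> R) (mu : nat -> R[i])
    : Prop := IsPswf {
  pswf_L2 : forall j, L2 (Icc11 R) (fun x => (psi j x)%:C);
  pswf_orthonormal : forall j k,
    \int[lebesgue_measure]_(x in Icc11 R) (psi j x * psi k x) = (j == k)%:R;
  pswf_basis : forall g, L2 (Icc11 R) g ->
    cvg_L2 (Icc11 R)
      (fun n x => \sum_(j < n) coef11 (psi j) g * (psi j x)%:C) g;
  pswf_eigen : forall j, ae_on (Icc11 R)
    (fun x => Fc c (fun y => (psi j y)%:C) x = mu j * (psi j x)%:C);
  pswf_eigenvalues : forall j, 0 < `|mu j.+1| < `|mu j|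
}.

(* u represents F_c^{-1}[g], the sum of the eigenfunction series of g; as an
   identity between elements of L2([-1,1]) the sum is an L2 limit, so u is
   determined up to a null set. *)
Definition is_Fc_inv (R : realType) (psi : nat -> R -> R) (mu : nat -> R[i])
    (g u : R -> R[i]) : Prop :=
  L2 (Icc11 R) u /\
  cvg_L2 (Icc11 R)
    (fun n y => \sum_(j < n) (mu j)^-1 * (psi j y)%:C * coef11 (psi j) g) u.

(* z / sqrt x has no meaning at x = 0 (the library's division returns 0), where
   the value is the limit from the right. *)
Definition h_resc (R : realType) (r : R) (nu : nat) (h : R -> R[i]) (x : R)
    : R[i] :=
  let q y := ((Num.sqrt (r * y))^-1)%:C * h (r * y) in
  if 0 < x then q x
  else if x < 0 then (-1) ^+ nu * q (- x)
  else lim (complex.Re (q y) @[y --> 0^'+]) +i*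
       lim (complex.Im (q y) @[y --> 0^'+]).

Definition inv_integrand (R : realType) (nu : nat) (sigma : R) (u : R -> R[i])
    (s t : R) : R[i] :=
  (s * (chebyshevT R nu).[t / s] / (t * Num.sqrt (t ^+ 2 - s ^+ 2)))%:C
    * u (t / sigma).

Definition inv_integral (R : realType) (nu : nat) (sigma : R) (u : R -> R[i])
    (s : R) : R[i] :=
  cintegral `[s, sigma]%classic (inv_integrand nu sigma u s).

(* f is supported in [0, sigma], as an element of L2(R_+). *)
Definition supported (R : realType) (sigma : R) (f : R -> R[i]) : Prop :=
  ae_on (Rplus R) (fun s => sigma < s -> f s = 0).

(* Main.v *)
Require Import Defs.
From mathcomp Require Import all_boot all_order all_algebra.
From mathcomp Require Import all_classical all_reals all_analysis.
From mathcomp Require Import complex.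
From mathcomp Require Import measurable_realfun.
From mathcomp Require Import zify ring lra.

Import Order.TTheory GRing.Theory Num.Theory.
Import numFieldNormedType.Exports.

(** The Hankel kernel factors through the Fourier kernel. For $a > 0$ and real
    $b$,
    $$\pi i^\nu J_\nu(ab) = \int_{-a}^a e^{ibz}\,
        \frac{T_\nu(z/a)}{\sqrt{a^2 - z^2}}\,dz ,$$
    proved by integrating the power series of the exponential term by term
    ([cos_chebyshev_integral], [sin_chebyshev_integral]). Taking $a = s/\sigma$
    in the definition of $h = \mathcal{H}_\nu[f]$ and exchanging the integrals
    shows that $h(rx)/\sqrt{rx}$ is the value at $x$ of $\mathcal{F}_c[v]$, where
    $$v(z) = \frac{1}{\pi i^\nu} \int_{\sigma|z|}^\sigma
        \frac{T_\nu(\sigma z/s)}{\sqrt{(s/\sigma)^2 - z^2}}\,f(s)\sqrt{s}\,ds$$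
    is a transform of Abel type ([fourier_source], [h_rescE]). The parity of
    $J_\nu$ matches the extension of the data to negative $x$.

    The inverse square root in the kernel of $v$ is integrable but not square
    integrable, so $v$ is shown to be square integrable by a Cauchy-Schwarz
    inequality that splits this singularity evenly between the two factors
    ([abel_transform_L2]). As the kernel of $\mathcal{F}_c$ is symmetric, the
    coefficient of $\mathcal{F}_c[v]$ on an eigenfunction is the eigenvalue times
    that of $v$ ([coef11_Fc]). Hence the series that defines the inverse is the expansion of
    $v$ in an orthonormal basis, and every function that represents
    $\mathcal{F}_c^{-1}[h_{r,\nu}]$ is equal to $v$ almost everywhere.

    It remains to invert the Abel transform. For $0 < s < p$,
    $$\int_s^p \frac{T_\nu(t/s)\,T_\nu(t/p)}
        {t\sqrt{t^2 - s^2}\sqrt{p^2 - t^2}}\,dt = \frac{\pi}{2sp}$$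
    for every $\nu$, by an induction on $\nu$ in steps of two: the difference of the
    integrands is the derivative of a function that vanishes at both ends
    ([abel2_integral]). So the integral of the reconstruction formula is
    $\frac{\sigma}{2 i^\nu}\int_s^\sigma f(p)\,p^{-1/2}\,dp$
    ([abel_transform_inversion]), and its derivative at $s$ is
    $-\frac{\sigma}{2 i^\nu} f(s)/\sqrt{s}$ for almost every $s$, by the
    differentiation theorem of Lebesgue ([derive_tail_integral]).

    For the uniqueness of $f$: if $g$ has the same Hankel transform on
    $[0, r]$, then the function $v$ built from $g$ represents the same inverse,
    so $f$ and $g$ are reconstructed from the same data. *)

Local Open Scope classical_set_scope.
Local Open Scope ring_scope.

Set Implicit Arguments.
Unset Strict Implicit.
Unset Printing Implicit Defensive.

(** * Chebyshev polynomials *)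

(** [chebyshevU n x] is $U_{n-1}(x)$, the Chebyshev polynomial of the second
    kind; the shift gives [chebyshevU 0 = 0]. *)
Fixpoint chebyshevU (R : realType) (n : nat) (x : R) {struct n} : R :=
  if n is m.+1 then x * chebyshevU m x + (chebyshevT R m).[x] else 0.

Section chebyshev.
Variable R : realType.
Notation T n x := (chebyshevT R n).[x].
Notation U := (@chebyshevU R).
Implicit Types (n : nat) (x : R).

Lemma chebyshevT0 x : T 0 x = 1. Proof. by rewrite hornerC. Qed.

Lemma chebyshevT1 x : T 1 x = x. Proof. by rewrite hornerX. Qed.

Lemma chebyshevTSS n x : T n.+2 x = 2 * x * T n.+1 x - T n x.
Proof. by rewrite [chebyshevT R n.+2]/= -/(chebyshevT R n.+1) !hornerE. Qed.

Lemma chebyshevUS n x : U n.+1 x = x * U n x + T n x. Proof. by []. Qed.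

Lemma chebyshevTS n x : T n.+1 x = x * T n x + (x ^+ 2 - 1) * U n x.
Proof.
elim: n => [|n ih]; first by rewrite /= mulr0 addr0 hornerX hornerC mulr1.
by rewrite chebyshevTSS chebyshevUS ih; ring.
Qed.

Lemma chebyshevT_pred n x : T n x = x * T n.+1 x - (x ^+ 2 - 1) * U n.+1 x.
Proof. by rewrite chebyshevTS chebyshevUS; ring. Qed.

(** The identity $\cosh^2 - \sinh^2 = 1$ in disguise; on $[-1, 1]$ both terms on
    the left are nonnegative, which bounds $T_n$ by 1. *)
Lemma chebyshev_pell n x : T n x ^+ 2 - (x ^+ 2 - 1) * U n x ^+ 2 = 1.
Proof.
elim: n => [|n ih]; first by rewrite /= hornerC; ring.
by rewrite chebyshevTS chebyshevUS -[RHS]ih; ring.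
Qed.

Lemma chebyshevT_le1 n x : `|x| <= 1 -> `|T n x| <= 1.
Proof.
move=> x1; rewrite -(@ler_pXn2r _ 2)// ?nnegrE// expr1n real_normK ?num_real//.
rewrite -[leRHS](chebyshev_pell n x) lerDl oppr_ge0.
apply: mulr_le0_ge0; rewrite ?sqr_ge0// subr_le0 -real_normK ?num_real//.
by rewrite expr_le1.
Qed.

(** One induction proves both, since each recurrence involves the other family.
    The derivative of $U$ is characterized by its product with $x^2 - 1$, which
    avoids the division that its closed form would need at $x = \pm 1$. *)
Lemma is_derive_chebyshev n x :
  is_derive x 1 (fun y => T n y) (n%:R * U n x) /\
  (exists dU, is_derive x 1 (U n) dU /\
    (x ^+ 2 - 1) * dU = n%:R * T n x - x * U n x).
Proof.
elim: n => [|n [ihT [dU [ihU dUE]]]].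
  rewrite mul0r; split.
    rewrite (_ : (fun _ => _) = cst 1); first exact: is_derive_cst.
    by apply/funext => y; rewrite chebyshevT0.
  by exists 0; split; [exact: is_derive_cst|rewrite /= !mulr0 mul0r subrr].
have dU' : is_derive x 1 (U n.+1) (U n x + x * dU + n%:R * U n x).
  rewrite (_ : U n.+1 = (id * U n + (fun y => T n y))); last exact/funext.
  by apply: is_derive_eq; rewrite /GRing.scale/=; ring.
split; last first.
  exists (U n x + x * dU + n%:R * U n x); split => //.
  rewrite chebyshevTS chebyshevUS -natr1.
  transitivity ((x ^+ 2 - 1) * (1 + n%:R) * U n x + x * ((x ^+ 2 - 1) * dU)); first by ring.
  by rewrite dUE; ring.
rewrite (_ : (fun y => T n.+1 y) = (id * (fun y => T n y) + (id ^+ 2 - cst 1) * U n)); last first.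
  by apply/funext => y; rewrite chebyshevTS.
apply: is_derive_eq; rewrite /GRing.scale/= !fctE/=.
by rewrite [(x ^+ 2 - 1) * dU]dUE; ring.
Qed.

Lemma continuous_chebyshevT n : continuous (fun x => T n x).
Proof. exact: continuous_horner. Qed.

Lemma continuous_chebyshevU n : continuous (U n).
Proof.
move=> x; have [_ [dU [h _]]] := is_derive_chebyshev n x.
by apply: differentiable_continuous; apply/derivable1_diffP.
Qed.

End chebyshev.

(** * Integration of derivatives over open intervals *)

Section ftc.
Variable R : realType.
Notation mu := (@lebesgue_measure R).
Implicit Types (f F g G h H : R -> R) (a b : R).

(** With $n + 3$ the margin is at most a third of the length, so that none of
    the compact intervals is empty. *)
Lemma oo_bigcup a b : a < b -> `]a, b[%classic =
  \bigcup_n `[a + (b - a) / n.+3%:R, b - (b - a) / n.+3%:R]%classic.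
Proof.
move=> ab; apply/seteqP; split => x /=; rewrite ?in_itv/=.
- move=> /andP[ax xb].
  pose d := Num.min (x - a) (b - x).
  have d0 : 0 < d by rewrite lt_min !subr_gt0 ax xb.
  have ba0 : 0 < b - a by rewrite subr_gt0.
  have [n nd] : exists n : nat, (b - a) / d < n%:R.
    exists (Num.trunc ((b - a) / d)).+1; apply: truncnS_gt.
  exists n => //=; rewrite in_itv/=.
  have h : (b - a) / n.+3%:R <= d.
    rewrite ler_pdivrMr// mulrC -ler_pdivrMr// (le_trans (ltW nd))//.
    by rewrite ler_nat -addn3 leq_addr.
  by move: h; rewrite /d le_min; set e := _ / _ => /andP[h1 h2]; apply/andP; split; lra.
- move=> [n _ /=]; rewrite !in_itv/= => /andP[h1 h2].
  have : 0 < (b - a) / n.+3%:R by rewrite divr_gt0// subr_gt0.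
  move: h1 h2; set e := _ / _ => h1 h2 h; apply/andP; split; lra.
Qed.

(** [F] is a primitive of [f] on [`]a, b[] with limits at the end points;
    [f] itself may be unbounded there. *)
Definition primitive_oo f F a b : Prop :=
  [/\ forall x, a < x < b -> is_derive x 1 F (f x),
      forall x, a < x < b -> {for x, continuous f},
      F x @[x --> a^'+] --> F a & F x @[x --> b^'-] --> F b].

Lemma near_oo a b x : a < x < b -> \forall y \near x, a < y < b.
Proof.
move=> axb; have := @near_in_itvoo R a b x.
rewrite in_itv/= => /(_ axb); apply: filterS => y.
by rewrite in_itv.
Qed.

Lemma eq_primitive_oo f g F a b : (forall x, a < x < b -> f x = g x) ->
  primitive_oo f F a b -> primitive_oo g F a b.
Proof.
move=> fg [dF cf Fa Fb]; split => // x axb; first by rewrite -fg//; exact: dF.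
rewrite /prop_for /continuous_at -fg//.
apply: cvg_trans (cf x axb); apply: near_eq_cvg.
by near=> y; apply: fg; near: y; exact: near_oo.
Unshelve. all: by end_near. Qed.

Lemma primitive_ooD f g F G a b : primitive_oo f F a b -> primitive_oo g G a b ->
  primitive_oo (f \+ g) (F \+ G) a b.
Proof.
move=> [dF cf Fa Fb] [dG cg Ga Gb]; split => [x axb|x axb||].
- by apply: is_deriveD; [exact: dF|exact: dG].
- by apply: continuousD; [exact: cf|exact: cg].
- exact: cvgD.
- exact: cvgD.
Qed.

Lemma primitive_ooZ k f F a b : primitive_oo f F a b ->
  primitive_oo (fun x => k * f x) (fun x => k * F x) a b.
Proof.
move=> [dF cf Fa Fb]; split => [x axb|x axb||].
- by apply: is_deriveZ; exact: dF.
- by apply: continuousM; [exact: cvg_cst|exact: cf].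
- by apply: cvgM => //; exact: cvg_cst.
- by apply: cvgM => //; exact: cvg_cst.
Qed.

(** Only the limits of [F] at the end points enter, so that [f] may blow up
    there: exhaust the open interval by compact ones and use monotone
    convergence. *)
Lemma ge0_FTC2_oo f F a b : a < b ->
  (forall x, a < x < b -> 0 <= f x) -> primitive_oo f F a b ->
  (\int[mu]_(x in `]a, b[) (f x)%:E = (F b - F a)%:E)%E.
Proof.
move=> ab f0 [dF cf Fa Fb].
pose e n := (b - a) / n.+3%:R.
have ba0 : 0 < b - a by rewrite subr_gt0.
have e_gt0 n : 0 < e n by rewrite divr_gt0.
have e_half n : a + e n < b - e n.
  have : e n <= (b - a) / 3 by rewrite ler_pM2l// lef_pV2 ?posrE// ler_nat.
  by move=> ?; lra.
have e_cvg : e n @[n --> \oo] --> (0 : R).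
  rewrite -(mulr0 (b - a)); apply: cvgM; first exact: cvg_cst.
  apply/gtr0_cvgV0; first by near=> n.
  rewrite (_ : (fun n => _) = (fun n => (n + 3)%:R)); last first.
    by apply/funext => n; rewrite addn3.
  by have := @cvgr_idn R; rewrite -(cvg_shiftn 3).
have sub n x : a + e n <= x <= b - e n -> a < x < b.
  by move=> /andP[h1 h2]; have := e_gt0 n => h; apply/andP; split; lra.
have mf : measurable_fun `]a, b[ f.
  apply: open_continuous_measurable_fun => //.
  by move=> x; rewrite inE/= in_itv/=; exact: cf.
rewrite oo_bigcup//.
set S := fun n : nat => `[a + e n, b - e n]%classic.
have Sab n : S n `<=` `]a, b[.
  by move=> x; rewrite /S/= !in_itv/=; exact: sub.
have cv : (\int[mu]_(x in S n) (f x)%:E @[n --> \oo] -->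
    \int[mu]_(x in \bigcup_n S n) (f x)%:E)%E.
  apply: ge0_nondecreasing_set_cvg_integral.
  - move=> m n mn; apply/subsetPset => x; rewrite /S/= !in_itv/=.
    have : e n <= e m by rewrite ler_pM2l// lef_pV2 ?posrE// ler_nat.
    by move=> h /andP[h1 h2]; apply/andP; split; lra.
  - by move=> n; exact: measurable_itv.
  - move=> n; apply/measurable_EFinP; exact: measurable_funS mf.
  - by move=> n x /Sab; rewrite lee_fin/= in_itv/=; exact: f0.
have eqS : (fun n => \int[mu]_(x in S n) (f x)%:E)%E =
    (fun n => (F (b - e n) - F (a + e n))%:E).
  apply/funext => n; rewrite EFinB; apply: continuous_FTC2 => //.
  - apply: continuous_in_subspaceT => x; rewrite inE/= in_itv/= => /sub; exact: cf.
  - have cF x : a < x < b -> {for x, continuous F}.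
      by move=> /dF h; apply: differentiable_continuous; apply/derivable1_diffP.
    split.
    + by move=> x; rewrite in_itv/= => /andP[h1 h2]; have /dF : a < x < b
        by apply: (sub n); rewrite !ltW.
    + apply: cvg_at_right_filter; apply: cF; apply: (sub n); rewrite lexx/= ltW//.
    + apply: cvg_at_left_filter; apply: cF; apply: (sub n); rewrite lexx/= ltW//.
  - move=> x; rewrite in_itv/= => /andP[h1 h2].
    have /dF h : a < x < b by apply: (sub n); rewrite !ltW.
    by rewrite derive1E; exact: derive_val.
rewrite eqS in cv.
apply: (cvg_unique _ cv) => //.
apply: cvg_EFin; first exact: nearW.
rewrite /comp /=; apply: cvgB.
- move/cvg_at_leftP : Fb; apply; split => [n|].
    by rewrite ltrBlDr ltrDl.
  by rewrite -[X in _ --> X]subr0; apply: cvgB => //; exact: cvg_cst.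
- move/cvg_at_rightP : Fa; apply; split => [n|].
    by rewrite ltrDl.
  by rewrite -[X in _ --> X]addr0; apply: cvgD => //; exact: cvg_cst.
Unshelve. all: by end_near. Qed.

(** Writing [f] as [(f + g) - g] with both terms nonnegative reduces to the
    nonnegative case. *)
Lemma FTC2_oo f F g G a b : a < b -> (forall x, a < x < b -> `|f x| <= g x) ->
  primitive_oo f F a b -> primitive_oo g G a b ->
  mu.-integrable `]a, b[ (EFin \o f) /\ \int[mu]_(x in `]a, b[) f x = F b - F a.
Proof.
move=> ab fg pF pG.
have g0 x : a < x < b -> 0 <= g x by move=> /fg; apply: le_trans.
have mfun h H : primitive_oo h H a b -> measurable_fun `]a, b[ h.
  move=> [_ ch _ _]; apply: open_continuous_measurable_fun => //.
  by move=> x; rewrite inE/= in_itv/=; exact: ch.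
have ge0_int (h H : R -> R) : (forall x, a < x < b -> 0 <= h x) -> primitive_oo h H a b ->
    mu.-integrable `]a, b[ (EFin \o h).
  move=> h0 ph; apply/integrableP; split; first by apply/measurable_EFinP; exact: (mfun _ H).
  rewrite (@eq_integral _ _ _ mu _ (EFin \o h)).
    by have /= -> := ge0_FTC2_oo ab h0 ph; rewrite ltry.
  by move=> x; rewrite inE/= in_itv/= => /h0 hx; rewrite ger0_norm.
have fgD x : a < x < b -> 0 <= f x + g x.
  by move=> /fg; rewrite ler_norml => /andP[+ _]; rewrite -subr_ge0 opprK.
have pD := primitive_ooD pF pG.
have ig := ge0_int _ _ g0 pG; have iD := ge0_int _ _ fgD pD.
have fE : EFin \o f = ((EFin \o (f \+ g)%R) \- (EFin \o g))%E.
  by apply/funext => x /=; rewrite -EFinB addrK.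
split; first by rewrite fE; exact: integrableB.
rewrite (_ : (fun x => f x) = (fun x => (f \+ g) x - g x)); last first.
  by apply/funext => x /=; rewrite addrK.
rewrite RintegralB//= /Rintegral.
rewrite (ge0_FTC2_oo ab fgD pD) (ge0_FTC2_oo ab g0 pG) /=; ring.
Qed.

End ftc.

(** * The arcsine *)

Section arcsine.
Variable R : realType.
Implicit Types (L l : R -> R) (a b c x : R).

(** The arcsine on [[-1, 1]], written with the arctangent so as to be continuous
    on the whole line, end points included. *)
Definition arcsine x : R := 2 * atan (x / (1 + Num.sqrt (1 - x ^+ 2))).

Lemma arcsine_denom_gt0 x : 0 < 1 + Num.sqrt (1 - x ^+ 2).
Proof. by rewrite (lt_le_trans ltr01)// lerDl sqrtr_ge0. Qed.

Lemma continuous_arcsine : continuous arcsine.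
Proof.
move=> x; rewrite /arcsine; apply: cvgM; first exact: cvg_cst.
apply: continuous_comp; last exact: continuous_atan.
apply: cvgM; first exact: cvg_id.
apply: cvgV; first by rewrite gt_eqF// arcsine_denom_gt0.
apply: cvgD; first exact: cvg_cst.
apply: continuous_comp; last exact: sqrt_continuous.
apply: cvgB; first exact: cvg_cst.
exact: exprn_continuous.
Qed.

Lemma arcsine1 : arcsine 1 = pi / 2.
Proof. by rewrite /arcsine expr1n subrr sqrtr0 addr0 divr1 atan1; lra. Qed.

Lemma arcsineN1 : arcsine (-1) = - (pi / 2).
Proof.
by rewrite /arcsine sqrrN expr1n subrr sqrtr0 addr0 divr1 atanN atan1; lra.
Qed.

Lemma is_derive_sqrt (u : R -> R) du x : 0 < u x -> is_derive x 1 u du ->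
  is_derive x 1 (fun y => Num.sqrt (u y)) (du / (2 * Num.sqrt (u x))).
Proof.
move=> u0 hu; rewrite mulrC.
exact: (@is_derive1_comp _ Num.sqrt u x _ _ (is_derive1_sqrt u0) hu).
Qed.

Lemma is_derive_mul (u v : R -> R) du dv x :
  is_derive x 1 u du -> is_derive x 1 v dv ->
  is_derive x 1 (fun y => u y * v y) (du * v x + u x * dv).
Proof.
move=> hu hv; have := is_deriveM hu hv; congr is_derive.
by rewrite /GRing.scale /= addrC (mulrC du).
Qed.

Lemma is_derive_inv (u : R -> R) du x : u x != 0 ->
  is_derive x 1 u du -> is_derive x 1 (fun y => (u y)^-1) (- du / u x ^+ 2).
Proof.
move=> u0 hu; have := is_deriveV u0 hu; congr is_derive.
by rewrite /GRing.scale /= mulrC mulrN mulNr.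
Qed.

Lemma is_derive_sqr x : is_derive x 1 (fun y : R => y ^+ 2) (2 * x).
Proof.
have := is_derive_mul (is_derive_id x (1 : R)) (is_derive_id x (1 : R)).
by congr is_derive; rewrite mul1r mulr1 mulr2n mulrDl mul1r.
Qed.

Lemma is_derive_sqrt1B x : -1 < x < 1 ->
  is_derive x 1 (fun y => Num.sqrt (1 - y ^+ 2)) (- x / Num.sqrt (1 - x ^+ 2)).
Proof.
move=> x1; have h : 0 < 1 - x ^+ 2.
  rewrite (_ : 1 - x ^+ 2 = (1 - x) * (1 + x)); last by ring.
  by case/andP: x1 => ? ?; rewrite mulr_gt0//; lra.
have := is_deriveB (is_derive_cst (1 : R) x 1) (is_derive_sqr x).
rewrite sub0r => du.
have := @is_derive_sqrt (fun y => 1 - y ^+ 2) _ x h du; congr is_derive.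
by field; rewrite gt_eqF// sqrtr_gt0.
Qed.

Lemma is_derive_arcsine x : -1 < x < 1 ->
  is_derive x 1 arcsine (Num.sqrt (1 - x ^+ 2))^-1.
Proof.
move=> x1; have h : 0 < 1 - x ^+ 2.
  rewrite (_ : 1 - x ^+ 2 = (1 - x) * (1 + x)); last by ring.
  by case/andP: x1 => ? ?; rewrite mulr_gt0//; lra.
have dq := is_derive_sqrt1B x1.
pose q (y : R) : R := Num.sqrt (1 - y ^+ 2).
have q0 : 0 < q x by rewrite sqrtr_gt0.
have q2 : q x ^+ 2 = 1 - x ^+ 2 by rewrite sqr_sqrtr// ltW.
have q1 : 1 + q x != 0 by rewrite gt_eqF// arcsine_denom_gt0.
have dd : is_derive x 1 (fun y => 1 + q y) (- x / q x).
  by rewrite -[- x / q x]add0r; apply: is_deriveD.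
have du := is_derive_mul (is_derive_id x (1 : R)) (@is_derive_inv _ _ x q1 dd).
have := is_deriveZ 2 (is_derive1_comp (is_derive1_atan _) du).
congr is_derive; rewrite /GRing.scale /= -/(q x).
have xq : x ^+ 2 = 1 - q x ^+ 2 by rewrite q2; ring.
have D : 1 + (x / (1 + q x)) ^+ 2 = 2 / (1 + q x).
  by rewrite exprMn xq; field.
rewrite /= D mul1r.
transitivity ((1 + q x) * ((1 + q x)^-1 + x ^+ 2 / (q x * (1 + q x) ^+ 2))).
  by field; rewrite q1 gt_eqF.
by rewrite xq; field; rewrite q1 gt_eqF.
Qed.

(** The substitution rule for an integrand with inverse square root
    singularities at both ends. *)
Lemma primitive_arcsine L l c a b :
  (forall x, a <= x <= b -> {for x, continuous L}) -> a < b ->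
  (forall x, a < x < b -> [/\ is_derive x 1 L (l x), {for x, continuous l} &
    -1 < L x < 1]) ->
  primitive_oo (fun x => c * (l x / Num.sqrt (1 - L x ^+ 2)))
    (fun x => c * arcsine (L x)) a b.
Proof.
move=> cL ab hL; apply: primitive_ooZ; split.
- move=> x /hL[dL cl Lx]; rewrite mulrC.
  exact: (@is_derive1_comp _ arcsine L x _ _ (is_derive_arcsine Lx) dL).
- move=> x axb; have [dL cl Lx] := hL x axb.
  have cLx : {for x, continuous L} by apply: cL; case/andP: axb => *; rewrite !ltW.
  apply: cvgM => //; apply: cvgV.
    rewrite gt_eqF// sqrtr_gt0 (_ : 1 - L x ^+ 2 = (1 - L x) * (1 + L x)); last by ring.
    by case/andP: Lx => ? ?; rewrite mulr_gt0//; lra.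
  apply: continuous_comp; last exact: sqrt_continuous.
  apply: cvgB; first exact: cvg_cst.
  exact: (cvgM cLx cLx).
- apply: cvg_at_right_filter.
  apply: (@continuous_comp _ _ _ L arcsine); last exact: continuous_arcsine.
  by apply: cL; rewrite lexx ltW.
- apply: cvg_at_left_filter.
  apply: (@continuous_comp _ _ _ L arcsine); last exact: continuous_arcsine.
  by apply: cL; rewrite lexx ltW.
Qed.

End arcsine.

(** * Primitives of Chebyshev polynomials against Abel weights *)

Section primitives.
Variable R : realType.
Notation mu := (@lebesgue_measure R).
Notation T n x := (chebyshevT R n).[x].
Notation U := (@chebyshevU R).
Implicit Types (n k : nat) (a s p t x z : R).

Lemma sqrBB_gt0 s t : 0 < s < t -> 0 < t ^+ 2 - s ^+ 2.
Proof. by move=> /andP[s0 st]; rewrite subr_gt0 ltr_pXn2r// nnegrE ltW// (lt_trans s0). Qed.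

Lemma is_derive_divr t s : is_derive t 1 (fun y : R => y / s) s^-1.
Proof.
have := is_derive_mul (is_derive_id t (1 : R)) (is_derive_cst s^-1 t 1).
by congr is_derive; rewrite mul1r mulr0 addr0.
Qed.

Lemma continuous_divr s : continuous (fun y : R => y / s).
Proof. by move=> x; apply: cvgM; [exact: cvg_id|exact: cvg_cst]. Qed.

Lemma continuous_sqrtBr s : continuous (fun y : R => Num.sqrt (y ^+ 2 - s)).
Proof.
move=> x; apply: continuous_comp; last exact: sqrt_continuous.
by apply: cvgB; [exact: exprn_continuous|exact: cvg_cst].
Qed.

Lemma continuous_sqrtBl s : continuous (fun y : R => Num.sqrt (s - y ^+ 2)).
Proof.
move=> x; apply: continuous_comp; last exact: sqrt_continuous.
by apply: cvgB; [exact: cvg_cst|exact: exprn_continuous].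
Qed.

Lemma continuous_fun_comp (f g : R -> R) :
  continuous f -> continuous g -> continuous (fun y => g (f y)).
Proof.
move=> cf cg x; have h : {for x, continuous (g \o f)}.
  by apply: continuous_comp; [exact: cf|exact: cg].
exact: h.
Qed.

Lemma continuous_Tdivr n s : continuous (fun y : R => T n (y / s)).
Proof.
apply: (@continuous_fun_comp _ (fun y => T n y)); first exact: continuous_divr.
exact: continuous_chebyshevT.
Qed.

Lemma continuous_Udivr n s : continuous (fun y : R => U n (y / s)).
Proof.
apply: (@continuous_fun_comp _ (U n)); first exact: continuous_divr.
exact: continuous_chebyshevU.
Qed.

Lemma is_derive_Udivr n t s : s != 0 -> exists dU,
  is_derive t 1 (fun y => U n (y / s)) dU /\
  (t ^+ 2 - s ^+ 2) * dU = s * n%:R * T n (t / s) - t * U n (t / s).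
Proof.
move=> s0; have [_ [dU [hU eU]]] := is_derive_chebyshev n (t / s).
exists (dU / s); split.
  exact: (@is_derive1_comp _ (U n) (fun y => y / s) t _ _ hU (is_derive_divr t s)).
transitivity (s * (((t / s) ^+ 2 - 1) * dU)); first by field.
by rewrite eU; field.
Qed.

(** For $t = s\cosh\alpha$ this is the derivative of $s\sinh(n\alpha)$, as
    $\sqrt{x^2 - 1}\,U_{n-1}(x) = \sinh(n\alpha)$ at $x = \cosh\alpha$. *)
Lemma is_derive_sqrt_U_gt n t s : 0 < s < t ->
  is_derive t 1 (fun y => Num.sqrt (y ^+ 2 - s ^+ 2) * U n (y / s))
    (n%:R * s * (T n (t / s) / Num.sqrt (t ^+ 2 - s ^+ 2))).
Proof.
move=> st; have h := sqrBB_gt0 st; have s0 : s != 0 by case/andP: st => /gt_eqF->.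
have [dU [hU eU]] := is_derive_Udivr n t s0.
have := is_deriveB (is_derive_sqr t) (is_derive_cst (s ^+ 2) t 1).
rewrite subr0 => du.
have := is_derive_mul (@is_derive_sqrt _ (fun y => y ^+ 2 - s ^+ 2) _ t h du) hU.
congr is_derive; set q := Num.sqrt _.
have q0 : q != 0 by rewrite gt_eqF// sqrtr_gt0.
have q2 : q ^+ 2 = t ^+ 2 - s ^+ 2 by rewrite sqr_sqrtr// ltW.
transitivity (t / q * U n (t / s) + (q ^+ 2 * dU) / q); first by field.
by rewrite q2 eU; field.
Qed.

(** The trigonometric counterpart, with $t = p\cos\beta$. *)
Lemma is_derive_sqrt_U_lt n t p : p != 0 -> t ^+ 2 < p ^+ 2 ->
  is_derive t 1 (fun y => Num.sqrt (p ^+ 2 - y ^+ 2) * U n (y / p))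
    (- (n%:R * p * (T n (t / p) / Num.sqrt (p ^+ 2 - t ^+ 2)))).
Proof.
move=> p0 tp; have h : 0 < p ^+ 2 - t ^+ 2 by rewrite subr_gt0.
have [dU [hU eU]] := is_derive_Udivr n t p0.
have := is_deriveB (is_derive_cst (p ^+ 2) t 1) (is_derive_sqr t).
rewrite sub0r => du.
have := is_derive_mul (@is_derive_sqrt _ (fun y => p ^+ 2 - y ^+ 2) _ t h du) hU.
congr is_derive; set q := Num.sqrt _.
have q0 : q != 0 by rewrite gt_eqF// sqrtr_gt0.
have q2 : q ^+ 2 = - (t ^+ 2 - p ^+ 2) by rewrite sqr_sqrtr ?ltW// opprB.
transitivity (- t / q * U n (t / p) + (q ^+ 2 * dU) / q); first by field.
by rewrite q2 [- (_ - _) * dU]mulNr eU; field.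
Qed.

Lemma primitive_abel0 a : 0 < a ->
  primitive_oo (fun z => (Num.sqrt (a ^+ 2 - z ^+ 2))^-1)
    (fun z => 1 * arcsine (z / a)) (- a) a.
Proof.
move=> a0; apply: eq_primitive_oo; last first.
  apply: (@primitive_arcsine _ (fun z => z / a) (cst a^-1)).
  - by move=> x _; exact: continuous_divr.
  - by lra.
  - move=> x /andP[x1 x2]; split; [exact: is_derive_divr|exact: cvg_cst|].
    by rewrite ltr_pdivlMr// ltr_pdivrMr// mulN1r mul1r x1.
move=> x /andP[x1 x2] /=.
rewrite (_ : 1 - (x / a) ^+ 2 = a^-1 ^+ 2 * (a ^+ 2 - x ^+ 2)); last by field; rewrite gt_eqF.
rewrite sqrtrM ?sqr_ge0// sqrtr_sqr ger0_norm ?invr_ge0 ?ltW//.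
by rewrite mul1r invfM mulrA mulfV ?mul1r// invr_eq0 gt_eqF.
Qed.

(** With $z = a\cos\beta$ this is the primitive $\sin(n\beta)/n$ of
    $\cos(n\beta)$; it vanishes at both ends. *)
Lemma primitive_abelT n a : 0 < a ->
  primitive_oo (fun z => T n.+1 (z / a) / Num.sqrt (a ^+ 2 - z ^+ 2))
    (fun z => - (n.+1%:R * a)^-1 * (Num.sqrt (a ^+ 2 - z ^+ 2) * U n.+1 (z / a)))
    (- a) a.
Proof.
move=> a0; have cF : continuous (fun z => Num.sqrt (a ^+ 2 - z ^+ 2) * U n.+1 (z / a)).
  by move=> x; apply: cvgM; [exact: continuous_sqrtBl|exact: continuous_Udivr].
apply: (@eq_primitive_oo _ (fun z => - (n.+1%:R * a)^-1 *
    - (n.+1%:R * a * (T n.+1 (z / a) / Num.sqrt (a ^+ 2 - z ^+ 2))))).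
  move=> x _; rewrite mulrNN mulrA mulVf ?mul1r//.
  by rewrite mulf_neq0// gt_eqF.
have xa x : - a < x < a -> x ^+ 2 < a ^+ 2.
  rewrite -ltr_norml => h; rewrite -(real_normK (num_real x)).
  by rewrite ltr_pXn2r// nnegrE// ltW.
apply: primitive_ooZ; split => [x|x /xa h||].
- by move=> /xa h; apply: is_derive_sqrt_U_lt; rewrite // gt_eqF.
- apply: cvgN; apply: cvgM; first exact: cvg_cst.
  apply: cvgM; first exact: continuous_Tdivr.
  apply: cvgV; last exact: continuous_sqrtBl.
  by rewrite gt_eqF// sqrtr_gt0 subr_gt0.
- exact: cvg_at_right_filter (cF _).
- exact: cvg_at_left_filter (cF _).
Qed.

Section two_endpoints.
Variables s p : R.
Hypothesis sp : 0 < s < p.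
Let q1 t : R := Num.sqrt (t ^+ 2 - s ^+ 2).
Let q2 t : R := Num.sqrt (p ^+ 2 - t ^+ 2).

Let s0 : 0 < s. Proof. by case/andP: sp. Qed.
Let p0 : 0 < p. Proof. by case/andP: sp => ? /(lt_trans _); apply. Qed.
Let ltsp : s < p. Proof. by case/andP: sp. Qed.
Let D := p ^+ 2 - s ^+ 2.
Let D0 : 0 < D. Proof. exact: sqrBB_gt0. Qed.

Let tsp t : s < t < p ->
  [/\ 0 < t, 0 < t ^+ 2 - s ^+ 2, 0 < p ^+ 2 - t ^+ 2, 0 < q1 t & 0 < q2 t].
Proof.
move=> /andP[st tp]; have t0 := lt_trans s0 st.
have h1 : 0 < t ^+ 2 - s ^+ 2 by apply: sqrBB_gt0; rewrite s0.
have h2 : 0 < p ^+ 2 - t ^+ 2 by apply: sqrBB_gt0; rewrite t0.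
by split; rewrite ?sqrtr_gt0.
Qed.

Let cq1 : continuous q1. Proof. exact: continuous_sqrtBr. Qed.
Let cq2 : continuous q2. Proof. exact: continuous_sqrtBl. Qed.

(** In the variable $t^{-2}$ the weight becomes that of the arcsine law. *)
Lemma primitive_abel2_0 :
  primitive_oo (fun t => (t * q1 t * q2 t)^-1)
    (fun t => (2 * s * p)^-1 *
       arcsine ((p ^+ 2 + s ^+ 2 - 2 * s ^+ 2 * p ^+ 2 * (t ^+ 2)^-1) / D)) s p.
Proof.
have t20 t : s <= t <= p -> t ^+ 2 != 0.
  by move=> /andP[st _]; rewrite expf_neq0// gt_eqF// (lt_le_trans s0).
apply: eq_primitive_oo; last first.
  apply: (@primitive_arcsine _
    (fun t => (p ^+ 2 + s ^+ 2 - 2 * s ^+ 2 * p ^+ 2 * (t ^+ 2)^-1) / D)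
    (fun t => 4 * s ^+ 2 * p ^+ 2 * (t ^+ 3)^-1 / D) (2 * s * p)^-1 s p _ ltsp).
  - move=> t /t20 t2; apply: cvgM; last exact: cvg_cst.
    apply: cvgB; first exact: cvg_cst.
    apply: cvgM; first exact: cvg_cst.
    by apply: cvgV => //; exact: exprn_continuous.
  - move=> t stp; have [t0 h1 h2 h3 h4] := tsp stp.
    have t2 : t ^+ 2 != 0 by rewrite expf_neq0// gt_eqF.
    split.
    + have := is_derive_mul (is_derive_cst (2 * s ^+ 2 * p ^+ 2) t 1)
        (@is_derive_inv _ (fun y => y ^+ 2) _ t t2 (is_derive_sqr t)).
      move/(is_deriveB (is_derive_cst (p ^+ 2 + s ^+ 2) t 1)) => h.
      have := is_derive_mul h (is_derive_cst D^-1 t 1).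
      by congr is_derive; rewrite /=; field; rewrite !gt_eqF.
    + apply: cvgM; last exact: cvg_cst.
      apply: cvgM; first exact: cvg_cst.
      apply: cvgV; first by rewrite expf_neq0// gt_eqF.
      exact: exprn_continuous.
    + rewrite ltr_pdivlMr// ltr_pdivrMr// mulN1r mul1r.
      have e1 : 0 < s ^+ 2 * p ^+ 2 * (t ^+ 2)^-1 - s ^+ 2.
        rewrite (_ : _ - _ = s ^+ 2 * (p ^+ 2 - t ^+ 2) / t ^+ 2); last by field; rewrite gt_eqF.
        by rewrite divr_gt0 ?mulr_gt0 ?exprn_gt0.
      have e2 : 0 < p ^+ 2 - s ^+ 2 * p ^+ 2 * (t ^+ 2)^-1.
        rewrite (_ : _ - _ = p ^+ 2 * (t ^+ 2 - s ^+ 2) / t ^+ 2); last by field; rewrite gt_eqF.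
        by rewrite divr_gt0 ?mulr_gt0 ?exprn_gt0.
      rewrite /D; set w := s ^+ 2 * _ * _ in e1 e2.
      have -> : 2 * s ^+ 2 * p ^+ 2 * (t ^+ 2)^-1 = 2 * w by rewrite /w !mulrA.
      by apply/andP; split; lra.
move=> t stp; have [t0 h1 h2 h3 h4] := tsp stp.
have -> : 1 - ((p ^+ 2 + s ^+ 2 - 2 * s ^+ 2 * p ^+ 2 * (t ^+ 2)^-1) / D) ^+ 2 =
    (2 * s * p / (t ^+ 2 * D)) ^+ 2 * ((t ^+ 2 - s ^+ 2) * (p ^+ 2 - t ^+ 2)).
  by rewrite /D; field; rewrite (gt_eqF t0) -/D gt_eqF.
rewrite sqrtrM ?sqr_ge0// sqrtr_sqr ger0_norm; last first.
  by rewrite divr_ge0 ?mulr_ge0 ?sqr_ge0 ?ltW.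
rewrite sqrtrM ?ltW// -/(q1 t) -/(q2 t).
by field; rewrite !gt_eqF.
Qed.

(** Here it is the variable $t^2$ that follows the arcsine law. *)
Lemma primitive_abel2_1 :
  primitive_oo (fun t => (t / s) * (t / p) / (t * q1 t * q2 t))
    (fun t => (2 * s * p)^-1 * arcsine ((2 * t ^+ 2 - (p ^+ 2 + s ^+ 2)) / D)) s p.
Proof.
apply: eq_primitive_oo; last first.
  apply: (@primitive_arcsine _ (fun t => (2 * t ^+ 2 - (p ^+ 2 + s ^+ 2)) / D)
    (fun t => 4 * t / D) (2 * s * p)^-1 s p _ ltsp).
  - move=> t _; apply: cvgM; last exact: cvg_cst.
    apply: cvgB; last exact: cvg_cst.
    by apply: cvgM; [exact: cvg_cst|exact: exprn_continuous].
  - move=> t stp; have [t0 h1 h2 h3 h4] := tsp stp; split.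
    + have := is_deriveB (is_derive_mul (is_derive_cst (2 : R) t 1) (is_derive_sqr t))
        (is_derive_cst (p ^+ 2 + s ^+ 2) t 1).
      move=> h; have := is_derive_mul h (is_derive_cst D^-1 t 1).
      by congr is_derive; rewrite /=; field; rewrite !gt_eqF.
    + apply: cvgM; last exact: cvg_cst.
      by apply: cvgM; [exact: cvg_cst|exact: cvg_id].
    + by rewrite ltr_pdivlMr// ltr_pdivrMr// mulN1r mul1r /D; apply/andP; split; lra.
move=> t stp; have [t0 h1 h2 h3 h4] := tsp stp.
have -> : 1 - ((2 * t ^+ 2 - (p ^+ 2 + s ^+ 2)) / D) ^+ 2 =
    (2 / D) ^+ 2 * ((t ^+ 2 - s ^+ 2) * (p ^+ 2 - t ^+ 2)).
  by rewrite /D; field; rewrite -/D gt_eqF.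
rewrite sqrtrM ?sqr_ge0// sqrtr_sqr ger0_norm ?divr_ge0 ?ltW//.
rewrite sqrtrM ?ltW// -/(q1 t) -/(q2 t).
by field; rewrite !gt_eqF.
Qed.

(** With $t = s\cosh\alpha = p\cos\beta$ and $\gamma = \alpha + i\beta$ one has
    $T_n(t/s)T_n(t/p) = \Re\cosh(n\gamma)$ and the weight times $\sinh\gamma$ is
    a multiple of $d\gamma$; so the difference of the products of order $n+1$
    and $n-1$, namely $2\Re(\sinh(n\gamma)\sinh\gamma)$, integrates to
    $\Im\cosh(n\gamma) = \sinh(n\alpha)\sin(n\beta)$, up to a constant. *)
Lemma primitive_abel2_step n :
  primitive_oo (fun t => (T n.+2 (t / s) * T n.+2 (t / p) - T n (t / s) * T n (t / p))
      / (t * q1 t * q2 t))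
    (fun t => - (2 / (n.+1%:R * s ^+ 2 * p ^+ 2)) *
      ((q1 t * U n.+1 (t / s)) * (q2 t * U n.+1 (t / p)))) s p.
Proof.
have cF : continuous (fun t => (q1 t * U n.+1 (t / s)) * (q2 t * U n.+1 (t / p))).
  by move=> t; apply: cvgM; apply: cvgM; [exact: cq1|exact: continuous_Udivr|
    exact: cq2|exact: continuous_Udivr].
pose f t := n.+1%:R * s * (T n.+1 (t / s) / q1 t) * (q2 t * U n.+1 (t / p))
  + q1 t * U n.+1 (t / s) * - (n.+1%:R * p * (T n.+1 (t / p) / q2 t)).
apply: (@eq_primitive_oo _ (fun t => - (2 / (n.+1%:R * s ^+ 2 * p ^+ 2)) * f t)).
  move=> t stp; have [t0 h1 h2 h3 h4] := tsp stp.
  rewrite !(chebyshevTS n.+1) !(chebyshevT_pred n) /f.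
  have e1 : q1 t ^+ 2 = t ^+ 2 - s ^+ 2 by rewrite sqr_sqrtr// ltW.
  have e2 : q2 t ^+ 2 = p ^+ 2 - t ^+ 2 by rewrite sqr_sqrtr// ltW.
  have -> : (t / s) ^+ 2 - 1 = q1 t ^+ 2 / s ^+ 2 by rewrite e1; field; rewrite gt_eqF.
  have -> : (t / p) ^+ 2 - 1 = - q2 t ^+ 2 / p ^+ 2 by rewrite e2; field; rewrite gt_eqF.
  field; rewrite (gt_eqF s0) (gt_eqF p0) (gt_eqF t0) (gt_eqF h3) (gt_eqF h4) /=.
  by rewrite nat1r pnatr_eq0.
apply: primitive_ooZ; split => [t stp|t stp||].
- have [t0 h1 h2 h3 h4] := tsp stp; apply: is_derive_mul.
    by apply: is_derive_sqrt_U_gt; case/andP: stp => ->; rewrite s0.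
  by apply: is_derive_sqrt_U_lt; [rewrite gt_eqF|rewrite -subr_gt0].
- have [t0 h1 h2 h3 h4] := tsp stp; apply: cvgD.
    apply: cvgM; last by apply: cvgM; [exact: cq2|exact: continuous_Udivr].
    apply: cvgM; first exact: cvg_cst.
    apply: cvgM; first exact: continuous_Tdivr.
    by apply: cvgV; [rewrite gt_eqF|exact: cq1].
  apply: cvgM; first by apply: cvgM; [exact: cq1|exact: continuous_Udivr].
  apply: cvgN; apply: cvgM; first exact: cvg_cst.
  apply: cvgM; first exact: continuous_Tdivr.
  by apply: cvgV; [rewrite gt_eqF|exact: cq2].
- exact: cvg_at_right_filter (cF _).
- exact: cvg_at_left_filter (cF _).
Qed.

End two_endpoints.

End primitives.

(** * Moments of the arcsine law *)

(** [walk k n] counts the $k$-step paths from $n$ to $0$ that are dictated by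
    $2 x T_n = T_{n+1} + T_{n-1}$, where $T_{-1} = T_1$ doubles the step out of
    $0$. It is the mean of $(2x)^k T_n(x)$ for the arcsine law, because $T_n$ has
    mean $0$ unless $n = 0$. *)
Fixpoint walk (k n : nat) {struct k} : nat :=
  if k is k'.+1 then
    if n is n'.+1 then (walk k' n'.+2 + walk k' n')%N else (2 * walk k' 1)%N
  else n == 0%N.

(** A path from $n$ to $0$ has at least $n$ steps, and as many as $n$ modulo 2. *)
Lemma walk_eq0 k n : (k < n)%N || odd (k + n)%N -> walk k n = 0%N.
Proof.
elim: k n => [|k ih] [|n]//=.
  by move=> h; rewrite ih//; lia.
by move=> h; rewrite !ih//; lia.
Qed.

(** Unfolding the reflection at $0$, these are the paths on the integers from $n$
    to $0$, and $m$ of their steps go up. *)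
Lemma walk_bin m n : walk (2 * m + n)%N n = 'C(2 * m + n, m).
Proof.
move: {2}(2 * m + n)%N (leqnn (2 * m + n)%N) => k.
elim: k m n => [|k ih] m n hk.
  by have [-> ->] : m = 0%N /\ n = 0%N by lia.
case: n hk => [|n] hk.
  case: m hk => [|m] hk //.
  have -> : (2 * m.+1 + 0 = (2 * m + 1).+1)%N by lia.
  rewrite /= ih; last by lia.
  rewrite binS mul2n -addnn; congr (_ + _)%N.
  by rewrite -[RHS]bin_sub; [congr 'C(_, _); lia|lia].
have -> : (2 * m + n.+1 = (2 * m + n).+1)%N by lia.
rewrite /=; case: m hk => [|m] hk.
  by rewrite walk_eq0 ?ltnS ?leqnSn// ih ?bin0//; lia.
rewrite ih; last by lia.
have -> : (2 * m.+1 + n = 2 * m + n.+2)%N by lia.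
by rewrite ih ?binS 1?addnC//; lia.
Qed.

Section moments.
Variable R : realType.
Notation mu := (@lebesgue_measure R).
Notation T n x := (chebyshevT R n).[x].
Implicit Types (n k : nat) (a z : R).

Lemma RintegrableZ (D : set R) (c : R) (f : R -> R) : measurable D ->
  mu.-integrable D (EFin \o f) -> mu.-integrable D (EFin \o (fun x => c * f x)).
Proof. by move=> mD h; exact: (@integrableZl _ _ _ mu D mD c _ h). Qed.

Lemma RintegrableD (D : set R) (f g : R -> R) : measurable D ->
  mu.-integrable D (EFin \o f) -> mu.-integrable D (EFin \o g) ->
  mu.-integrable D (EFin \o (fun x => f x + g x)).
Proof. by move=> mD hf hg; exact: (@integrableD _ _ _ mu D mD _ _ hf hg). Qed.

Lemma abel_integral0 a : 0 < a ->
  mu.-integrable `]-a, a[ (EFin \o (fun z => (Num.sqrt (a ^+ 2 - z ^+ 2))^-1)) /\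
  \int[mu]_(z in `]-a, a[) (Num.sqrt (a ^+ 2 - z ^+ 2))^-1 = pi.
Proof.
move=> a0; have aa : - a < a by lra.
have pa := primitive_abel0 a0.
have dom x : - a < x < a -> `|(Num.sqrt (a ^+ 2 - x ^+ 2))^-1| <=
    (Num.sqrt (a ^+ 2 - x ^+ 2))^-1.
  by move=> _; rewrite ger0_norm// invr_ge0 sqrtr_ge0.
have [h1 ->] := FTC2_oo aa dom pa pa.
split=> //; rewrite !mul1r mulNr divff ?gt_eqF// arcsine1 arcsineN1.
by rewrite opprK -splitr.
Qed.

Lemma abel_integralT n a : 0 < a ->
  let f z := T n (z / a) / Num.sqrt (a ^+ 2 - z ^+ 2) in
  mu.-integrable `]-a, a[ (EFin \o f) /\
  \int[mu]_(z in `]-a, a[) f z = pi * (n == 0%N)%:R.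
Proof.
move=> a0; have aa : - a < a by lra.
have pa := primitive_abel0 a0.
case: n => [|n] f.
  have -> : f = (fun z => (Num.sqrt (a ^+ 2 - z ^+ 2))^-1).
    by apply/funext => z; rewrite /f chebyshevT0 mul1r.
  by rewrite mulr1; exact: abel_integral0.
have dom x : - a < x < a -> `|f x| <= (Num.sqrt (a ^+ 2 - x ^+ 2))^-1.
  move=> xa; rewrite /f normrM [X in _ * X]ger0_norm ?invr_ge0 ?sqrtr_ge0//.
  rewrite ler_piMl ?invr_ge0 ?sqrtr_ge0// chebyshevT_le1//.
  by rewrite ler_norml ler_pdivlMr// ler_pdivrMr// mulN1r mul1r !ltW//; case/andP: xa.
have [h1 ->] := FTC2_oo aa dom (primitive_abelT n a0) pa.
split=> //; rewrite sqrrN !subrr !sqrtr0 !mul0r !mulr0 subrr //.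
Qed.

Lemma abel_moment k n a : 0 < a ->
  let f z := z ^+ k * (T n (z / a) / Num.sqrt (a ^+ 2 - z ^+ 2)) in
  mu.-integrable `]-a, a[ (EFin \o f) /\
  \int[mu]_(z in `]-a, a[) f z = pi * ((a / 2) ^+ k * (walk k n)%:R).
Proof.
move=> a0; elim: k n => [|k ih] n.
  move=> f; have [h1 h2] := abel_integralT n a0; split.
    by apply: eq_integrable h1 => // z _; rewrite /f /= expr0 mul1r.
  by rewrite expr0 mul1r -h2; apply: eq_Rintegral => z _; rewrite /f expr0 mul1r.
case: n => [|n] f.
  have -> : f = (fun z => a * (z ^+ k * (T 1 (z / a) / Num.sqrt (a ^+ 2 - z ^+ 2)))).
    apply/funext => z; rewrite /f exprS chebyshevT0 chebyshevT1.
    by move: (Num.sqrt _)^-1 => q; field; rewrite gt_eqF.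
  have [h1 h2] := ih 1%N; split; first exact: RintegrableZ.
  by rewrite RintegralZl// h2 exprS -[walk k.+1 0]/(2 * walk k 1)%N natrM; field.
have -> : f = (fun z =>
    (a / 2) * (z ^+ k * (T n.+2 (z / a) / Num.sqrt (a ^+ 2 - z ^+ 2)))
  + (a / 2) * (z ^+ k * (T n (z / a) / Num.sqrt (a ^+ 2 - z ^+ 2)))).
  apply/funext => z; rewrite /f exprS chebyshevTSS.
  move: (T n.+1 _) (T n _) (Num.sqrt _)^-1 => t1 t0 q.
  by field; rewrite gt_eqF.
have [h1 h2] := ih n.+2; have [h3 h4] := ih n.
split; first by apply: RintegrableD => //; exact: RintegrableZ.
rewrite RintegralD//; [|exact: RintegrableZ|exact: RintegrableZ].
rewrite !RintegralZl// h2 h4 exprS -[walk k.+1 n.+1]/(walk k n.+2 + walk k n)%N natrD.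
by ring.
Qed.

End moments.

(** * Bessel functions as Fourier integrals *)

Section bessel.
Variable R : realType.
Notation mu := (@lebesgue_measure R).
Notation T n x := (chebyshevT R n).[x].
Implicit Types (n k : nat) (a b x z : R).

Definition besselJ_coeff (nu : nat) x (m : nat) : R :=
  (-1) ^+ m / (m`! * (m + nu)`!)%:R * (x / 2) ^+ (2 * m + nu).

Lemma exp_partial_sum n x : 0 <= x -> \sum_(k < n) x ^+ k / k`!%:R <= expR x.
Proof.
move=> x0; have -> : \sum_(k < n) x ^+ k / k`!%:R = series (exp_coeff x) n.
  by rewrite /series /= big_mkord.
rewrite /expR; apply: nondecreasing_cvgn_le; last exact: is_cvg_series_exp_coeff.
apply/nondecreasing_seqP => m; rewrite /series/= big_nat_recr//= lerDl.
by rewrite /exp_coeff/= divr_ge0 ?exprn_ge0.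
Qed.

(** An entire function given by its power series, of the kind of $\cos$ and
    $\sin$. *)
Variables (E : R -> R) (e : nat -> R).
Hypothesis cE : continuous E.
Hypothesis E_le1 : forall x, `|E x| <= 1.
Hypothesis E_series : forall x, series (fun k => e k / k`!%:R * x ^+ k) @ \oo --> E x.
Hypothesis e_le1 : forall k, `|e k| <= 1.
Hypothesis eSS : forall k, e k.+2 = - e k.

Let eD2 nu m : e (2 * m + nu) = (-1) ^+ m * e nu.
Proof.
elim: m => [|m ih]; first by rewrite mul1r.
by rewrite (_ : (2 * m.+1 + nu = (2 * m + nu).+2)%N) ?eSS ?ih ?exprS ?mulN1r ?mulNr//; lia.
Qed.

Let term nu k a b := e k / k`!%:R * b ^+ k * (pi * ((a / 2) ^+ k * (walk k nu)%:R)).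

Let term_sum nu a b M : \sum_(k < 2 * M + nu) term nu k a b =
  pi * (e nu * series (besselJ_coeff nu (b * a)) M).
Proof.
have t0 k : (k < nu)%N || odd (k + nu) -> term nu k a b = 0.
  by move=> h; rewrite /term walk_eq0// !mulr0.
elim: M => [|M ih].
  rewrite muln0 add0n /series/= big_geq// !mulr0 big1// => k _.
  by rewrite t0// ltn_ord.
rewrite (_ : (2 * M.+1 + nu = (2 * M + nu).+2)%N); last by lia.
rewrite !big_ord_recr/= ih [X in _ + X = _]t0 ?addr0; last by lia.
rewrite /series/= big_nat_recr//= !mulrDr; congr (_ + _).
rewrite /term eD2 walk_bin /besselJ_coeff.
have <- : ('C(2 * M + nu, M) * (M`! * (M + nu)`!))%N = (2 * M + nu)`!.
  by rewrite -(@bin_fact (2 * M + nu) M); [congr (_ * (_ * _`!))%N; lia|lia].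
rewrite !natrM.
have c0 : 'C(2 * M + nu, M)%:R != 0 :> R by rewrite pnatr_eq0 -lt0n bin_gt0; lia.
rewrite !expr_div_n exprMn.
have f1 : (M`!)%:R != 0 :> R by rewrite pnatr_eq0 -lt0n fact_gt0.
have f2 : ((M + nu)`!)%:R != 0 :> R by rewrite pnatr_eq0 -lt0n fact_gt0.
have f3 : 2 ^+ (2 * M + nu) != 0 :> R by rewrite expf_neq0.
by field; rewrite c0 f1 f2 f3.
Qed.

(** The series of [E] may be integrated term by term, as its partial sums are
    bounded by $e^{|b| a}$. The moment of order $k$ is zero unless
    $k = 2m + \nu$; then it contains the binomial coefficient $\binom{k}{m}$,
    which turns $1/k!$ into the coefficient $1/(m!\,(m+\nu)!)$ of $J_\nu$. *)
Lemma chebyshev_series_integral nu a b : 0 < a ->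
  e nu * series (besselJ_coeff nu (b * a)) M @[M --> \oo] -->
  (\int[mu]_(z in `]-a, a[) (E (b * z) * (T nu (z / a) / Num.sqrt (a ^+ 2 - z ^+ 2)))) / pi.
Proof.
move=> a0.
pose w z := T nu (z / a) / Num.sqrt (a ^+ 2 - z ^+ 2).
pose S n z := \sum_(k < n) (e k / k`!%:R * (b * z) ^+ k).
have [iw _] := abel_integralT nu a0; rewrite -/w in iw.
have iSn n : mu.-integrable `]-a, a[ (EFin \o (fun z => S n z * w z)) /\
    \int[mu]_(z in `]-a, a[) (S n z * w z) = \sum_(k < n) term nu k a b.
  elim: n => [|n [ih1 ih2]].
    have -> : (fun z => S 0 z * w z) = cst 0.
      by apply/funext => z; rewrite /S big_ord0 mul0r.
    rewrite big_ord0 /cst Rintegral_cst// mul0r; split => //.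
    exact: integrable0.
  have -> : (fun z => S n.+1 z * w z) =
      (fun z => S n z * w z + (e n / n`!%:R * b ^+ n) * (z ^+ n * w z)).
    by apply/funext => z; rewrite /S big_ord_recr/= mulrDl exprMn !mulrA.
  have [h1 h2] := abel_moment n nu a0.
  have h3 := RintegrableZ (e n / n`!%:R * b ^+ n) (measurable_itv _) h1.
  split; first exact: RintegrableD.
  by rewrite RintegralD// ih2 RintegralZl// h2 big_ord_recr.
pose I : set R := `]-a, a[%classic.
have cvS : (fun n : nat => \int[mu]_(z in I) (S n z * w z)%R%:E)%E @ \oo -->
    (\int[mu]_(z in I) (E (b * z) * w z)%R%:E)%E.
  apply: (@dominated_cvg _ _ _ mu _ _ _ _
    (fun z => (expR (`|b| * a) * (Num.sqrt (a ^+ 2 - z ^+ 2))^-1)%:E)) => //.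
  - exact: measurable_itv.
  - by move=> n; have [/measurable_int] := iSn n.
  - move=> z _; apply: cvg_EFin; first exact: nearW.
    apply: cvgM; last exact: cvg_cst.
    rewrite (_ : (fun n => S n z) = series (fun k => e k / k`!%:R * (b * z) ^+ k)).
      exact: E_series.
    by apply/funext => n; rewrite /series/= big_mkord.
  - exact: (RintegrableZ _ (measurable_itv _) (abel_integral0 a0).1).
  - move=> n z; rewrite /I /= in_itv/= => /andP[z1 z2].
    have za : `|z| <= a by rewrite ler_norml !ltW.
    rewrite lee_fin normrM; apply: ler_pM => //.
      apply: (le_trans (ler_norm_sum _ _ _)).
      apply: (@le_trans _ _ (\sum_(k < n) (`|b| * a) ^+ k / k`!%:R)).
        apply: ler_sum => k _; rewrite 2!normrM normfV normr_nat normrX -mulrA.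
        rewrite -[leRHS]mul1r [_^-1 * _]mulrC.
        apply: ler_pM => //.
        rewrite ler_pM2r ?invr_gt0 ?ltr0n ?fact_gt0//.
        by apply: lerXn2r; rewrite ?nnegrE ?mulr_ge0 ?(ltW a0)// normrM ler_wpM2l.
      by apply: exp_partial_sum; rewrite mulr_ge0// ltW.
    rewrite /w normrM [X in _ * X]ger0_norm ?invr_ge0 ?sqrtr_ge0//.
    rewrite ler_piMl ?invr_ge0 ?sqrtr_ge0// chebyshevT_le1//.
    by rewrite normrM normfV (gtr0_norm a0) ler_pdivrMr// mul1r.
have cvR : \sum_(k < n) term nu k a b @[n --> \oo] -->
    \int[mu]_(z in `]-a, a[) (E (b * z) * w z).
  have iE : mu.-integrable `]-a, a[ (EFin \o (fun z => E (b * z) * w z)).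
    apply: (le_integrable _ _ _ iw) => //.
      apply/measurable_EFinP; apply: measurable_funM.
        apply: measurable_funTS; apply: continuous_measurable_fun.
        by apply: (@continuous_fun_comp _ (fun z => b * z)) => //; exact: mulrl_continuous.
      by move/measurable_int : iw => /measurable_EFinP.
    by move=> z _; rewrite lee_fin normrM ler_piMl.
  have := cvS; rewrite -(fineK (integrable_fin_num _ iE)) //.
  move/fine_cvg.
  rewrite (_ : (fun n => \sum_(k < n) term nu k a b) =
    (fine \o (fun n : nat => \int[mu]_(z in I) (S n z * w z)%R%:E)%E)) //.
  by apply/funext => n; have [_ <-] := iSn n.
have sub : ((2 * M + nu)%N @[M --> \oo] --> \oo).
  apply: (@cvg_comp _ _ _ (fun M => 2 * M)%N (fun M => M + nu)%N _ (\oo : set_system nat)).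
    exact: cvg_mulnl.
  exact: cvg_addnr.
have := cvg_comp _ _ sub cvR; move/(cvgM (cvg_cst pi^-1)).
rewrite mulrC.
rewrite (_ : (fun M => e nu * series (besselJ_coeff nu (b * a)) M) = (fun M => pi^-1 *
  ((fun n => \sum_(k < n) term nu k a b) \o (fun M => 2 * M + nu)%N) M)) //.
by apply/funext => M /=; rewrite term_sum mulKf// gt_eqF// pi_gt0.
Qed.

End bessel.

Section bessel_cos_sin.
Variable R : realType.
Notation mu := (@lebesgue_measure R).
Notation T n x := (chebyshevT R n).[x].
Implicit Types (n k : nat) (a b x z : R).

(** The real and imaginary parts of $i^n$. *)
Definition re_expi n : R := (~~ odd n)%:R * (-1) ^+ n./2.
Definition im_expi n : R := (odd n)%:R * (-1) ^+ n.-1./2.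

Let re_expi_le1 n : `|re_expi n| <= 1.
Proof. by rewrite normrM normrX normrN1 expr1n mulr1 normr_nat; case: odd. Qed.

Let im_expi_le1 n : `|im_expi n| <= 1.
Proof. by rewrite normrM normrX normrN1 expr1n mulr1 normr_nat; case: odd. Qed.

Let re_expiSS n : re_expi n.+2 = - re_expi n.
Proof. by rewrite /re_expi /= negbK exprS mulN1r mulrN. Qed.

Let im_expiSS n : im_expi n.+2 = - im_expi n.
Proof.
by case: n => [|n]; rewrite /im_expi /= ?mul0r ?oppr0// negbK exprS mulN1r mulrN.
Qed.

Let cos_series x : series (fun k => re_expi k / k`!%:R * x ^+ k) @ \oo --> cos x.
Proof.
rewrite (_ : (fun k => _) = cos_coeff x); first by rewrite unlock; exact: is_cvg_series_cos_coeff.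
by apply/funext => k; rewrite cos_coeffE.
Qed.

Let sin_series x : series (fun k => im_expi k / k`!%:R * x ^+ k) @ \oo --> sin x.
Proof.
rewrite (_ : (fun k => _) = sin_coeff x); first by rewrite unlock; exact: is_cvg_series_sin_coeff.
by apply/funext => k; rewrite sin_coeffE.
Qed.

Let norm_cos_le1 x : `|cos x| <= 1.
Proof. by rewrite ler_norml cos_geN1 cos_le1. Qed.

Let norm_sin_le1 x : `|sin x| <= 1.
Proof. by rewrite ler_norml sin_geN1 sin_le1. Qed.

Let cvg_cos := @chebyshev_series_integral R cos re_expi
  (@continuous_cos R) norm_cos_le1 cos_series re_expi_le1 re_expiSS.
Let cvg_sin := @chebyshev_series_integral R sin im_expi
  (@continuous_sin R) norm_sin_le1 sin_series im_expi_le1 im_expiSS.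

(** The partial sums are those of the preceding Fourier integral up to a nonzero
    factor: cosine for even orders, sine for odd ones. *)
Lemma cvg_besselJ nu x : series (besselJ_coeff nu x) @ \oo --> besselJ nu x.
Proof.
suff : exists c : R, c != 0 /\ exists l : R,
    (fun M => c * series (besselJ_coeff nu x) M) @ \oo --> l.
  move=> [c [c0 [l cl]]].
  apply/cvg_ex; exists (c^-1 * l).
  rewrite (_ : series _ = (fun M => c^-1 * (c * series (besselJ_coeff nu x) M))).
    by apply: cvgM => //; exact: cvg_cst.
  by apply/funext => M; rewrite mulKf.
have [nu_odd|nu_even] := boolP (odd nu).
- exists (im_expi nu); split; first by rewrite /im_expi nu_odd mul1r signr_eq0.
  by eexists; have := @cvg_sin nu 1 x ltr01; rewrite mulr1; apply.
- exists (re_expi nu); split; first by rewrite /re_expi nu_even mul1r signr_eq0.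
  by eexists; have := @cvg_cos nu 1 x ltr01; rewrite mulr1; apply.
Qed.

Lemma cos_chebyshev_integral nu a b : 0 < a ->
  \int[mu]_(z in `]-a, a[) (cos (b * z) * (T nu (z / a) / Num.sqrt (a ^+ 2 - z ^+ 2))) =
  pi * (re_expi nu * besselJ nu (b * a)).
Proof.
move=> a0; have h := @cvg_cos nu a b a0.
have h2 : (fun M => re_expi nu * series (besselJ_coeff nu (b * a)) M) @ \oo -->
    re_expi nu * besselJ nu (b * a).
  by apply: cvgM; [exact: cvg_cst|exact: cvg_besselJ].
by rewrite -(cvg_unique _ h h2)// mulrC divfK// gt_eqF// pi_gt0.
Qed.

Lemma sin_chebyshev_integral nu a b : 0 < a ->
  \int[mu]_(z in `]-a, a[) (sin (b * z) * (T nu (z / a) / Num.sqrt (a ^+ 2 - z ^+ 2))) =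
  pi * (im_expi nu * besselJ nu (b * a)).
Proof.
move=> a0; have h := @cvg_sin nu a b a0.
have h2 : (fun M => im_expi nu * series (besselJ_coeff nu (b * a)) M) @ \oo -->
    im_expi nu * besselJ nu (b * a).
  by apply: cvgM; [exact: cvg_cst|exact: cvg_besselJ].
by rewrite -(cvg_unique _ h h2)// mulrC divfK// gt_eqF// pi_gt0.
Qed.

End bessel_cos_sin.

(** * The orthogonality relation of Cormack *)

Section abel_inversion_kernel.
Variable R : realType.
Notation mu := (@lebesgue_measure R).
Notation T n x := (chebyshevT R n).[x].
Implicit Types (n : nat) (s p t x b : R).

(** A crude bound outside of $[-1, 1]$, where the argument $t/s$ of the inversion
    kernel lies. *)
Lemma chebyshevT_bound n b x : 1 <= b -> `|x| <= b -> `|T n x| <= (2 * b + 1) ^+ n.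
Proof.
move=> b1 xb; have b0 : 0 <= b by rewrite (le_trans ler01).
elim/ltn_ind: n => -[_|[_|n ih]].
- by rewrite chebyshevT0 normr1.
- by rewrite chebyshevT1 (le_trans xb)//; lra.
rewrite chebyshevTSS (le_trans (ler_normB _ _))//.
have h1 := ih n.+1 (leqnn _); have h0 := ih n (leqnSn _).
apply: (@le_trans _ _ (2 * b * (2 * b + 1) ^+ n.+1 + (2 * b + 1) ^+ n)).
  apply: lerD => //; rewrite normrM; apply: ler_pM => //.
  by rewrite normrM ger0_norm// ler_pM2l.
rewrite [leRHS]exprS [leRHS]mulrDl mul1r lerD2l exprS.
by rewrite ler_peMl ?exprn_ge0//; lra.
Qed.

Let weight s p t := (t * Num.sqrt (t ^+ 2 - s ^+ 2) * Num.sqrt (p ^+ 2 - t ^+ 2))^-1.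

Let weight_ge0 s p t : 0 < s < t -> 0 <= weight s p t.
Proof.
move=> /andP[s0 st].
by rewrite invr_ge0 !mulr_ge0 ?sqrtr_ge0// ltW// (lt_trans s0).
Qed.

Lemma abel2_integral0 s p : 0 < s < p ->
  mu.-integrable `]s, p[ (EFin \o weight s p) /\
  \int[mu]_(t in `]s, p[) weight s p t = pi / (2 * s * p).
Proof.
move=> sp; have /andP[s0 ltsp] := sp; have p0 := lt_trans s0 ltsp.
have dom t : s < t < p -> `|weight s p t| <= weight s p t.
  by move=> /andP[st _]; rewrite ger0_norm// weight_ge0// s0.
have pr := primitive_abel2_0 sp.
have [h1 ->] := FTC2_oo ltsp dom pr pr; split => //.
have D0 := sqrBB_gt0 sp.
rewrite (_ : (p ^+ 2 + s ^+ 2 - 2 * s ^+ 2 * p ^+ 2 * (p ^+ 2)^-1) / (p ^+ 2 - s ^+ 2) = 1).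
  rewrite (_ : (p ^+ 2 + s ^+ 2 - 2 * s ^+ 2 * p ^+ 2 * (s ^+ 2)^-1) / (p ^+ 2 - s ^+ 2) = -1).
    by rewrite arcsine1 arcsineN1; field; rewrite !gt_eqF.
  by field; rewrite !gt_eqF.
by field; rewrite !gt_eqF.
Qed.

(** Cormack's identity. The step from $n$ to $n + 2$ adds the integral of an
    exact derivative, whose primitive carries the factor
    $\sqrt{t^2 - s^2}\sqrt{p^2 - t^2}$ and so vanishes at both ends. *)
Lemma abel2_integral n s p : 0 < s < p ->
  let f t := T n (t / s) * T n (t / p) * weight s p t in
  mu.-integrable `]s, p[ (EFin \o f) /\
  \int[mu]_(t in `]s, p[) f t = pi / (2 * s * p).
Proof.
move=> sp; have /andP[s0 ltsp] := sp; have p0 := lt_trans s0 ltsp.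
have D0 := sqrBB_gt0 sp.
elim/ltn_ind: n => -[_|[_|n ih]] f.
- have -> : f = weight s p by apply/funext => t; rewrite /f !chebyshevT0 !mul1r.
  exact: abel2_integral0.
- have fE t : s < t < p -> (t / s) * (t / p) * weight s p t = f t.
    by move=> _; rewrite /f !chebyshevT1.
  have pr := eq_primitive_oo fE (primitive_abel2_1 sp).
  have dom t : s < t < p -> `|f t| <= f t.
    move=> /andP[st tp]; have t0 := lt_trans s0 st.
    rewrite ger0_norm// /f !chebyshevT1 mulr_ge0// ?weight_ge0 ?s0//.
    by rewrite mulr_ge0// divr_ge0// ltW.
  have [h1 ->] := FTC2_oo ltsp dom pr pr; split => //.
  rewrite (_ : (2 * p ^+ 2 - (p ^+ 2 + s ^+ 2)) / (p ^+ 2 - s ^+ 2) = 1).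
    rewrite (_ : (2 * s ^+ 2 - (p ^+ 2 + s ^+ 2)) / (p ^+ 2 - s ^+ 2) = -1).
      by rewrite arcsine1 arcsineN1; field; rewrite !gt_eqF.
    by field; rewrite !gt_eqF.
  by field; rewrite !gt_eqF.
pose d t := (T n.+2 (t / s) * T n.+2 (t / p) - T n (t / s) * T n (t / p)) * weight s p t.
have pd := primitive_abel2_step sp n; rewrite -/d in pd.
(* [t / s] is at most [p / s] and [t / p] at most 1 on the interval. *)
pose C := (2 * (p / s) + 1) ^+ n.+2 + (2 * (p / s) + 1) ^+ n.
have pw := primitive_ooZ C (primitive_abel2_0 sp).
have dom t : s < t < p -> `|d t| <= C * weight s p t.
  move=> /andP[st tp]; have t0 := lt_trans s0 st.
  have ts : `|t / s| <= p / s.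
    by rewrite ger0_norm ?divr_ge0 ?ltW// ltr_pM2r ?invr_gt0.
  have tp1 : `|t / p| <= 1.
    by rewrite ger0_norm ?divr_ge0 ?ltW// ltr_pdivrMr// mul1r.
  have ps : 1 <= p / s by rewrite ler_pdivlMr// mul1r ltW.
  have Tle m : `|T m (t / s) * T m (t / p)| <= (2 * (p / s) + 1) ^+ m.
    rewrite normrM -[leRHS]mulr1; apply: ler_pM => //; last exact: chebyshevT_le1.
    exact: chebyshevT_bound.
  rewrite normrM [X in _ * X]ger0_norm ?weight_ge0 ?s0//.
  rewrite ler_wpM2r ?weight_ge0 ?s0// (le_trans (ler_normB _ _))//.
  exact: lerD.
have [h1 h2] := FTC2_oo ltsp dom pd pw.
have [h3 h4] := ih n (leqnSn _).
have -> : f = (fun t => d t + T n (t / s) * T n (t / p) * weight s p t).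
  by apply/funext => t; rewrite /f /d; ring.
split; first exact: RintegrableD.
rewrite RintegralD// h2 h4 !subrr !sqrtr0 !mul0r !mulr0 subrr add0r //.
Qed.

End abel_inversion_kernel.

(** * Iterated integrals of real functions *)

Section fubini.
Variable R : realType.
Notation mu := (@lebesgue_measure R).
Implicit Types (f g w : R -> R) (h K : R * R -> R).

Lemma measurable_invr : measurable_fun setT (@GRing.inv R).
Proof.
rewrite (_ : @GRing.inv R = (fun x : R => x * (x ^+ 2) `^ (-1))).
  apply: measurable_funM => //.
  apply: (measurableT_comp (measurable_powR (-1))); exact: exprn_measurable.
apply/funext => x; rewrite powR_inv1 ?sqr_ge0//.
by have [->|x0] := eqVneq x 0; [rewrite invr0 mul0r|field].
Qed.

Lemma measurable_funV d (X : measurableType d) (D : set X) (f : X -> R) :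
  measurable_fun D f -> measurable_fun D (fun x => (f x)^-1).
Proof. by move=> mf; apply: (measurableT_comp measurable_invr). Qed.

Lemma measurable_fun_sqrt d (X : measurableType d) (D : set X) (f : X -> R) :
  measurable_fun D f -> measurable_fun D (fun x => Num.sqrt (f x)).
Proof.
move=> mf; apply: (measurableT_comp _ mf).
by apply: continuous_measurable_fun; exact: sqrt_continuous.
Qed.

Lemma measurable_fun_chebyshevT d (X : measurableType d) (D : set X) (f : X -> R) n :
  measurable_fun D f -> measurable_fun D (fun x => (chebyshevT R n).[f x]).
Proof.
move=> mf; apply: (measurableT_comp _ mf).
by apply: continuous_measurable_fun; exact: continuous_chebyshevT.
Qed.

Lemma ae_imply (P Q : R -> Prop) : (forall x, P x -> Q x) ->
  {ae mu, forall x, P x} -> {ae mu, forall x, Q x}.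
Proof. by move=> PQ; apply: (@filterS _ _ (ae_filter_ringOfSetsType mu)). Qed.

Lemma ae_imply2 (P Q S : R -> Prop) : (forall x, P x -> Q x -> S x) ->
  {ae mu, forall x, P x} -> {ae mu, forall x, Q x} -> {ae mu, forall x, S x}.
Proof. by move=> PQ; apply: (@filterS2 _ _ (ae_filter_ringOfSetsType mu)). Qed.

Lemma ae_eq_Rintegral (D : set R) f g : measurable D ->
  measurable_fun D f -> measurable_fun D g ->
  {ae mu, forall x, D x -> f x = g x} ->
  \int[mu]_(x in D) f x = \int[mu]_(x in D) g x.
Proof.
move=> mD mf mg fg; rewrite /Rintegral; congr fine.
apply: ae_eq_integral => //; try exact/measurable_EFinP.
by apply: ae_imply fg => x + Dx => /(_ Dx) ->.
Qed.

Lemma measurable_Rintegral_section h : measurable_fun setT h ->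
  measurable_fun setT (fun y => \int[mu]_x (h (x, y))).
Proof.
move=> mh; apply: (measurableT_comp (fine_measurable measurableT)).
have mEh : measurable_fun setT (EFin \o h) by exact/measurable_EFinP.
rewrite (_ : (fun y => _) = ((fun y => \int[mu]_x (EFin \o h)^\+ (x, y)) \-
    (fun y => \int[mu]_x (EFin \o h)^\- (x, y)))%E); last first.
  apply/funext => y; rewrite [LHS]integralE; congr (_ - _)%E.
    by apply: eq_integral => x _; rewrite !funeposE.
  by apply: eq_integral => x _; rewrite !funenegE.
apply: emeasurable_funB.
  apply: (@measurable_fun_fubini_tonelli_G _ _ _ _ R mu (EFin \o h)^\+%E).
    exact: measurable_funepos.
  by move=> p; exact: funepos_ge0.
apply: (@measurable_fun_fubini_tonelli_G _ _ _ _ R mu (EFin \o h)^\-%E).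
  exact: measurable_funeneg.
by move=> p; exact: funeneg_ge0.
Qed.

(** The Fubini theorem for the real-valued integral, with a factor of the outer
    variable: the inner integral may diverge where the factor vanishes. *)
Lemma Rfubini h w : measurable_fun setT h -> measurable_fun setT w ->
  (\int[mu]_x \int[mu]_y (`|w y * h (x, y)|)%:E < +oo)%E ->
  mu.-integrable setT (EFin \o (fun y => w y * \int[mu]_x h (x, y))) /\
  \int[mu]_y (w y * \int[mu]_x h (x, y)) = \int[mu]_x \int[mu]_y (w y * h (x, y)).
Proof.
move=> mh mw fin.
pose H (p : R * R) : \bar R := (w p.2 * h p)%:E.
have mH : measurable_fun setT H.
  apply/measurable_EFinP; apply: measurable_funM => //.
  exact: measurableT_comp.
have iH : (mu \x mu)%E.-integrable setT H by apply/integrable12ltyP.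
have aeG : {ae mu, forall y, (w y * \int[mu]_x h (x, y))%:E = fubini_G mu H y}.
  have := ae_integrable2 iH; apply: ae_imply => y iy.
  have hy : w y != 0 -> mu.-integrable setT (EFin \o (fun x => h (x, y))).
    move=> wy0; have := @integrableZl _ _ _ mu setT measurableT (w y)^-1 _ iy.
    apply: eq_integrable => // x _; rewrite /H /= -EFinM; congr EFin.
    by rewrite mulKf.
  rewrite /fubini_G /H /=; have [->|wy0] := eqVneq (w y) 0.
    rewrite mul0r -[LHS](@integral0 _ _ _ mu setT); apply: eq_integral => x _.
    by rewrite mul0r.
  rewrite -RintegralZl ?hy// /Rintegral fineK//.
  by apply: integrable_fin_num.
have aeF : {ae mu, forall x, (\int[mu]_y (w y * h (x, y)))%:E = fubini_F mu H x}.
  have := ae_integrable1 iH; apply: ae_imply => x ix.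
  by rewrite /Rintegral fineK//; exact: integrable_fin_num.
have iF := integrable_fubini_F iH.
have iG : mu.-integrable setT (fubini_G mu H).
  apply/integrableP; split; first exact: (measurable_fubini_G iH).
  have lt := (@integrable21ltyP _ _ _ _ _ mu mu H mH).1 iH.
  apply: (le_lt_trans _ lt); apply: ge0_le_integral => //.
  - by apply: measurableT_comp => //; exact: (measurable_fubini_G iH).
  - apply: (@measurable_fun_fubini_tonelli_G _ _ _ _ R mu (abse \o H)).
      exact: measurableT_comp.
    by move=> p; exact: abse_ge0.
  - move=> y _; apply: le_abse_integral => //.
    exact: (measurableT_comp mH (pair2_measurable y)).
have mRF : measurable_fun setT (fun x => (\int[mu]_y (w y * h (x, y)))).
  exact: (measurableT_comp (fine_measurable measurableT) (measurable_int _ iF)).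
have mG0 := measurable_Rintegral_section mh.
have mG : measurable_fun setT (EFin \o (fun y => w y * \int[mu]_x h (x, y))).
  by apply/measurable_EFinP; exact: measurable_funM.
split.
  apply/integrableP; split => //.
  move/integrableP : iG => [mGG]; apply: le_lt_trans.
  apply: ae_ge0_le_integral => //; try exact: measurableT_comp.
  by apply: ae_imply aeG => y /= <- _.
rewrite /Rintegral; congr fine.
transitivity (\int[mu]_y fubini_G mu H y)%E.
  apply: ae_eq_integral => //; first exact: measurable_int iG.
  by apply: ae_imply aeG => y /= -> _.
rewrite -(Fubini iH); apply: ae_eq_integral => //.
- exact: measurable_int iF.
- exact/measurable_EFinP.
- by apply: ae_imply aeF => y /= -> _.
Qed.

End fubini.

(** * The Abel kernel *)

Section abel_kernel.
Variable R : realType.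
Notation mu := (@lebesgue_measure R).
Notation T n x := (chebyshevT R n).[x].
Implicit Types (n nu : nat) (a b s t z : R).

Definition abel_weight a z : R :=
  if `|z| < a then (Num.sqrt (a ^+ 2 - z ^+ 2))^-1 else 0.

Definition abel_kernel nu a z : R := T nu (z / a) * abel_weight a z.

Lemma abel_weight_ge0 a z : 0 <= abel_weight a z.
Proof. by rewrite /abel_weight; case: ifP => // _; rewrite invr_ge0 sqrtr_ge0. Qed.

Lemma abel_kernel_le nu a z : `|abel_kernel nu a z| <= abel_weight a z.
Proof.
rewrite /abel_kernel /abel_weight; case: ifPn => [za|_]; last by rewrite mulr0 normr0.
have a0 : 0 < a by rewrite (le_lt_trans _ za).
rewrite normrM [X in _ * X]ger0_norm ?invr_ge0 ?sqrtr_ge0//.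
rewrite ler_piMl ?invr_ge0 ?sqrtr_ge0// chebyshevT_le1//.
by rewrite normrM normfV (gtr0_norm a0) ler_pdivrMr// mul1r ltW.
Qed.

Lemma abel_weight_scale c a z : 0 < c -> abel_weight (a / c) (z / c) = c * abel_weight a z.
Proof.
move=> c0; rewrite /abel_weight normrM normfV (gtr0_norm c0) ltr_pM2r ?invr_gt0//.
case: ifP => _; last by rewrite mulr0.
rewrite (_ : (a / c) ^+ 2 - (z / c) ^+ 2 = (c^-1) ^+ 2 * (a ^+ 2 - z ^+ 2)); last by ring.
by rewrite sqrtrM ?sqr_ge0// sqrtr_sqr ger0_norm ?invr_ge0 ?ltW// invfM invrK.
Qed.

Lemma abel_kernel_scale nu c a z : 0 < c ->
  abel_kernel nu (a / c) (z / c) = c * abel_kernel nu a z.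
Proof.
move=> c0; rewrite /abel_kernel abel_weight_scale// mulrCA.
by congr (_ * ((chebyshevT R nu).[_] * _)); rewrite invfM invrK mulrACA mulVf ?mulr1// gt_eqF.
Qed.

Lemma measurable_abel_weight d (X : measurableType d) (u v : X -> R) :
  measurable_fun setT u -> measurable_fun setT v ->
  measurable_fun setT (fun x => abel_weight (u x) (v x)).
Proof.
move=> mu_ mv; apply: measurable_fun_ifT => //.
  apply: measurable_fun_ltr => //; exact: measurableT_comp.
apply: measurable_funV; apply: measurable_fun_sqrt.
by apply: measurable_funB; exact: measurable_funX.
Qed.

Lemma measurable_abel_kernel nu d (X : measurableType d) (u v : X -> R) :
  measurable_fun setT u -> measurable_fun setT v ->
  measurable_fun setT (fun x => abel_kernel nu (u x) (v x)).
Proof.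
move=> mu_ mv; apply: measurable_funM; last exact: measurable_abel_weight.
apply: measurable_fun_chebyshevT; apply: measurable_funM => //.
exact: measurable_funV.
Qed.

Lemma mem_itvNoo a z : (z \in (`]-a, a[%classic : set R)) = (`|z| < a).
Proof. by rewrite mem_setE in_itv/= ltr_norml. Qed.

Lemma Rintegral_abel_kernel (f : R -> R) nu a :
  \int[mu]_z (f z * abel_kernel nu a z) = \int[mu]_(z in `]-a, a[)
    (f z * (T nu (z / a) / Num.sqrt (a ^+ 2 - z ^+ 2))).
Proof.
rewrite [RHS]Rintegral_mkcond; apply: eq_Rintegral => z _.
rewrite patchE mem_itvNoo /abel_kernel /abel_weight; case: ifP => // _.
by rewrite !mulr0.
Qed.

(** The mass does not depend on [a], which makes the Abel transform bounded
    on integrable functions. *)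
Lemma integral_abel_weight a : 0 < a ->
  (\int[mu]_z (abel_weight a z)%:E = pi%:E)%E.
Proof.
move=> a0; have [h1 h2] := abel_integral0 a0.
have /fineK := @integrable_fin_num _ _ _ mu _ (measurable_itv _) _ h1.
rewrite -[fine _]/(Rintegral _ _ _) h2 => ->.
rewrite [RHS]integral_mkcond; apply: eq_integral => z _.
by rewrite patchE mem_itvNoo /abel_weight /=; case: ifP.
Qed.

(** The mass of the second term in the Cauchy-Schwarz bound of the Abel
    transform; [b] below is the point where the weight becomes nonzero, and
    $\sigma\sqrt{s^2 - b^2}$ is a primitive of the integrand beyond it. *)
Lemma integral_id_abel_weight (sigma z : R) : 0 < sigma ->
  (\int[mu]_s (s * abel_weight (s / sigma) z * \1_(`]0, sigma[%classic) s)%:E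
    <= (sigma ^+ 2)%:E)%E.
Proof.
move=> s0; pose b := sigma * `|z|.
have b0 : 0 <= b by rewrite mulr_ge0// ltW.
have sE s : s * abel_weight (s / sigma) z * \1_(`]0, sigma[%classic) s =
    ((fun s => sigma * (s / Num.sqrt (s ^+ 2 - b ^+ 2))) \_ `]b, sigma[) s.
  rewrite patchE indicE !mem_setE !in_itv/= /abel_weight ltr_pdivlMr// mulrC [`|z| * _]mulrC -/b.
  have [bs|sb] := ltP b s; last by rewrite !mulr0.
  have s_gt0 := le_lt_trans b0 bs; rewrite s_gt0 /=.
  case: (s < sigma); rewrite ?mul0r// mul1r.
  have -> : (s / sigma) ^+ 2 - z ^+ 2 = (sigma^-1) ^+ 2 * (s ^+ 2 - b ^+ 2).
    by rewrite /b [(sigma * _) ^+ 2]exprMn real_normK ?num_real//; field; rewrite gt_eqF.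
  rewrite sqrtrM ?sqr_ge0// sqrtr_sqr ger0_norm ?invr_ge0 ?ltW// invfM invrK.
  by rewrite mulrCA.
have [sb|bs] := leP sigma b.
  rewrite integral0_eq ?lee_fin ?sqr_ge0// => s _.
  by rewrite sE patchE set_itv_ge ?in_set0// bnd_simp -leNgt.
have cF : continuous (fun s => sigma * Num.sqrt (s ^+ 2 - b ^+ 2)).
  by move=> s; apply: cvgM; [exact: cvg_cst|exact: continuous_sqrtBr].
have pr : primitive_oo (fun s => sigma * (s / Num.sqrt (s ^+ 2 - b ^+ 2)))
    (fun s => sigma * Num.sqrt (s ^+ 2 - b ^+ 2)) b sigma.
  have pos s : b < s < sigma -> 0 < s ^+ 2 - b ^+ 2.
    by move=> /andP[bs' _]; rewrite subr_gt0 ltr_pXn2r// nnegrE// ltW// (le_lt_trans b0).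
  apply: primitive_ooZ; split => [s /pos h|s /pos h||].
  - have := is_deriveB (is_derive_sqr s) (is_derive_cst (b ^+ 2) s 1); rewrite subr0 => du.
    have := @is_derive_sqrt _ (fun s => s ^+ 2 - b ^+ 2) _ s h du; congr is_derive.
    by field; rewrite gt_eqF// sqrtr_gt0.
  - apply: cvgM; first exact: cvg_id.
    by apply: cvgV; [rewrite gt_eqF// sqrtr_gt0|exact: continuous_sqrtBr].
  - by apply: cvg_at_right_filter; exact: continuous_sqrtBr.
  - by apply: cvg_at_left_filter; exact: continuous_sqrtBr.
rewrite (_ : (\int[mu]_s _)%E =
    (\int[mu]_(s in `]b, sigma[) (sigma * (s / Num.sqrt (s ^+ 2 - b ^+ 2)))%:E)%E); last first.
  rewrite [RHS]integral_mkcond; apply: eq_integral => s _.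
  by rewrite sE !patchE; case: ifP.
rewrite (ge0_FTC2_oo bs _ pr); last first.
  move=> s /andP[bs' _]; apply: mulr_ge0; first exact: ltW.
  by apply: divr_ge0; [exact: ltW (le_lt_trans b0 bs')|exact: sqrtr_ge0].
rewrite lee_fin subrr sqrtr0 mulr0 subr0 expr2 ler_pM2l//.
rewrite (le_trans (_ : _ <= Num.sqrt (sigma ^+ 2)))//; last by rewrite sqrtr_sqr gtr0_norm.
by rewrite ler_sqrt ?sqr_ge0// lerBlDr lerDl sqr_ge0.
Qed.

End abel_kernel.

Section tonelli.
Variable R : realType.
Notation mu := (@lebesgue_measure R).

(** The mass of [K] is controlled only where [G] is nonzero: the Abel kernel is
    nontrivial for positive [s] alone. *)
Lemma tonelli_lty (G : R -> R) (K : R * R -> R) (c : R) : 0 <= c ->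
  mu.-integrable setT (EFin \o G) -> measurable_fun setT K ->
  (forall s, G s != 0 -> (\int[mu]_z (`|K (s, z)|)%:E <= c%:E)%E) ->
  (\int[mu]_s \int[mu]_z (`|G s * K (s, z)|)%:E < +oo)%E.
Proof.
move=> c0 iG mK Kc.
have /integrableP[/measurable_EFinP mG Goo] := iG.
have mKs s : measurable_fun setT (fun z => K (s, z)).
  exact: (measurableT_comp mK (pair1_measurable s)).
have Gfin : (\int[mu]_s (`|G s|)%:E)%E \is a fin_num by rewrite ge0_fin_numE ?integral_ge0.
apply: (@le_lt_trans _ _ (c%:E * \int[mu]_s (`|G s|)%:E)%E); last first.
  by rewrite -(fineK Gfin) -EFinM ltry.
rewrite -ge0_integralZl//; last by apply/measurable_EFinP; exact: measurableT_comp.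
apply: ge0_le_integral => //.
- by move=> s _; apply: integral_ge0.
- apply: (@measurable_fun_fubini_tonelli_F _ _ _ _ R mu
    (fun p => (`|G p.1 * K p|)%:E)) => //.
  apply/measurable_EFinP; apply: measurableT_comp => //.
  by apply: measurable_funM => //; exact: measurableT_comp.
- apply/measurable_EFinP; apply: measurable_funM => //; exact: measurableT_comp.
move=> s _; under eq_integral do rewrite normrM EFinM.
rewrite ge0_integralZl//; last first.
  by apply/measurable_EFinP; exact: (measurableT_comp _ (mKs s)).
have [->|Gs0] := eqVneq (G s) 0; first by rewrite normr0 mul0e mule0.
rewrite [leRHS]muleC; apply: lee_wpmul2l; first by rewrite lee_fin.
exact: Kc.
Qed.

End tonelli.

(** * The Abel transform *)

Section abel_transform.
Variable R : realType.
Notation mu := (@lebesgue_measure R).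
Notation T n x := (chebyshevT R n).[x].
Implicit Types (s t p z : R).

(** Up to the factor $\pi i^\nu$, this is the function on $[-1, 1]$ whose Fourier
    transform is the rescaled Hankel transform of [g]. *)
Definition abel_transform (nu : nat) (sigma : R) (g : R -> R) (z : R) : R :=
  \int[mu]_s (abel_kernel nu (s / sigma) z * (g s * Num.sqrt s)).

Variables (nu : nat) (sigma : R) (g : R -> R).
Hypothesis sigma_gt0 : 0 < sigma.
Hypothesis mg : measurable_fun setT g.
Hypothesis g_supp : forall s, g s != 0 -> 0 < s < sigma.
Hypothesis g_L2 : (\int[mu]_s (g s ^+ 2)%:E < +oo)%E.
Notation A := (abel_transform nu sigma g).
Notation k s z := (abel_kernel nu (s / sigma) z).

Lemma integrable_sqr_supp : mu.-integrable setT (EFin \o (fun s => g s ^+ 2)).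
Proof.
apply/integrableP; split; first by apply/measurable_EFinP; exact: measurable_funX.
by under eq_integral do rewrite /= ger0_norm ?sqr_ge0//.
Qed.

Lemma integrable_supp (m : R -> R) (C : R) : measurable_fun setT m ->
  (forall s, 0 < s < sigma -> `|m s| <= C) ->
  mu.-integrable setT (EFin \o (fun s => g s * m s)).
Proof.
move=> mm mC.
have half : 0 < sigma / 2 < sigma.
  by have h := sigma_gt0; apply/andP; split; lra.
have C0 : 0 <= C := le_trans (normr_ge0 _) (mC _ half).
have ib : mu.-integrable setT (EFin \o (fun s : R => C * (g s ^+ 2 + \1_(`]0, sigma[%classic) s))).
  apply: RintegrableZ => //; apply: RintegrableD => //.
    exact: integrable_sqr_supp.
  exact: integrable_indic_itv.
apply: (le_integrable _ _ _ ib) => //.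
  by apply/measurable_EFinP; exact: measurable_funM.
move=> s _; rewrite /= lee_fin [leRHS]ger0_norm; last first.
  by rewrite mulr_ge0// addr_ge0 ?sqr_ge0// indicE.
have [->|gs] := eqVneq (g s) 0.
  by rewrite mul0r normr0 mulr_ge0// addr_ge0 ?sqr_ge0// indicE.
have sI := g_supp gs; rewrite indicE mem_setE in_itv/= sI.
rewrite normrM mulrC; apply: ler_pM => //; first exact: mC.
rewrite -[g s ^+ 2]real_normK ?num_real//.
have := normr_ge0 (g s); set x := `|g s| => x0.
have : 0 <= (x - 1) ^+ 2 by exact: sqr_ge0.
by rewrite sqrrB1 -[true%:R]/(1 : R) => h; lra.
Qed.

Lemma integrable_supp_sqrt : mu.-integrable setT (EFin \o (fun s => g s * Num.sqrt s)).
Proof.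
apply: (@integrable_supp _ (Num.sqrt sigma)).
  by apply: measurable_fun_sqrt; exact: measurable_id.
move=> s /andP[s0 ss]; rewrite ger0_norm ?sqrtr_ge0//.
by rewrite ler_sqrt// ltW.
Qed.

Lemma measurable_kernel2 : measurable_fun setT (fun p : R * R => k p.1 p.2).
Proof.
apply: measurable_abel_kernel => //.
by apply: measurable_funM.
Qed.

Lemma integral_abel_kernel_le (w : R -> R) s : measurable_fun setT w ->
  (forall z, `|w z| <= 1) -> 0 < s ->
  (\int[mu]_z (`|w z * k s z|)%:E <= pi%:E)%E.
Proof.
move=> mw w1 s0; rewrite -(@integral_abel_weight _ (s / sigma)) ?divr_gt0//.
apply: ge0_le_integral => //.
- apply/measurable_EFinP; apply: measurableT_comp => //; apply: measurable_funM => //.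
  exact: measurable_abel_kernel.
- by apply/measurable_EFinP; exact: measurable_abel_weight.
- move=> z _; rewrite lee_fin normrM -[leRHS]mul1r; apply: ler_pM => //.
  exact: abel_kernel_le.
Qed.

Lemma abel_transform_tonelli (w : R -> R) : measurable_fun setT w ->
  (forall z, `|w z| <= 1) ->
  (\int[mu]_s \int[mu]_z (`|w z * (k s z * (g s * Num.sqrt s))|)%:E < +oo)%E.
Proof.
move=> mw w1.
have mK : measurable_fun setT (fun p : R * R => w p.2 * k p.1 p.2).
  by apply: measurable_funM; [exact: measurableT_comp|exact: measurable_kernel2].
have Kpi s : g s * Num.sqrt s != 0 -> (\int[mu]_z (`|w z * k s z|)%:E <= pi%:E)%E.
  rewrite mulf_eq0 negb_or => /andP[/g_supp/andP[s0 _] _].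
  exact: integral_abel_kernel_le.
have := tonelli_lty (pi_ge0 R) integrable_supp_sqrt mK Kpi.
apply: le_lt_trans; rewrite le_eqVlt; apply/orP; left; apply/eqP.
apply: eq_integral => s _; apply: eq_integral => z _.
by rewrite mulrA [in RHS]mulrC.
Qed.

Let measurable_integrand : measurable_fun setT
  (fun p : R * R => k p.1 p.2 * (g p.1 * Num.sqrt p.1)).
Proof.
apply: measurable_funM; first exact: measurable_kernel2.
apply: measurable_funM; first exact: measurableT_comp.
by apply: measurable_fun_sqrt.
Qed.

(** The Fubini theorem; [w] stands for the cosine or the sine of a Fourier
    integral. *)
Lemma integral_abel_transform (w : R -> R) : measurable_fun setT w ->
  (forall z, `|w z| <= 1) ->
  mu.-integrable setT (EFin \o (fun z => w z * A z)) /\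
  \int[mu]_z (w z * A z) =
    \int[mu]_s (g s * Num.sqrt s * \int[mu]_z (w z * k s z)).
Proof.
move=> mw w1.
have [h1 ->] := Rfubini measurable_integrand mw (abel_transform_tonelli mw w1).
split => //; apply: eq_Rintegral => s _ /=.
have [gs|gs] := eqVneq (g s) 0.
  rewrite gs !mul0r -[RHS](mul0r (fine (mu setT))) -Rintegral_cst//.
  by apply: eq_Rintegral => z _; rewrite /= !mulr0.
rewrite -RintegralZl//; first by apply: eq_Rintegral => z _; rewrite /= mulrA mulrC.
apply/integrableP; split.
  apply/measurable_EFinP; apply: measurable_funM => //; exact: measurable_abel_kernel.
have /andP[s0 _] := g_supp gs.
by apply: le_lt_trans (integral_abel_kernel_le mw w1 s0) _; rewrite ltry.
Qed.

Lemma integrable_abel_transform : mu.-integrable setT (EFin \o A).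
Proof.
have [//||+ _] := @integral_abel_transform (cst 1); first by move=> z; rewrite normr1.
by apply: eq_integrable => // z _ /=; rewrite mul1r.
Qed.

Lemma abel_transform_out z : 1 <= `|z| -> A z = 0.
Proof.
move=> z1; rewrite /abel_transform -[RHS](mul0r (fine (mu setT))) -Rintegral_cst//.
apply: eq_Rintegral => s _ /=.
have [->|/g_supp/andP[s0 ss]] := eqVneq (g s) 0; first by rewrite mul0r mulr0.
rewrite /abel_kernel /abel_weight ltNge (le_trans _ z1) ?mulr0 ?mul0r//.
by rewrite ler_pdivrMr// mul1r ltW.
Qed.

End abel_transform.

(** * Square integrability of the Abel transform *)

Section abel_transform_square.
Variable R : realType.
Notation mu := (@lebesgue_measure R).
Notation T n x := (chebyshevT R n).[x].
Implicit Types (s t p z : R).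

Lemma ae_integrable_section (h : R * R -> R) : measurable_fun setT h ->
  (\int[mu]_x \int[mu]_y (`|h (x, y)|)%:E < +oo)%E ->
  {ae mu, forall y, mu.-integrable setT (EFin \o (fun x => h (x, y)))}.
Proof.
move=> mh fin; have iH : (mu \x mu)%E.-integrable setT (EFin \o h).
  by apply/integrable12ltyP => //; exact/measurable_EFinP.
by have := ae_integrable2 iH; apply: ae_imply.
Qed.

Variables (nu : nat) (sigma : R) (g : R -> R).
Hypothesis sigma_gt0 : 0 < sigma.
Hypothesis mg : measurable_fun setT g.
Hypothesis g_supp : forall s, g s != 0 -> 0 < s < sigma.
Hypothesis g_L2 : (\int[mu]_s (g s ^+ 2)%:E < +oo)%E.
Notation A := (abel_transform nu sigma g).
Notation k s z := (abel_kernel nu (s / sigma) z).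
Notation W s z := (abel_weight (s / sigma) z).

(** Cauchy-Schwarz in the form
    $2 |g| \sqrt s \le \lambda g^2 + s / \lambda$, against the weight [W]. With
    $P(z)$ the integral of $g^2 W$ and $\lambda = \sigma / \sqrt{P(z) + 1}$ it
    yields $A(z)^2 \le \sigma^2 (P(z) + 1)$ on $]-1, 1[$, and $P$ is integrable
    because the mass of [W] in $z$ is $\pi$. *)
Lemma abel_transform_L2 : (\int[mu]_z (A z ^+ 2)%:E < +oo)%E.
Proof.
have mW : measurable_fun setT (fun p : R * R => W p.1 p.2).
  by apply: measurable_abel_weight => //; exact: measurable_funM.
pose h (p : R * R) := W p.1 p.2 * g p.1 ^+ 2.
have mh : measurable_fun setT h.
  by apply: measurable_funM => //; apply: measurable_funX; exact: measurableT_comp.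
have i2 := integrable_sqr_supp mg g_L2.
have fin : (\int[mu]_s \int[mu]_z (`|h (s, z)|)%:E < +oo)%E.
  have Wpi s : g s ^+ 2 != 0 -> (\int[mu]_z (`|W s z|)%:E <= pi%:E)%E.
    rewrite expf_eq0/= => /g_supp/andP[s0 _].
    rewrite -(@integral_abel_weight _ (s / sigma)) ?divr_gt0//.
    rewrite le_eqVlt; apply/orP; left; apply/eqP; apply: eq_integral => z _.
    by rewrite ger0_norm ?abel_weight_ge0.
  have := tonelli_lty (pi_ge0 R) i2 mW Wpi.
  apply: le_lt_trans; rewrite le_eqVlt; apply/orP; left; apply/eqP.
  by apply: eq_integral => s _; apply: eq_integral => z _; rewrite /h mulrC.
pose P z := \int[mu]_s h (s, z).
have iP : mu.-integrable setT (EFin \o P).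
  have m1 : measurable_fun setT (fun _ : R => 1 : R) by [].
  have fin1 : (\int[mu]_s \int[mu]_z (`|1 * h (s, z)|)%:E < +oo)%E.
    by under eq_integral do under eq_integral do rewrite mul1r.
  have [+ _] := Rfubini mh m1 fin1.
  by apply: eq_integrable => // z _ /=; rewrite mul1r.
have P0 z : 0 <= P z.
  by apply: Rintegral_ge0 => s _; rewrite mulr_ge0 ?sqr_ge0 ?abel_weight_ge0.
have ibd : mu.-integrable setT
    (EFin \o (fun z => sigma ^+ 2 * (P z + \1_(`]-1, 1[%classic) z))).
  apply: RintegrableZ => //; apply: RintegrableD => //.
  exact: integrable_indic_itv.
have iA := integrable_abel_transform nu sigma_gt0 mg g_supp g_L2.
have /measurable_EFinP mA := measurable_int _ iA.
have /integrableP[mbd] := ibd.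
apply: le_lt_trans; apply: ae_ge0_le_integral => //.
- by move=> z _; rewrite lee_fin sqr_ge0.
- by apply/measurable_EFinP; exact: measurable_funX.
- exact: measurableT_comp.
have m1 : measurable_fun setT (fun _ : R => 1 : R) by [].
have n1 (z : R) : `|1 : R| <= 1 by rewrite normr1.
have mk : measurable_fun setT (fun p : R * R => k p.1 p.2 * (g p.1 * Num.sqrt p.1)).
  apply: measurable_funM; first by apply: measurable_abel_kernel => //; exact: measurable_funM.
  apply: measurable_funM; first exact: measurableT_comp.
  by apply: measurable_fun_sqrt.
have fink : (\int[mu]_s \int[mu]_z (`|k s z * (g s * Num.sqrt s)|)%:E < +oo)%E.
  have := abel_transform_tonelli nu sigma_gt0 mg g_supp g_L2 m1 n1.
  by under eq_integral do under eq_integral do rewrite mul1r.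
have ak := ae_integrable_section mk fink; have ah := ae_integrable_section mh fin.
apply: ae_imply2 ak ah => z ik ih _; rewrite lee_fin.
rewrite [leRHS]ger0_norm; last by apply: mulr_ge0; rewrite ?sqr_ge0// addr_ge0// indicE.
rewrite indicE.
have [z1|z1] := leP 1 `|z|.
  by rewrite abel_transform_out// expr0n/= mulr_ge0 ?sqr_ge0// addr_ge0.
(* Adding 1 to [P z] keeps the optimal [l] finite where [P z] vanishes. *)
have -> : (z \in `]-1, 1[%classic) = true by rewrite mem_itvNoo.
rewrite -[true%:R]/(1 : R).
pose q := Num.sqrt (P z + 1).
have q2 : q ^+ 2 = P z + 1 by rewrite sqr_sqrtr// addr_ge0.
have q0 : 0 < q by rewrite sqrtr_gt0 ltr_wpDl.
rewrite -q2 -exprMn -[A z ^+ 2]real_normK ?num_real//.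
apply: lerXn2r; rewrite ?nnegrE//; first by rewrite mulr_ge0 ?(ltW q0) ?(ltW sigma_gt0).
pose Q s := s * W s z * \1_(`]0, sigma[%classic) s.
have Q0 s : 0 <= Q s.
  rewrite /Q indicE mem_setE in_itv/=.
  have [/andP[s0 _]|_] := boolP (0 < s < sigma); last by rewrite mulr0.
  by rewrite mulr1 mulr_ge0 ?abel_weight_ge0// ltW.
have Qle := @integral_id_abel_weight R sigma z sigma_gt0.
have mQ : measurable_fun setT Q.
  apply: measurable_funM; last exact: measurable_indic.
  apply: measurable_funM => //; apply: measurable_abel_weight => //.
  exact: measurable_funM.
have iQ : mu.-integrable setT (EFin \o Q).
  apply/integrableP; split; first exact/measurable_EFinP.
  rewrite (@eq_integral _ _ _ mu _ (EFin \o Q)); last first.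
    by move=> s _; rewrite /= ger0_norm ?Q0.
  by apply: le_lt_trans Qle _; rewrite ltry.
have Qs : \int[mu]_s Q s <= sigma ^+ 2.
  by rewrite -lee_fin /Rintegral fineK//; exact: integrable_fin_num.
pose l := sigma / q.
have l0 : 0 < l by rewrite divr_gt0.
have i3 : mu.-integrable setT (EFin \o (fun s => l / 2 * h (s, z) + (2 * l)^-1 * Q s)).
  by apply: RintegrableD => //; exact: RintegrableZ.
apply: (@le_trans _ _ (\int[mu]_s (l / 2 * h (s, z) + (2 * l)^-1 * Q s))).
  apply: le_trans (le_normr_Rintegral _ ik) _ => //.
  apply: le_Rintegral => //; first exact: integrable_norm.
  move=> s _ /=; have [gs|gs] := eqVneq (g s) 0.
    have h0 : 0 <= h (s, z) by rewrite mulr_ge0 ?sqr_ge0 ?abel_weight_ge0.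
    have c1 : 0 <= l / 2 by rewrite divr_ge0// ltW.
    have c2 : 0 <= (2 * l)^-1 by rewrite invr_ge0 mulr_ge0// ltW.
    by rewrite gs mul0r mulr0 normr0 addr_ge0// mulr_ge0.
  have /andP[s0 ss] := g_supp gs.
  rewrite /h /Q indicE mem_setE in_itv/= s0 ss mulr1 normrM.
  apply: (@le_trans _ _ (W s z * `|g s * Num.sqrt s|)).
    by rewrite ler_wpM2r// abel_kernel_le.
  rewrite (_ : _ + _ = W s z * (l / 2 * g s ^+ 2 + (2 * l)^-1 * s)); last by ring.
  rewrite ler_wpM2l ?abel_weight_ge0// normrM [`|Num.sqrt s|]ger0_norm ?sqrtr_ge0//.
  rewrite (_ : (2 * l)^-1 * s = (2 * l)^-1 * Num.sqrt s ^+ 2); last first.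
    by rewrite sqr_sqrtr ?(ltW s0).
  rewrite -[g s ^+ 2]real_normK ?num_real//.
  set x := `|g s|; set y := Num.sqrt s.
  have : 0 <= (2 * l)^-1 * (l * x - y) ^+ 2.
    by rewrite mulr_ge0 ?sqr_ge0// invr_ge0 mulr_ge0// ltW.
  rewrite -subr_ge0; by congr (0 <= _); field; rewrite gt_eqF.
rewrite RintegralD//; [|exact: RintegrableZ|exact: RintegrableZ].
rewrite !RintegralZl// -/(P z).
apply: (@le_trans _ _ (l / 2 * q ^+ 2 + (2 * l)^-1 * sigma ^+ 2)).
  apply: lerD; first by rewrite ler_pM2l ?divr_gt0// q2 lerDl.
  by rewrite ler_pM2l// invr_gt0 mulr_gt0.
rewrite le_eqVlt; apply/orP; left; apply/eqP.
by rewrite /l; field; rewrite !gt_eqF.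
Qed.

End abel_transform_square.

(** * Inversion of the Abel transform *)

Section abel_inversion.
Variable R : realType.
Notation mu := (@lebesgue_measure R).
Notation T n x := (chebyshevT R n).[x].
Implicit Types (s t p z : R).

(** The kernel of the reconstruction formula, extended by zero to the line. *)
Definition inversion_weight (nu : nat) (sigma s t : R) : R :=
  s * T nu (t / s) / (t * Num.sqrt (t ^+ 2 - s ^+ 2)) * \1_(`]s, sigma[%classic) t.

Variables (nu : nat) (sigma : R) (g : R -> R).
Hypothesis sigma_gt0 : 0 < sigma.
Hypothesis mg : measurable_fun setT g.
Hypothesis g_supp : forall s, g s != 0 -> 0 < s < sigma.
Hypothesis g_L2 : (\int[mu]_s (g s ^+ 2)%:E < +oo)%E.
Notation A := (abel_transform nu sigma g).
Notation k s z := (abel_kernel nu (s / sigma) z).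
Notation w s t := (inversion_weight nu sigma s t).
Let weight s p t := (t * Num.sqrt (t ^+ 2 - s ^+ 2) * Num.sqrt (p ^+ 2 - t ^+ 2))^-1.

Lemma measurable_inversion_weight s : measurable_fun setT (fun t => w s t).
Proof.
apply: measurable_funM; last exact: measurable_indic.
apply: measurable_funM.
  by apply: measurable_funM => //; apply: measurable_fun_chebyshevT; exact: measurable_funM.
apply: measurable_funV; apply: measurable_funM => //; apply: measurable_fun_sqrt.
by apply: measurable_funB => //; exact: measurable_funX.
Qed.

(** The product of the two kernels is the integrand of Cormack's identity, with
    the factor [sigma] that comes from the dilation by [sigma]. *)
Let kernelE s p t : 0 < s -> 0 < p < sigma ->
  w s t * k p (t / sigma) =
  ((fun t => sigma * s * (T nu (t / s) * T nu (t / p) * weight s p t)) \_ `]s, p[) t.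
Proof.
move=> s0 /andP[p0 psigma]; rewrite patchE mem_setE in_itv/=.
rewrite /inversion_weight indicE mem_setE in_itv/= abel_kernel_scale//.
rewrite /abel_kernel /abel_weight.
have [st|ts] := ltP s t; last by rewrite mulr0 mul0r.
have t0 := lt_trans s0 st; rewrite gtr0_norm//=.
have [tp|pt] := ltP t p; last by rewrite !mulr0.
rewrite (lt_trans tp psigma) mulr1 /weight !invfM; ring.
Qed.

(** Independent of [p], as the exchange of the integrals requires. *)
Let kernel_bound s p : 0 < s -> 0 < p < sigma ->
  (\int[mu]_t (`|w s t * k p (t / sigma)|)%:E <=
    (sigma * (2 * (sigma / s) + 1) ^+ nu * pi / (2 * s))%:E)%E.
Proof.
move=> s0 psig; have /andP[p0 psigma] := psig.
have M0 : 0 <= (2 * (sigma / s) + 1) ^+ nu.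
  by rewrite exprn_ge0// addr_ge0// mulr_ge0// divr_ge0// ltW.
have [ps|sp] := leP p s.
  rewrite integral0_eq; last first.
    by move=> t _; rewrite kernelE// patchE set_itv_ge ?in_set0 ?normr0// bnd_simp -leNgt.
  by rewrite lee_fin !mulr_ge0 ?pi_ge0// ?invr_ge0 ?mulr_ge0// ltW.
have ssp : 0 < s < p by rewrite s0.
have [i0 e0] := abel2_integral0 ssp.
pose C := sigma * s * (2 * (sigma / s) + 1) ^+ nu.
have C0 : 0 <= C by rewrite !mulr_ge0// ltW.
apply: (@le_trans _ _ (\int[mu]_(t in `]s, p[) (C * weight s p t)%:E)%E).
  rewrite [leRHS]integral_mkcond; apply: ge0_le_integral => //.
  - apply/measurable_EFinP; apply: measurableT_comp => //.
    apply: measurable_funM; first exact: measurable_inversion_weight.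
    by apply: measurable_abel_kernel => //; exact: measurable_funM.
  - apply/(measurable_restrictT _ _).1 => //; apply/measurable_EFinP.
    apply: measurable_funM => //.
    by have /measurable_int/measurable_EFinP := i0.
  - move=> t _; rewrite kernelE// !patchE mem_setE; case: ifPn; last by rewrite normr0.
    rewrite in_itv/= => /andP[st tp]; have t0 := lt_trans s0 st.
    have wt0 : 0 <= weight s p t.
      by rewrite invr_ge0 !mulr_ge0 ?sqrtr_ge0// ltW.
    rewrite lee_fin normrM [X in X * _]ger0_norm ?mulr_ge0 ?(ltW s0) ?(ltW sigma_gt0)//.
    rewrite /C -[leRHS]mulrA ler_pM2l ?(mulr_gt0 sigma_gt0 s0)// normrM [X in _ * X]ger0_norm//.
    rewrite ler_wpM2r// normrM -[leRHS]mulr1; apply: ler_pM => //.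
      apply: chebyshevT_bound.
        by rewrite ler_pdivlMr// mul1r ltW// (lt_trans st)// (lt_trans tp).
      have ts0 : 0 <= t / s by rewrite divr_ge0// ltW.
      by rewrite ger0_norm// ler_pM2r ?invr_gt0// ltW// (lt_trans tp).
    apply: chebyshevT_le1.
    have tp0 : 0 <= t / p by rewrite divr_ge0// ltW.
    by rewrite ger0_norm// ler_pdivrMr// mul1r ltW.
have iC := RintegrableZ C (measurable_itv _) i0.
rewrite (_ : (\int[mu]_(t in _) _)%E = (\int[mu]_(t in `]s, p[) (C * weight s p t))%:E).
  2: by rewrite /Rintegral fineK//; exact: (integrable_fin_num _ iC).
rewrite RintegralZl// e0 lee_fin /C.
rewrite (_ : sigma * s * _ * _ = (sigma * (2 * (sigma / s) + 1) ^+ nu * pi / 2) * p^-1); last first.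
  by field; rewrite !gt_eqF.
rewrite [leRHS](_ : _ = (sigma * (2 * (sigma / s) + 1) ^+ nu * pi / 2) * s^-1); last first.
  by field; rewrite !gt_eqF.
rewrite ler_wpM2l ?lef_pV2 ?posrE ?(ltW sp)//.
by rewrite !mulr_ge0 ?pi_ge0// ltW.
Qed.

Let kernel_integral s p : 0 < s -> 0 < p < sigma ->
  mu.-integrable setT (EFin \o (fun t => w s t * k p (t / sigma))) /\
  \int[mu]_t (w s t * k p (t / sigma)) = sigma * (pi / 2) * (p^-1 * (s < p)%R%:R).
Proof.
move=> s0 psig; have /andP[p0 psigma] := psig; split.
  apply/integrableP; split.
    apply/measurable_EFinP; apply: measurable_funM; first exact: measurable_inversion_weight.
    by apply: measurable_abel_kernel => //; exact: measurable_funM.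
  by apply: le_lt_trans (kernel_bound s0 psig) _; rewrite ltry.
transitivity (\int[mu]_t ((fun t => sigma * s *
    (T nu (t / s) * T nu (t / p) * weight s p t)) \_ `]s, p[) t).
  by apply: eq_Rintegral => t _; rewrite kernelE.
rewrite -Rintegral_mkcond; have [sp|ps] := ltP s p; last first.
  rewrite !mulr0 set_itv_ge ?Rintegral_set0// bnd_simp -leNgt//.
have ssp : 0 < s < p by rewrite s0.
have [i0 e0] := abel2_integral nu ssp.
by rewrite RintegralZl// e0 mulr1; field; rewrite !gt_eqF.
Qed.

(** The tail of [g p / sqrt p], whose derivative recovers [g]. *)
Definition tail_integral s : R :=
  \int[mu]_p (g p * ((Num.sqrt p)^-1 * (s < p)%R%:R)).

(** After the exchange of the integrals, the inner one is $\sigma\pi/(2p)$ for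
    $p > s$ and zero otherwise, by Cormack's identity; the factor $\sqrt p / p$
    leaves $1/\sqrt p$. *)
Lemma abel_transform_inversion s : 0 < s ->
  mu.-integrable setT (EFin \o (fun t => w s t * A (t / sigma))) /\
  \int[mu]_t (w s t * A (t / sigma)) = sigma * (pi / 2) * tail_integral s.
Proof.
move=> s0.
pose h (q : R * R) := k q.1 (q.2 / sigma) * (g q.1 * Num.sqrt q.1).
have mk : measurable_fun setT (fun q : R * R => k q.1 (q.2 / sigma)).
  by apply: measurable_abel_kernel; exact: measurable_funM.
have mh : measurable_fun setT h.
  apply: measurable_funM => //.
  apply: measurable_funM; first exact: measurableT_comp.
  exact: measurable_fun_sqrt.
have mK : measurable_fun setT (fun q : R * R => w s q.2 * k q.1 (q.2 / sigma)).
  apply: measurable_funM => //.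
  exact: (measurableT_comp (measurable_inversion_weight s)).
have c0 : 0 <= sigma * (2 * (sigma / s) + 1) ^+ nu * pi / (2 * s).
  rewrite !mulr_ge0 ?invr_ge0 ?mulr_ge0 ?pi_ge0 ?(ltW s0) ?(ltW sigma_gt0)//.
  by rewrite exprn_ge0// addr_ge0// mulr_ge0// divr_ge0// ltW.
have Kc p : g p * Num.sqrt p != 0 -> (\int[mu]_t (`|w s t * k p (t / sigma)|)%:E <=
    (sigma * (2 * (sigma / s) + 1) ^+ nu * pi / (2 * s))%:E)%E.
  by rewrite mulf_eq0 negb_or => /andP[/g_supp psig _]; exact: kernel_bound.
have fin : (\int[mu]_p \int[mu]_t (`|w s t * h (p, t)|)%:E < +oo)%E.
  have := tonelli_lty c0 (integrable_supp_sqrt sigma_gt0 mg g_supp g_L2) mK Kc.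
  apply: le_lt_trans; rewrite le_eqVlt; apply/orP; left; apply/eqP.
  apply: eq_integral => p _; apply: eq_integral => t _.
  by rewrite /h/= mulrA [in RHS]mulrC.
have [h1 h2] := Rfubini mh (measurable_inversion_weight s) fin; split => //.
rewrite [LHS]h2 /tail_integral -RintegralZl//; last first.
  apply: (@integrable_supp _ _ _ sigma_gt0 mg g_supp g_L2 _ (Num.sqrt s)^-1).
    apply: measurable_funM; first by apply: measurable_funV; exact: measurable_fun_sqrt.
    rewrite (_ : (fun p => _) = \1_(`]s, +oo[%classic)); first exact: measurable_indic.
    by apply/funext => p; rewrite indicE mem_setE in_itv/= andbT.
  move=> p /andP[p0 _]; have [sp|_] := ltP s p; last first.
    by rewrite mulr0 normr0 invr_ge0 sqrtr_ge0.
  rewrite mulr1 ger0_norm ?invr_ge0 ?sqrtr_ge0// lef_pV2 ?posrE ?sqrtr_gt0//.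
  by rewrite ler_sqrt// ltW.
apply: eq_Rintegral => p _; rewrite /h /=.
have [gp|gp] := eqVneq (g p) 0.
  rewrite gp !(mul0r, mulr0) -[RHS](mul0r (fine (mu setT))) -Rintegral_cst//.
  by apply: eq_Rintegral => t _; rewrite /= !(mul0r, mulr0).
have psig := g_supp gp; have /andP[p0 _] := psig.
have [i1 e1] := kernel_integral s0 psig.
transitivity (\int[mu]_t ((g p * Num.sqrt p) * (w s t * k p (t / sigma)))).
  by apply: eq_Rintegral => t _; rewrite /= mulrA mulrC.
rewrite RintegralZl// e1.
rewrite (_ : p^-1 = (Num.sqrt p)^-1 * (Num.sqrt p)^-1); last first.
  by rewrite -invfM -expr2 sqr_sqrtr// ltW.
by field; rewrite gt_eqF// sqrtr_gt0.
Qed.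

End abel_inversion.

(** * Almost everywhere statements under dilations *)

Section ae_scale.
Variable R : realType.
Notation mu := (@lebesgue_measure R).

(** Both sides are measures that agree on half-open intervals. *)
Lemma lebesgue_measure_scale (c : R) (M : set R) : 0 < c -> measurable M ->
  (mu ((fun x => (x / c)%R) @^-1` M) = c%:E * mu M)%E.
Proof.
move=> c0 mM; pose phi : measurableTypeR R -> measurableTypeR R := fun x : R => x / c.
have mphi : measurable_fun setT phi by exact: (@measurable_funM _ (measurableTypeR R) R setT id (cst c^-1)).
have ci0 : 0 <= c^-1 by rewrite invr_ge0 ltW.
pose pm : {measure set (measurableTypeR R) -> \bar R} :=
  measure_function_pushforward__canonical__measure_function_Measure mu mphi.
pose m : {measure set (measurableTypeR R) -> \bar R} :=
  mscale (NngNum ci0) pm.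
have mE : forall A, measurable A -> mu A = m A.
  apply: lebesgue_measure_unique => X /ocitvP[->|[[a b] /= ab ->]].
    by rewrite !measure0.
  rewrite /m /= /mscale /= /pm /= /pushforward.
  rewrite (_ : phi @^-1` `]a, b] = `](a * c), (b * c)]%classic); last first.
    by apply/seteqP; split => x; rewrite /phi /= !in_itv/= ltr_pdivlMr// ler_pdivrMr.
  rewrite !lebesgue_measure_itv /= !lte_fin ltr_pM2r// ab -!EFinB -EFinM.
  by congr EFin; field; rewrite gt_eqF.
rewrite (mE M mM) /m /= /mscale /= /pm /= /pushforward muleA -EFinM divff ?mul1e//.
by rewrite gt_eqF.
Qed.

Lemma ae_scale (c : R) (P : R -> Prop) : 0 < c ->
  {ae mu, forall x, P x} -> {ae mu, forall x, P (x / c)}.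
Proof.
move=> c0 [N [mN N0 PN]]; exists ((fun x => x / c) @^-1` N); split.
- have mphi : measurable_fun setT (fun x : R => x / c) by exact: measurable_funM.
  by rewrite -[X in measurable X]setTI; exact: mphi.
- by rewrite lebesgue_measure_scale// N0 mule0.
- by move=> x /= nP; apply: PN.
Qed.

End ae_scale.

(** * Differentiation of the tail integral *)

Section tail.
Variable R : realType.
Notation mu := (@lebesgue_measure R).
Implicit Types (s p : R).

Variables (sigma : R) (g : R -> R).
Hypothesis sigma_gt0 : 0 < sigma.
Hypothesis mg : measurable_fun setT g.
Hypothesis g_supp : forall s, g s != 0 -> 0 < s < sigma.
Hypothesis g_L2 : (\int[mu]_s (g s ^+ 2)%:E < +oo)%E.

(** As $g(p)/\sqrt p$ need not be integrable near $0$, the differentiation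
    theorem is applied to its restrictions to $]\sigma/(n+1), +\infty[$; the
    countably many exceptional sets have a null union. *)
Lemma derive_tail_integral : {ae mu, forall s, 0 < s < sigma ->
  is_derive s 1 (tail_integral g) (- (g s / Num.sqrt s))}.
Proof.
pose phi a p := g p * ((Num.sqrt p)^-1 * (a < p)%R%:R).
pose a n := sigma / n.+1%:R.
have a0 n : 0 < a n by rewrite divr_gt0.
have iphi b : 0 < b -> mu.-integrable setT (EFin \o phi b).
  move=> b0; apply: (@integrable_supp _ _ _ sigma_gt0 mg g_supp g_L2 _ (Num.sqrt b)^-1).
    apply: measurable_funM; first by apply: measurable_funV; exact: measurable_fun_sqrt.
    rewrite (_ : (fun p => _) = \1_(`]b, +oo[%classic)); first exact: measurable_indic.
    by apply/funext => p; rewrite indicE mem_setE in_itv/= andbT.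
  move=> p /andP[p0 _]; have [sp|_] := ltP b p; last first.
    by rewrite mulr0 normr0 invr_ge0 sqrtr_ge0.
  rewrite mulr1 ger0_norm ?invr_ge0 ?sqrtr_ge0// lef_pV2 ?posrE ?sqrtr_gt0//.
  by rewrite ler_sqrt// ltW.
pose F n x := \int[mu]_(t in `]-oo, x]) phi (a n) t.
have dF n : {ae mu, forall x, derivable (F n) x 1 /\ derive1 (F n) x = phi (a n) x}.
  apply: FTC1Ny; last by apply: open_integrable_locally => //; [exact: openT|exact: iphi].
  by move=> y; apply: integrableS (iphi _ (a0 n)).
have : {ae mu, forall x, forall n, derivable (F n) x 1 /\ derive1 (F n) x = phi (a n) x}.
  exact: ae_foralln.
apply: ae_imply => s dFs /andP[s0 ssigma].
have [n an] : exists n, a n < s.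
  exists (Num.trunc (sigma / s)); rewrite /a ltr_pdivrMr// mulrC -ltr_pdivrMr//.
  exact: truncnS_gt.
have [d1 d2] := dFs n.
have tailE x : a n < x -> tail_integral g x = \int[mu]_p phi (a n) p - F n x.
  move=> ax; rewrite /F [X in _ - X]Rintegral_mkcond -RintegralB//; last 2 first.
  - exact: iphi.
  - rewrite -restrict_EFin; apply/(integrable_mkcond _ _).1 => //.
    by apply: integrableS (iphi _ (a0 n)).
  apply: eq_Rintegral => p _; rewrite /= patchE mem_setE in_itv/= /phi.
  have [px|xp] := leP p x; first by rewrite !mulr0 subrr.
  by rewrite (lt_trans ax xp) subr0.
have dFn : is_derive s 1 (F n) (phi (a n) s).
  by apply: DeriveDef; [exact: d1|rewrite -derive1E; exact: d2].
have -> : - (g s / Num.sqrt s) = 0 - phi (a n) s by rewrite /phi an mulr1 sub0r.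
apply: (@near_eq_is_derive _ _ _ (cst (\int[mu]_p phi (a n) p) - F n)).
near=> x; rewrite tailE//; near: x.
exact: lt_nbhsr.
Unshelve. all: by end_near. Qed.

End tail.

Local Open Scope complex_scope.

(** * Complex square-integrable functions *)

Section complex_L2.
Variable R : realType.
Notation mu := (@lebesgue_measure R).
Notation Re := (@complex.Re R).
Notation Im := (@complex.Im R).
Notation normc := (@ComplexField.Normc.normc R).
Implicit Types (x y : R[i]) (f g u v : R -> R[i]) (A : set R).

Lemma complex_eqP x y : Re x = Re y -> Im x = Im y -> x = y.
Proof. by case: x => a b; case: y => c d /= -> ->. Qed.

Lemma ReD x y : Re (x + y) = Re x + Re y.
Proof. by case: x => ? ?; case: y. Qed.

Lemma ImD x y : Im (x + y) = Im x + Im y.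
Proof. by case: x => ? ?; case: y. Qed.

Lemma ReB x y : Re (x - y) = Re x - Re y.
Proof. by case: x => ? ?; case: y. Qed.

Lemma ImB x y : Im (x - y) = Im x - Im y.
Proof. by case: x => ? ?; case: y. Qed.

Lemma ReM x y : Re (x * y) = Re x * Re y - Im x * Im y.
Proof. by case: x => ? ?; case: y. Qed.

Lemma ImM x y : Im (x * y) = Re x * Im y + Im x * Re y.
Proof. by case: x => ? ?; case: y. Qed.

Lemma ReZl (a : R) x : Re (a%:C * x) = a * Re x.
Proof. by rewrite ReM /= mul0r subr0. Qed.

Lemma ImZl (a : R) x : Im (a%:C * x) = a * Im x.
Proof. by rewrite ImM /= mul0r addr0. Qed.

Lemma ReZr x (a : R) : Re (x * a%:C) = Re x * a.
Proof. by rewrite ReM /= mulr0 subr0. Qed.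

Lemma ImZr x (a : R) : Im (x * a%:C) = Im x * a.
Proof. by rewrite ImM /= mulr0 add0r. Qed.

Lemma sqr_normcE x : normc x ^+ 2 = Re x ^+ 2 + Im x ^+ 2.
Proof. by case: x => a b; rewrite /= sqr_sqrtr// addr_ge0 ?sqr_ge0. Qed.

Lemma measurable_sqr_normc A f : measurable_fun A (fun t => Re (f t)) ->
  measurable_fun A (fun t => Im (f t)) ->
  measurable_fun A (fun t => normc (f t) ^+ 2).
Proof.
move=> mR mI; rewrite (_ : (fun t => _) = (fun t => Re (f t) ^+ 2 + Im (f t) ^+ 2)).
  by apply: measurable_funD; exact: measurable_funX.
by apply/funext => t; rewrite sqr_normcE.
Qed.

Lemma L2_Re A f : measurable A -> L2 A f ->
  (\int[mu]_(t in A) (Re (f t) ^+ 2)%:E < +oo)%E.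
Proof.
move=> mA [mR mI]; apply: le_lt_trans; apply: ge0_le_integral => //.
- by move=> t _; rewrite lee_fin sqr_ge0.
- by apply/measurable_EFinP; exact: measurable_funX.
- by apply/measurable_EFinP; exact: measurable_sqr_normc.
- by move=> t _; rewrite lee_fin sqr_normcE lerDl sqr_ge0.
Qed.

Lemma L2_Im A f : measurable A -> L2 A f ->
  (\int[mu]_(t in A) (Im (f t) ^+ 2)%:E < +oo)%E.
Proof.
move=> mA [mR mI]; apply: le_lt_trans; apply: ge0_le_integral => //.
- by move=> t _; rewrite lee_fin sqr_ge0.
- by apply/measurable_EFinP; exact: measurable_funX.
- by apply/measurable_EFinP; exact: measurable_sqr_normc.
- by move=> t _; rewrite lee_fin sqr_normcE lerDr sqr_ge0.
Qed.

Lemma L2_intro A f : measurable A -> measurable_fun A (fun t => Re (f t)) ->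
  measurable_fun A (fun t => Im (f t)) ->
  (\int[mu]_(t in A) (Re (f t) ^+ 2)%:E < +oo)%E ->
  (\int[mu]_(t in A) (Im (f t) ^+ 2)%:E < +oo)%E -> L2 A f.
Proof.
move=> mA mR mI lR lI; split => //.
under eq_integral do rewrite sqr_normcE EFinD.
rewrite ge0_integralD//; first exact: lte_add_pinfty.
- by move=> t _; rewrite lee_fin sqr_ge0.
- by apply/measurable_EFinP; exact: measurable_funX.
- by move=> t _; rewrite lee_fin sqr_ge0.
- by apply/measurable_EFinP; exact: measurable_funX.
Qed.

Lemma sqr_integral_comb A (p q : R -> R) (a b : R) : measurable A ->
  measurable_fun A p -> measurable_fun A q ->
  (\int[mu]_(t in A) (p t ^+ 2)%:E < +oo)%E ->
  (\int[mu]_(t in A) (q t ^+ 2)%:E < +oo)%E ->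
  (\int[mu]_(t in A) ((a * p t + b * q t) ^+ 2)%:E < +oo)%E.
Proof.
move=> mA mp mq lp lq.
have mp2 : measurable_fun A (fun t => (p t ^+ 2)%:E).
  by apply/measurable_EFinP; exact: measurable_funX.
have mq2 : measurable_fun A (fun t => (q t ^+ 2)%:E).
  by apply/measurable_EFinP; exact: measurable_funX.
have p0 t : A t -> (0 <= (p t ^+ 2)%:E)%E by rewrite lee_fin sqr_ge0.
have q0 t : A t -> (0 <= (q t ^+ 2)%:E)%E by rewrite lee_fin sqr_ge0.
have ca : (0 <= (2 * a ^+ 2)%:E)%E by rewrite lee_fin mulr_ge0 ?sqr_ge0.
have cb : (0 <= (2 * b ^+ 2)%:E)%E by rewrite lee_fin mulr_ge0 ?sqr_ge0.
apply: (@le_lt_trans _ _ ((2 * a ^+ 2)%:E * \int[mu]_(t in A) (p t ^+ 2)%:E +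
    (2 * b ^+ 2)%:E * \int[mu]_(t in A) (q t ^+ 2)%:E)%E); last first.
  have fp : (\int[mu]_(t in A) (p t ^+ 2)%:E)%E \is a fin_num.
    by rewrite ge0_fin_numE// integral_ge0.
  have fq : (\int[mu]_(t in A) (q t ^+ 2)%:E)%E \is a fin_num.
    by rewrite ge0_fin_numE// integral_ge0.
  by rewrite -(fineK fp) -(fineK fq) -!EFinM -EFinD ltry.
rewrite -!ge0_integralZl// -ge0_integralD//; last 4 first.
- by move=> t At; rewrite mule_ge0// p0.
- exact: measurable_funeM.
- by move=> t At; rewrite mule_ge0// q0.
- exact: measurable_funeM.
apply: ge0_le_integral => //.
- by move=> t _; rewrite lee_fin sqr_ge0.
- apply/measurable_EFinP; apply: measurable_funX; apply: measurable_funD;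
    exact: measurable_funM.
- by apply: emeasurable_funD; exact: measurable_funeM.
move=> t _; rewrite -!EFinM -EFinD lee_fin -subr_ge0.
by have := sqr_ge0 (a * p t - b * q t); congr (0 <= _); ring.
Qed.

Lemma sqr_integrable A (p : R -> R) : measurable A -> (mu A < +oo)%E ->
  measurable_fun A p -> (\int[mu]_(t in A) (p t ^+ 2)%:E < +oo)%E ->
  mu.-integrable A (EFin \o p).
Proof.
move=> mA Aoo mp lp.
have i2 : mu.-integrable A (EFin \o (fun t => p t ^+ 2)).
  apply/integrableP; split; first by apply/measurable_EFinP; exact: measurable_funX.
  by under eq_integral do rewrite /= ger0_norm ?sqr_ge0//.
have i1 : mu.-integrable A (EFin \o cst (1 : R)).
  apply: measurable_bounded_integrable => //.
  exists 1; split => // M M1 t _ /=; by rewrite normr1 ltW.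
apply: (le_integrable _ _ _ (RintegrableD mA i2 i1)) => //.
  exact/measurable_EFinP.
move=> t _ /=; rewrite lee_fin [leRHS]ger0_norm ?addr_ge0 ?sqr_ge0//.
rewrite -[p t ^+ 2]real_normK ?num_real//.
have := normr_ge0 (p t); set x := `|p t| => x0.
by have := sqr_ge0 (x - 1); rewrite sqrrB1 => h; lra.
Qed.

(** Squared form of the triangle inequality,
    $|u - v|^2 \le 2 |F_n - u|^2 + 2 |F_n - v|^2$, integrated and passed to the
    limit. *)
Lemma cvg_L2_unique A (F : nat -> R -> R[i]) u v : measurable A ->
  (forall n, measurable_fun A (fun t => Re (F n t))) ->
  (forall n, measurable_fun A (fun t => Im (F n t))) ->
  L2 A u -> L2 A v -> cvg_L2 A F u -> cvg_L2 A F v ->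
  ae_on A (fun t => u t = v t).
Proof.
move=> mA mR mI [uR uI _] [vR vI _] Fu Fv.
have mB f g : measurable_fun A (fun t => Re (f t)) -> measurable_fun A (fun t => Im (f t)) ->
    measurable_fun A (fun t => Re (g t)) -> measurable_fun A (fun t => Im (g t)) ->
    measurable_fun A (fun t => normc (f t - g t) ^+ 2).
  move=> m1 m2 m3 m4; apply: measurable_sqr_normc.
    by under eq_fun do rewrite ReB; exact: measurable_funB.
  by under eq_fun do rewrite ImB; exact: measurable_funB.
pose N := (\int[mu]_(t in A) (normc (u t - v t) ^+ 2)%:E)%E.
pose d n := (\int[mu]_(t in A) (normc (F n t - u t) ^+ 2)%:E)%E.
pose e n := (\int[mu]_(t in A) (normc (F n t - v t) ^+ 2)%:E)%E.
have Nle n : (N <= 2%:E * d n + 2%:E * e n)%E.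
  have md : measurable_fun A (fun t => (normc (F n t - u t) ^+ 2)%:E).
    by apply/measurable_EFinP; exact: mB.
  have me : measurable_fun A (fun t => (normc (F n t - v t) ^+ 2)%:E).
    by apply/measurable_EFinP; exact: mB.
  rewrite -!ge0_integralZl//; try (by move=> t _; rewrite lee_fin sqr_ge0).
  rewrite -ge0_integralD//; last 4 first.
  - by move=> t _; rewrite mule_ge0// lee_fin sqr_ge0.
  - exact: measurable_funeM.
  - by move=> t _; rewrite mule_ge0// lee_fin sqr_ge0.
  - exact: measurable_funeM.
  apply: ge0_le_integral => //.
  - by move=> t _; rewrite lee_fin sqr_ge0.
  - by apply/measurable_EFinP; exact: mB.
  - by apply: emeasurable_funD; exact: measurable_funeM.
  move=> t _; rewrite -!EFinM -EFinD lee_fin !sqr_normcE !ReB !ImB -subr_ge0.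
  have h1 := sqr_ge0 (Re (F n t) * 2 - Re (u t) - Re (v t)).
  have h2 := sqr_ge0 (Im (F n t) * 2 - Im (u t) - Im (v t)).
  by have := addr_ge0 h1 h2; congr (0 <= _); ring.
have cv : (fun n => 2%:E * d n + 2%:E * e n)%E @ \oo --> (0%E : \bar R).
  rewrite -[X in _ --> X](_ : (2%:E * 0 + 2%:E * 0 = 0)%E); last by rewrite !mule0 adde0.
  by apply: cvgeD; [rewrite !mule0|exact: cvgeZl|exact: cvgeZl].
have N0 : N = 0%E.
  apply/eqP; rewrite eq_le; apply/andP; split; last first.
    by apply: integral_ge0 => t _; rewrite lee_fin sqr_ge0.
  rewrite -(cvg_lim _ cv)//; apply: lime_ge; first by apply/cvg_ex; exists 0%E.
  exact: nearW.
have : ae_eq mu A (fun t => (normc (u t - v t) ^+ 2)%:E) (cst 0%E).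
  apply/(ae_eq_integral_abs mu mA).
    by apply/measurable_EFinP; exact: mB.
  rewrite -[RHS]N0; apply: eq_integral => t _.
  by rewrite /= ger0_norm// sqr_ge0.
apply: ae_imply => t h At; have /= [/eqP] := h At.
rewrite sqrf_eq0 => /eqP /ComplexField.Normc.eq0_normc /eqP.
by rewrite subr_eq0 => /eqP.
Qed.

End complex_L2.

(** * The Fourier transform of the Abel transform *)

Section bessel_facts.
Variable R : realType.
Notation mu := (@lebesgue_measure R).
Implicit Types (x t s b : R).

Lemma besselJN nu x : besselJ nu (- x) = (-1) ^+ nu * besselJ nu x.
Proof.
have h1 := @cvg_besselJ R nu (- x).
have h2 : (fun M => (-1) ^+ nu * series (besselJ_coeff nu x) M) @ \oo -->
    (-1) ^+ nu * besselJ nu x.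
  by apply: cvgM; [exact: cvg_cst|exact: cvg_besselJ].
apply: (cvg_unique _ h1) => //.
rewrite (_ : series _ = (fun M => (-1) ^+ nu * series (besselJ_coeff nu x) M)) //.
apply/funext => M; rewrite /series/= mulr_sumr; apply: eq_bigr => m _.
have -> : besselJ_coeff nu (- x) m = (-1) ^+ m / (m`! * (m + nu)`!)%:R *
    ((-1) ^+ (2 * m + nu) * (x / 2) ^+ (2 * m + nu)).
  by rewrite /besselJ_coeff mulNr [(- (x / 2)) ^+ _]exprNn.
by rewrite exprD exprM sqrrN !expr1n mul1r /besselJ_coeff; ring.
Qed.

Lemma measurable_besselJ nu : measurable_fun setT (@besselJ R nu).
Proof.
apply: (@measurable_fun_cvg _ _ _ setT (fun M x => series (besselJ_coeff nu x) M)).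
  move=> M; rewrite /series/=; apply: measurable_sum => m.
  apply: measurable_funM => //; apply: measurable_funX.
  exact: measurable_funM.
by move=> x _; exact: cvg_besselJ.
Qed.

Lemma re_expi_sqr nu : re_expi R nu ^+ 2 + im_expi R nu ^+ 2 = 1.
Proof.
rewrite /re_expi /im_expi !exprMn !sqrr_sign !mulr1 -!natrX.
by case: (odd nu); rewrite ?expr0n ?expr1n /= ?addr0 ?add0r.
Qed.

Lemma expiE nu : (0 +i* 1) ^+ nu = re_expi R nu +i* im_expi R nu.
Proof.
elim/ltn_ind: nu => -[_|[_|n ih]].
- by rewrite /re_expi /im_expi /= expr0 mul1r mul0r.
- by rewrite /re_expi /im_expi /= expr0 mul1r mul0r.
have mul_i (a b : R) : (a +i* b) * (0 +i* 1) = (- b) +i* a.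
  by apply: complex_eqP => /=; ring.
rewrite exprSr exprSr ih// !mul_i; congr (_ +i* _).
  by rewrite /re_expi /= negbK exprS mulN1r mulrN.
rewrite /im_expi; case: n {ih} => [|n] /=; first by rewrite !mul0r oppr0.
by rewrite negbK exprS mulN1r mulrN.
Qed.

(** Read off the Fourier integral with $a = 1$, whose weight has mass $\pi$. *)
Lemma besselJ_le1 nu b : `|besselJ nu b| <= 1.
Proof.
have [i1 e1] := @abel_integral0 R 1 ltr01.
have aux (E : R -> R) c : continuous E -> (forall x, `|E x| <= 1) -> `|c| = 1 ->
    \int[mu]_(z in `]-1, 1[) (E (b * z) * ((chebyshevT R nu).[z / 1] /
      Num.sqrt (1 ^+ 2 - z ^+ 2))) = pi * (c * besselJ nu (b * 1)) ->
    `|besselJ nu b| <= 1.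
  move=> cE E1 c1 e.
  rewrite -(@ler_pM2l _ pi) ?pi_gt0// mulr1.
  have -> : pi * `|besselJ nu b| = `|pi * (c * besselJ nu (b * 1))|.
    by rewrite !normrM c1 mul1r mulr1 [`|pi|]gtr0_norm ?pi_gt0.
  have [iT _] := @abel_integralT R nu 1 ltr01.
  have iE : mu.-integrable `]-1, 1[ (EFin \o (fun z => E (b * z) *
      ((chebyshevT R nu).[z / 1] / Num.sqrt (1 ^+ 2 - z ^+ 2)))).
    apply: (le_integrable _ _ _ iT) => //.
      apply/measurable_EFinP; apply: measurable_funM.
        apply: measurable_funTS; apply: continuous_measurable_fun.
        by apply: (@continuous_fun_comp _ (fun z => b * z)) => //; exact: mulrl_continuous.
      by move/measurable_int : iT => /measurable_EFinP.
    by move=> z _; rewrite lee_fin normrM ler_piMl.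
  rewrite -e -[leRHS]e1; apply: le_trans (le_normr_Rintegral _ iE) _ => //.
  apply: le_Rintegral => //; first exact: integrable_norm.
  move=> z; rewrite /= in_itv/= => /andP[z1 z2].
  have za : `|z| <= 1 by rewrite ler_norml !ltW.
  rewrite normrM normrM [`|_^-1|]ger0_norm ?invr_ge0 ?sqrtr_ge0//.
  rewrite mulrA ler_piMl ?invr_ge0 ?sqrtr_ge0// -[leRHS]mulr1.
  by apply: ler_pM => //; rewrite chebyshevT_le1// divr1.
have [nu_odd|nu_even] := boolP (odd nu).
- apply: (aux sin (im_expi R nu)).
  + exact: continuous_sin.
  + by move=> x; rewrite ler_norml sin_geN1 sin_le1.
  + by rewrite /im_expi nu_odd mul1r normrX normrN1 expr1n.
  + exact: sin_chebyshev_integral.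
- apply: (aux cos (re_expi R nu)).
  + exact: continuous_cos.
  + by move=> x; rewrite ler_norml cos_geN1 cos_le1.
  + by rewrite /re_expi nu_even mul1r normrX normrN1 expr1n.
  + exact: cos_chebyshev_integral.
Qed.

End bessel_facts.

Section fourier_abel.
Variable R : realType.
Notation mu := (@lebesgue_measure R).
Implicit Types (x t s b : R).
Variables (nu : nat) (sigma : R) (g : R -> R).
Hypothesis sigma_gt0 : 0 < sigma.
Hypothesis mg : measurable_fun setT g.
Hypothesis g_supp : forall s, g s != 0 -> 0 < s < sigma.
Hypothesis g_L2 : (\int[mu]_s (g s ^+ 2)%:E < +oo)%E.
Notation A := (abel_transform nu sigma g).

(** The Hankel transform of [g] divided by the square root of its variable; this
    quotient makes sense on the whole line. *)
Definition hankel_div t : R := \int[mu]_s (g s * (Num.sqrt s * besselJ nu (t * s))).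

Lemma integrable_hankel_div t :
  mu.-integrable setT (EFin \o (fun s => g s * (Num.sqrt s * besselJ nu (t * s)))).
Proof.
apply: (@integrable_supp _ _ _ sigma_gt0 mg g_supp g_L2 _ (Num.sqrt sigma)).
  apply: measurable_funM; first exact: measurable_fun_sqrt.
  by apply: (measurableT_comp (measurable_besselJ nu)); exact: measurable_funM.
move=> s /andP[s0 ss]; rewrite normrM [`|Num.sqrt s|]ger0_norm ?sqrtr_ge0//.
rewrite -[leRHS]mulr1; apply: ler_pM => //; last exact: besselJ_le1.
by rewrite ler_sqrt// ltW.
Qed.

(** The Fourier integral of the kernel is a Bessel function by
    [cos_chebyshev_integral] or [sin_chebyshev_integral], so that of [A] is an
    integral of [g] against Bessel functions. *)
Let fourier (E : R -> R) (e : R) b : continuous E -> (forall x, `|E x| <= 1) ->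
  (forall a, 0 < a -> \int[mu]_(z in `]-a, a[) (E (b * z) *
    ((chebyshevT R nu).[z / a] / Num.sqrt (a ^+ 2 - z ^+ 2))) =
    pi * (e * besselJ nu (b * a))) ->
  mu.-integrable setT (EFin \o (fun z => E (b * z) * A z)) /\
  \int[mu]_z (E (b * z) * A z) = pi * (e * hankel_div (b / sigma)).
Proof.
move=> cE E1 hE.
have mE : measurable_fun setT (fun z => E (b * z)).
  apply: continuous_measurable_fun.
  by apply: (@continuous_fun_comp _ (fun z => b * z)) => //; exact: mulrl_continuous.
have [h1 ->] := integral_abel_transform nu sigma_gt0 mg g_supp g_L2 mE (fun z => E1 _).
split => //; rewrite mulrA -RintegralZl//; last exact: integrable_hankel_div.
apply: eq_Rintegral => s _ /=.
have [->|/g_supp/andP[s0 _]] := eqVneq (g s) 0; first by rewrite !mul0r mulr0.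
rewrite Rintegral_abel_kernel hE ?divr_gt0//.
by rewrite (_ : b * (s / sigma) = b / sigma * s); [ring|rewrite mulrCA mulrC].
Qed.

Lemma fourier_cos b :
  mu.-integrable setT (EFin \o (fun z => cos (b * z) * A z)) /\
  \int[mu]_z (cos (b * z) * A z) = pi * (re_expi R nu * hankel_div (b / sigma)).
Proof.
apply: fourier; first exact: continuous_cos.
  by move=> x; rewrite ler_norml cos_geN1 cos_le1.
by move=> a a0; exact: cos_chebyshev_integral.
Qed.

Lemma fourier_sin b :
  mu.-integrable setT (EFin \o (fun z => sin (b * z) * A z)) /\
  \int[mu]_z (sin (b * z) * A z) = pi * (im_expi R nu * hankel_div (b / sigma)).
Proof.
apply: fourier; first exact: continuous_sin.
  by move=> x; rewrite ler_norml sin_geN1 sin_le1.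
by move=> a a0; exact: sin_chebyshev_integral.
Qed.

Lemma hankel_divN t : hankel_div (- t) = (-1) ^+ nu * hankel_div t.
Proof.
rewrite /hankel_div -RintegralZl//; last exact: integrable_hankel_div.
by apply: eq_Rintegral => s _ /=; rewrite mulNr besselJN; ring.
Qed.

End fourier_abel.

(** * Restriction to the support *)

Section real_integral_tools.
Variable R : realType.
Notation mu := (@lebesgue_measure R).

Lemma Rintegral_lin2 (D : set R) (p q : R -> R) (a b : R) : measurable D ->
  mu.-integrable D (EFin \o p) -> mu.-integrable D (EFin \o q) ->
  mu.-integrable D (EFin \o (fun t => a * p t + b * q t)) /\
  \int[mu]_(t in D) (a * p t + b * q t) =
    a * (\int[mu]_(t in D) p t) + b * (\int[mu]_(t in D) q t).
Proof.
move=> mD ip iq; have iap := RintegrableZ a mD ip; have ibq := RintegrableZ b mD iq.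
by split; [exact: RintegrableD|rewrite RintegralD// !RintegralZl].
Qed.

Lemma Rintegral_out (D : set R) (F : R -> R) : (forall x, ~ D x -> F x = 0) ->
  \int[mu]_(x in D) F x = \int[mu]_x F x.
Proof.
move=> FD; rewrite Rintegral_mkcond; apply: eq_Rintegral => x _.
by rewrite patchE; case: ifPn => // /negP xD; rewrite FD// => Dx; apply: xD; rewrite inE.
Qed.

Lemma ae_neq (c : R) : {ae mu, forall x : R, x != c}.
Proof.
exists [set c]; split; [exact: measurable_set1|exact: lebesgue_measure_set1|].
by move=> x /= /negP; rewrite negbK => /eqP.
Qed.

Variable sigma : R.
Hypothesis sigma_gt0 : 0 < sigma.

(** The end points are removed so that [s] and [sigma - s] are positive wherever
    the function is nonzero. *)
Definition cut_off (p : R -> R) : R -> R := p \_ `]0, sigma[.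

Variable p : R -> R.
Hypothesis mp : measurable_fun (Rplus R) p.

Let sub_Rplus : `]0, sigma[ `<=` Rplus R.
Proof. by move=> x; rewrite /Rplus /= !in_itv/= andbT => /andP[/ltW]. Qed.

Let mRplus : measurable (Rplus R). Proof. exact: measurable_itv. Qed.

Lemma measurable_cut_off : measurable_fun setT (cut_off p).
Proof.
apply/(measurable_restrictT _ _).1 => //.
exact: measurable_funS mp.
Qed.

Lemma cut_off_supp s : cut_off p s != 0 -> 0 < s < sigma.
Proof. by rewrite /cut_off patchE mem_setE in_itv/=; case: ifP => //; rewrite eqxx. Qed.

Lemma cut_offE s : 0 < s < sigma -> cut_off p s = p s.
Proof. by move=> h; rewrite /cut_off patchE mem_setE in_itv/= h. Qed.

Lemma cut_off_L2 : (\int[mu]_(s in Rplus R) (p s ^+ 2)%:E < +oo)%E ->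
  (\int[mu]_s (cut_off p s ^+ 2)%:E < +oo)%E.
Proof.
apply: le_lt_trans.
rewrite [leLHS](_ : _ = \int[mu]_(s in `]0%R, sigma[) (p s ^+ 2)%:E)%E.
  apply: ge0_subset_integral => //.
  - by apply/measurable_EFinP; exact: measurable_funX.
  - by move=> x _; rewrite lee_fin sqr_ge0.
rewrite [RHS]integral_mkcond; apply: eq_integral => s _.
by rewrite /cut_off !patchE; case: ifP => // _; rewrite expr0n.
Qed.

Lemma ae_cut_off : {ae mu, forall s, Rplus R s -> sigma < s -> p s = 0} ->
  {ae mu, forall s, Rplus R s -> p s = cut_off p s}.
Proof.
move=> supp; have := ae_imply2 (fun x a b => conj a b) (ae_neq 0) (ae_neq sigma).
apply: ae_imply2 supp => s hs [s0 ss] Rs; have := Rs.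
rewrite /Rplus /= in_itv/= andbT le_eqVlt eq_sym (negbTE s0) /= => s_gt0.
rewrite /cut_off patchE mem_setE in_itv/= s_gt0 /=.
case: ltP => //; rewrite le_eqVlt eq_sym (negbTE ss) /=; exact: hs.
Qed.

Lemma Rintegral_cut_off (m : R -> R) : measurable_fun setT m ->
  {ae mu, forall s, Rplus R s -> sigma < s -> p s = 0} ->
  \int[mu]_(s in Rplus R) (p s * m s) = \int[mu]_s (cut_off p s * m s).
Proof.
move=> mm supp; rewrite -(@Rintegral_out (Rplus R)); last first.
  move=> s ns; suff -> : cut_off p s = 0 by rewrite mul0r.
  by apply/eqP/negPn/negP => /cut_off_supp h; apply: ns; apply: sub_Rplus; rewrite /= in_itv.
apply: ae_eq_Rintegral => //.
- by apply: measurable_funM => //; exact: measurable_funTS.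
- by apply: measurable_funTS; apply: measurable_funM => //; exact: measurable_cut_off.
- by apply: ae_imply (ae_cut_off supp) => s h Rs; rewrite h.
Qed.

End real_integral_tools.

(** * The Hankel transform as a finite Fourier transform *)

Section source.
Variable R : realType.
Notation mu := (@lebesgue_measure R).
Notation Re := (@complex.Re R).
Notation Im := (@complex.Im R).
Implicit Types (x t s z : R).
Variables (nu : nat) (r sigma : R) (f : R -> R[i]).
Hypothesis r_gt0 : 0 < r.
Hypothesis sigma_gt0 : 0 < sigma.
Hypothesis fL2 : L2 (Rplus R) f.
Hypothesis f_supp : supported sigma f.

Definition re_cut := cut_off sigma (fun s => Re (f s)).
Definition im_cut := cut_off sigma (fun s => Im (f s)).
Notation gr := re_cut.
Notation gi := im_cut.
Notation rho := (re_expi R nu).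
Notation iota := (im_expi R nu).
Notation Vr := (abel_transform nu sigma gr).
Notation Vi := (abel_transform nu sigma gi).

Let mRplus : measurable (Rplus R). Proof. exact: measurable_itv. Qed.
Let mIcc : measurable (Icc11 R). Proof. exact: measurable_itv. Qed.

Lemma measurable_re_cut : measurable_fun setT gr.
Proof. by apply: measurable_cut_off; case: fL2. Qed.
Lemma measurable_im_cut : measurable_fun setT gi.
Proof. by apply: measurable_cut_off; case: fL2. Qed.
Lemma re_cut_supp s : gr s != 0 -> 0 < s < sigma. Proof. exact: cut_off_supp. Qed.
Lemma im_cut_supp s : gi s != 0 -> 0 < s < sigma. Proof. exact: cut_off_supp. Qed.
Lemma re_cut_L2 : (\int[mu]_s (gr s ^+ 2)%:E < +oo)%E.
Proof. by apply: cut_off_L2; [case: fL2|exact: L2_Re]. Qed.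
Lemma im_cut_L2 : (\int[mu]_s (gi s ^+ 2)%:E < +oo)%E.
Proof. by apply: cut_off_L2; [case: fL2|exact: L2_Im]. Qed.

Let mgr := measurable_re_cut.
Let mgi := measurable_im_cut.
Let gr_supp := re_cut_supp.
Let gi_supp := im_cut_supp.
Let gr_L2 := re_cut_L2.
Let gi_L2 := im_cut_L2.

(** The function $\pi^{-1} i^{-\nu} (V_r + i V_i)$, whose Fourier transform is
    the rescaled Hankel transform of [f]. *)
Definition fourier_source z : R[i] :=
  (pi^-1 * (rho * Vr z + iota * Vi z)) +i* (pi^-1 * (rho * Vi z + - iota * Vr z)).

Let iVr : mu.-integrable setT (EFin \o Vr).
Proof. exact: integrable_abel_transform. Qed.
Let iVi : mu.-integrable setT (EFin \o Vi).
Proof. exact: integrable_abel_transform. Qed.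
Let mVr : measurable_fun setT Vr.
Proof. by have /measurable_int/measurable_EFinP := iVr. Qed.
Let mVi : measurable_fun setT Vi.
Proof. by have /measurable_int/measurable_EFinP := iVi. Qed.

Lemma measurable_re_source : measurable_fun setT (fun z => Re (fourier_source z)).
Proof.
apply: measurable_funM => //; apply: measurable_funD; exact: measurable_funM.
Qed.

Lemma measurable_im_source : measurable_fun setT (fun z => Im (fourier_source z)).
Proof.
apply: measurable_funM => //; apply: measurable_funD; exact: measurable_funM.
Qed.

Lemma fourier_source_out z : 1 <= `|z| -> fourier_source z = 0.
Proof.
move=> z1; rewrite /fourier_source (@abel_transform_out _ nu sigma gr)//.
rewrite (@abel_transform_out _ nu sigma gi)//.
by rewrite !mulr0 addr0 mulr0.
Qed.

Lemma fourier_source_L2 : L2 (Icc11 R) fourier_source.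
Proof.
have sub (V : R -> R) : measurable_fun setT V ->
    (\int[mu]_z (V z ^+ 2)%:E < +oo)%E -> (\int[mu]_(z in Icc11 R) (V z ^+ 2)%:E < +oo)%E.
  move=> mV; apply: le_lt_trans; apply: ge0_subset_integral => //.
  - by apply/measurable_EFinP; exact: measurable_funX.
  - by move=> z _; rewrite lee_fin sqr_ge0.
have lr := sub _ mVr (abel_transform_L2 nu sigma_gt0 mgr gr_supp gr_L2).
have li := sub _ mVi (abel_transform_L2 nu sigma_gt0 mgi gi_supp gi_L2).
have mr : measurable_fun (Icc11 R) Vr by exact: measurable_funTS.
have mi : measurable_fun (Icc11 R) Vi by exact: measurable_funTS.
apply: L2_intro => //.
- by apply: measurable_funTS; exact: measurable_re_source.
- by apply: measurable_funTS; exact: measurable_im_source.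
- rewrite /fourier_source /=; under eq_integral do rewrite mulrDr !mulrA.
  exact: sqr_integral_comb.
- rewrite /fourier_source /=; under eq_integral do rewrite mulrDr !mulrA.
  exact: sqr_integral_comb.
Qed.

Lemma Fc_fourier_source x : Fc (r * sigma) fourier_source x =
  hankel_div nu gr (r * x) +i* hankel_div nu gi (r * x).
Proof.
pose b := r * sigma * x.
have bE : b / sigma = r * x by rewrite /b; field; rewrite gt_eqF.
have [icr ecr] := fourier_cos nu sigma_gt0 mgr gr_supp gr_L2 b.
have [ici eci] := fourier_cos nu sigma_gt0 mgi gi_supp gi_L2 b.
have [isr esr] := fourier_sin nu sigma_gt0 mgr gr_supp gr_L2 b.
have [isi esi] := fourier_sin nu sigma_gt0 mgi gi_supp gi_L2 b.
have pi0 : pi != 0 :> R by rewrite gt_eqF// pi_gt0.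
have rs := re_expi_sqr R nu.
have out (F : R -> R) : (forall z, 1 <= `|z| -> F z = 0) ->
    \int[mu]_(z in Icc11 R) F z = \int[mu]_z F z.
  move=> F0; apply: Rintegral_out => z; rewrite /Icc11/= in_itv/= => /negP.
  by rewrite -ler_norml -ltNge => /ltW; exact: F0.
rewrite /Fc /cintegral; congr (_ +i* _).
- rewrite out; last by move=> z z1; rewrite fourier_source_out// mulr0.
  have [i1 e1] := Rintegral_lin2 (pi^-1 * rho) (pi^-1 * iota) measurableT icr ici.
  have [i2 e2] := Rintegral_lin2 (pi^-1 * rho) (pi^-1 * - iota) measurableT isi isr.
  have [i3 e3] := Rintegral_lin2 1 (-1) measurableT i1 i2.
  transitivity (\int[mu]_z (1 * (pi^-1 * rho * (cos (b * z) * Vr z) + pi^-1 * iota * (cos (b * z) * Vi z))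
    + -1 * (pi^-1 * rho * (sin (b * z) * Vi z) + pi^-1 * - iota * (sin (b * z) * Vr z)))).
    by apply: eq_Rintegral => z _; rewrite ReM /= -/b; ring.
  rewrite e3 e1 e2 ecr eci esr esi bE.
  set H1 := hankel_div _ _ _; set H2 := hankel_div _ _ _.
  transitivity ((rho ^+ 2 + iota ^+ 2) * H1); first by move: pi pi0 => P P0; field.
  by rewrite rs mul1r.
- rewrite out; last by move=> z z1; rewrite fourier_source_out// mulr0.
  have [i1 e1] := Rintegral_lin2 (pi^-1 * rho) (pi^-1 * - iota) measurableT ici icr.
  have [i2 e2] := Rintegral_lin2 (pi^-1 * rho) (pi^-1 * iota) measurableT isr isi.
  have [i3 e3] := Rintegral_lin2 1 1 measurableT i1 i2.
  transitivity (\int[mu]_z (1 * (pi^-1 * rho * (cos (b * z) * Vi z) + pi^-1 * - iota * (cos (b * z) * Vr z))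
    + 1 * (pi^-1 * rho * (sin (b * z) * Vr z) + pi^-1 * iota * (sin (b * z) * Vi z)))).
    by apply: eq_Rintegral => z _; rewrite ImM /= -/b; ring.
  rewrite e3 e1 e2 ecr eci esr esi bE.
  set H1 := hankel_div _ _ _; set H2 := hankel_div _ _ _.
  transitivity ((rho ^+ 2 + iota ^+ 2) * H1); first by move: pi pi0 => P P0; field.
  by rewrite rs mul1r.
Qed.

Lemma hankelE t : 0 < t -> hankel nu f t =
  (Num.sqrt t * hankel_div nu gr t) +i* (Num.sqrt t * hankel_div nu gi t).
Proof.
move=> t0; have [mR mI _] := fL2.
have mm : measurable_fun setT (fun s => besselJ nu (t * s) * Num.sqrt (t * s)).
  apply: measurable_funM; last by apply: measurable_fun_sqrt; exact: measurable_funM.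
  by apply: (measurableT_comp (measurable_besselJ nu)); exact: measurable_funM.
have aux (g : R -> R) : measurable_fun setT g -> (forall s, g s != 0 -> 0 < s < sigma) ->
    (\int[mu]_s (g s ^+ 2)%:E < +oo)%E ->
    \int[mu]_s (g s * (besselJ nu (t * s) * Num.sqrt (t * s))) =
    Num.sqrt t * hankel_div nu g t.
  move=> mg gs gl; rewrite /hankel_div -RintegralZl//; last first.
    exact: (integrable_hankel_div nu sigma_gt0 mg gs gl).
  by apply: eq_Rintegral => s _ /=; rewrite sqrtrM ?ltW//; ring.
rewrite /hankel /cintegral; congr (_ +i* _).
- under eq_Rintegral do rewrite ReZr.
  rewrite (@Rintegral_cut_off _ sigma _ mR)//; first exact: aux.
  by apply: ae_imply f_supp => s h Rs ss; rewrite h.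
- under eq_Rintegral do rewrite ImZr.
  rewrite (@Rintegral_cut_off _ sigma _ mI)//; first exact: aux.
  by apply: ae_imply f_supp => s h Rs ss; rewrite h.
Qed.

(** On the negative side the sign $(-1)^\nu$ is that of $J_\nu(-x)$. *)
Lemma h_rescE x : x != 0 -> h_resc r nu (hankel nu f) x =
  Fc (r * sigma) fourier_source x.
Proof.
move=> x0; rewrite Fc_fourier_source /h_resc.
have q y : 0 < y -> ((Num.sqrt (r * y))^-1)%:C * hankel nu f (r * y) =
    hankel_div nu gr (r * y) +i* hankel_div nu gi (r * y).
  move=> y0; have ry : 0 < r * y by rewrite mulr_gt0.
  have sq : Num.sqrt (r * y) != 0 by rewrite gt_eqF// sqrtr_gt0.
  by rewrite hankelE//; apply: complex_eqP; rewrite (ReZl, ImZl) /= mulKf.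
case: (ltgtP 0 x) => [x_gt0|x_lt0|/esym/eqP]; [exact: q| |by rewrite (negbTE x0)].
have sgnC : (-1) ^+ nu = ((-1) ^+ nu)%:C :> R[i].
  by rewrite rmorphXn/= rmorphN1.
rewrite q ?oppr_gt0// sgnC mulrN.
rewrite (hankel_divN nu sigma_gt0 mgr gr_supp gr_L2) (hankel_divN nu sigma_gt0 mgi gi_supp gi_L2).
by apply: complex_eqP; rewrite (ReZl, ImZl) /= mulrA -expr2 sqrr_sign mul1r.
Qed.

Lemma h_resc_in_range : in_range_Fc (r * sigma) (h_resc r nu (hankel nu f)).
Proof.
exists fourier_source; first exact: fourier_source_L2.
by apply: ae_imply (ae_neq 0) => x x0 _; exact: h_rescE.
Qed.

End source.

(** * Symmetry of the finite Fourier transform *)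

Section trigonometric_transform.
Variable R : realType.
Notation mu := (@lebesgue_measure R).
Implicit Types (x y : R).

Lemma measurable_fun_off_point (D : set R) (F G : R -> R) (a : R) : measurable D ->
  measurable_fun D F -> (forall x, D x -> x != a -> G x = F x) ->
  measurable_fun D G.
Proof.
move=> mD mF GF.
apply: (eq_measurable_fun (fun x => if x == a then G a else F x)).
  move=> x; rewrite inE => Dx; case: eqVneq => [->//|xa]; by rewrite GF.
apply: measurable_fun_if => //.
- by apply: measurable_fun_eqr => //; exact: measurable_id.
- apply: measurable_funS mF => //.
Qed.

Lemma ae_integrable (D : set R) (F G : R -> R) : measurable D ->
  measurable_fun D F -> {ae mu, forall x, D x -> F x = G x} ->
  mu.-integrable D (EFin \o G) -> mu.-integrable D (EFin \o F).
Proof.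
move=> mD mF FG iG; apply/integrableP; split; first exact/measurable_EFinP.
have /integrableP[mG] := iG; apply: le_lt_trans.
apply: ae_ge0_le_integral => //.
- by apply: measurableT_comp => //; exact/measurable_EFinP.
- exact: measurableT_comp.
- by apply: ae_imply FG => x h Dx /=; rewrite h.
Qed.

Lemma integrable_sqr_mul (D : set R) (p q : R -> R) : measurable D ->
  measurable_fun D p -> measurable_fun D q ->
  (\int[mu]_(x in D) (p x ^+ 2)%:E < +oo)%E ->
  (\int[mu]_(x in D) (q x ^+ 2)%:E < +oo)%E ->
  mu.-integrable D (EFin \o (fun x => p x * q x)).
Proof.
move=> mD mp mq lp lq.
have i2 (w : R -> R) : measurable_fun D w ->
    (\int[mu]_(x in D) (w x ^+ 2)%:E < +oo)%E ->
    mu.-integrable D (EFin \o (fun x => w x ^+ 2)).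
  move=> mw lw; apply/integrableP; split.
    by apply/measurable_EFinP; exact: measurable_funX.
  by under eq_integral do rewrite /= ger0_norm ?sqr_ge0//.
apply: (le_integrable _ _ _ (RintegrableD mD (i2 _ mp lp) (i2 _ mq lq))) => //.
  by apply/measurable_EFinP; exact: measurable_funM.
move=> x _; rewrite lee_fin /= [leRHS]ger0_norm ?addr_ge0 ?sqr_ge0// normrM.
rewrite -[p x ^+ 2]real_normK ?num_real// -[q x ^+ 2]real_normK ?num_real//.
have := normr_ge0 (p x); have := normr_ge0 (q x).
by have := sqr_ge0 (`|p x| - `|q x|); nra.
Qed.

Definition trig_transform (E : R -> R) (c : R) (a : R -> R) (x : R) : R :=
  \int[mu]_y (E (c * x * y) * a y).

Variables (E : R -> R) (c : R).
Hypothesis cE : continuous E.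
Hypothesis E1 : forall x, `|E x| <= 1.
Notation F := (trig_transform E c).

Let mE2 : measurable_fun setT (fun q : R * R => E (c * q.2 * q.1)).
Proof.
have mE : measurable_fun setT E by exact: continuous_measurable_fun.
by apply: (measurableT_comp mE); do 2 apply: measurable_funM => //.
Qed.

Lemma measurable_trig_transform a : measurable_fun setT a ->
  measurable_fun setT (F a).
Proof.
move=> ma; apply: (@measurable_Rintegral_section R
  (fun q => E (c * q.2 * q.1) * a q.1)).
by apply: measurable_funM; [exact: mE2|exact: measurableT_comp].
Qed.

Lemma integrable_trig x a : mu.-integrable setT (EFin \o a) ->
  mu.-integrable setT (EFin \o (fun y => E (c * x * y) * a y)).
Proof.
move=> ia; have /measurable_int/measurable_EFinP ma := ia.
apply: (le_integrable _ _ _ ia) => //.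
  apply/measurable_EFinP; apply: measurable_funM => //.
  exact: (measurableT_comp mE2 (pair2_measurable x)).
by move=> y _; rewrite lee_fin /= normrM ler_piMl.
Qed.

(** The kernel $E(cxy)$ is symmetric in $x$ and $y$. *)
Lemma trig_transform_swap p a : mu.-integrable setT (EFin \o p) ->
  mu.-integrable setT (EFin \o a) ->
  mu.-integrable setT (EFin \o (fun x => p x * F a x)) /\
  \int[mu]_x (p x * F a x) = \int[mu]_y (a y * F p y).
Proof.
move=> ip ia.
have /integrableP[/measurable_EFinP mp poo] := ip.
have /measurable_int/measurable_EFinP ma := ia.
pose h (q : R * R) := E (c * q.2 * q.1) * a q.1.
have mh : measurable_fun setT h.
  by apply: measurable_funM; [exact: mE2|exact: measurableT_comp].
have mK : measurable_fun setT (fun q : R * R => p q.2 * E (c * q.2 * q.1)).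
  by apply: measurable_funM; [exact: measurableT_comp|exact: mE2].
pose C := fine (\int[mu]_x (`|p x|)%:E)%E.
have C0 : 0 <= C by apply: fine_ge0; apply: integral_ge0.
have fin : (\int[mu]_y \int[mu]_x (`|p x * h (y, x)|)%:E < +oo)%E.
  rewrite [ltLHS](_ : _ =
      \int[mu]_y \int[mu]_x (`|a y * (p x * E (c * x * y))|)%:E)%E; last first.
    by apply: eq_integral => y _; apply: eq_integral => x _; rewrite /h /= mulrA mulrC.
  apply: (@tonelli_lty R a _ C C0 ia mK) => y _.
  rewrite fineK; last by rewrite ge0_fin_numE ?integral_ge0.
  apply: ge0_le_integral => //.
  - apply/measurable_EFinP; apply: measurableT_comp => //.
    exact: (measurableT_comp mK (pair1_measurable y)).
  - by apply/measurable_EFinP; exact: measurableT_comp.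
  - by move=> x _; rewrite lee_fin normrM ler_piMr.
have [i e] := @Rfubini R h p mh mp fin; split; first exact: i.
rewrite [LHS]e; apply: eq_Rintegral => y _ /=.
rewrite /trig_transform -RintegralZl//; last exact: integrable_trig.
by apply: eq_Rintegral => x _; rewrite /h /= (mulrAC c x y); ring.
Qed.

End trigonometric_transform.

Section complex_fourier.
Variable R : realType.
Notation mu := (@lebesgue_measure R).
Notation Re := (@complex.Re R).
Notation Im := (@complex.Im R).
Implicit Types (x y : R).

Let mIcc : measurable (Icc11 R). Proof. exact: measurable_itv. Qed.

Definition extend (a : R -> R) : R -> R := a \_ (Icc11 R).

Lemma extendE (a : R -> R) x : Icc11 R x -> extend a x = a x.
Proof. by move=> Ix; rewrite /extend patchE mem_set. Qed.

Lemma extend_out (a : R -> R) x : ~ Icc11 R x -> extend a x = 0.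
Proof. by move=> Ix; rewrite /extend patchE memNset. Qed.

Lemma Rintegral_extend (a m : R -> R) :
  \int[mu]_(x in Icc11 R) (a x * m x) = \int[mu]_x (extend a x * m x).
Proof.
rewrite -(@Rintegral_out _ (Icc11 R)); last by move=> x Ix; rewrite extend_out// mul0r.
by apply: eq_Rintegral => x /set_mem Ix; rewrite extendE.
Qed.

Lemma integrable_extend (a : R -> R) : measurable_fun (Icc11 R) a ->
  (\int[mu]_(x in Icc11 R) (a x ^+ 2)%:E < +oo)%E ->
  mu.-integrable setT (EFin \o extend a).
Proof.
move=> ma la; have Ioo : (mu (Icc11 R) < +oo)%E.
  by rewrite /Icc11 lebesgue_measure_itv/= lte_fin; case: ifP => _; rewrite ?ltry.
have i := sqr_integrable mIcc Ioo ma la.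
have := (@integrable_mkcond _ _ _ mu (Icc11 R) (EFin \o a) mIcc).1 i.
by rewrite restrict_EFin.
Qed.

Variables (c : R) (v : R -> R[i]).
Hypothesis vL2 : L2 (Icc11 R) v.
Notation re := (extend (fun y => Re (v y))).
Notation im := (extend (fun y => Im (v y))).
Notation C := (trig_transform cos c).
Notation S := (trig_transform sin c).

Let ccos : continuous (@cos R). Proof. exact: continuous_cos. Qed.
Let csin : continuous (@sin R). Proof. exact: continuous_sin. Qed.
Let cos1 x : `|cos x| <= 1. Proof. by rewrite ler_norml cos_geN1 cos_le1. Qed.
Let sin1 x : `|sin x| <= 1. Proof. by rewrite ler_norml sin_geN1 sin_le1. Qed.

Let ire : mu.-integrable setT (EFin \o re).
Proof. by apply: integrable_extend; [case: vL2|exact: L2_Re]. Qed.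
Let iim : mu.-integrable setT (EFin \o im).
Proof. by apply: integrable_extend; [case: vL2|exact: L2_Im]. Qed.
Let mre : measurable_fun setT re.
Proof. by have /measurable_int/measurable_EFinP := ire. Qed.
Let mim : measurable_fun setT im.
Proof. by have /measurable_int/measurable_EFinP := iim. Qed.

Lemma Re_Fc x : Re (Fc c v x) = C re x - S im x.
Proof.
have [_ e] := Rintegral_lin2 1 (-1) measurableT
  (integrable_trig c ccos cos1 x ire) (integrable_trig c csin sin1 x iim).
transitivity (1 * C re x + -1 * S im x); last by ring.
rewrite -e /= -(@Rintegral_out _ (Icc11 R)); last first.
  by move=> y Iy; rewrite !extend_out//; ring.
by apply: eq_Rintegral => y /set_mem Iy; rewrite !extendE// ReM /=; ring.
Qed.

Lemma Im_Fc x : Im (Fc c v x) = C im x + S re x.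
Proof.
have [_ e] := Rintegral_lin2 1 1 measurableT
  (integrable_trig c ccos cos1 x iim) (integrable_trig c csin sin1 x ire).
transitivity (1 * C im x + 1 * S re x); last by ring.
rewrite -e /= -(@Rintegral_out _ (Icc11 R)); last first.
  by move=> y Iy; rewrite !extend_out//; ring.
by apply: eq_Rintegral => y /set_mem Iy; rewrite !extendE// ImM /=; ring.
Qed.

Lemma measurable_Re_Fc : measurable_fun setT (fun x => Re (Fc c v x)).
Proof.
by under eq_fun do rewrite Re_Fc; apply: measurable_funB; exact: measurable_trig_transform.
Qed.

Lemma measurable_Im_Fc : measurable_fun setT (fun x => Im (Fc c v x)).
Proof.
by under eq_fun do rewrite Im_Fc; apply: measurable_funD; exact: measurable_trig_transform.
Qed.

End complex_fourier.

Section eigenfunction.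
Variable R : realType.
Notation mu := (@lebesgue_measure R).
Notation Re := (@complex.Re R).
Notation Im := (@complex.Im R).
Implicit Types (x y : R).
Variables (c : R) (p : R -> R) (m : R[i]).
Hypothesis pL2 : L2 (Icc11 R) (fun x => (p x)%:C).
Hypothesis p_eigen : ae_on (Icc11 R) (fun x => Fc c (fun y => (p y)%:C) x = m * (p x)%:C).
Notation C := (trig_transform cos c).
Notation S := (trig_transform sin c).
Notation pe := (extend p).

Let mIcc : measurable (Icc11 R). Proof. exact: measurable_itv. Qed.
Let ccos : continuous (@cos R). Proof. exact: continuous_cos. Qed.
Let csin : continuous (@sin R). Proof. exact: continuous_sin. Qed.
Let cos1 x : `|cos x| <= 1. Proof. by rewrite ler_norml cos_geN1 cos_le1. Qed.
Let sin1 x : `|sin x| <= 1. Proof. by rewrite ler_norml sin_geN1 sin_le1. Qed.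

Let mp : measurable_fun (Icc11 R) p. Proof. by case: pL2. Qed.
Let lp : (\int[mu]_(x in Icc11 R) (p x ^+ 2)%:E < +oo)%E.
Proof. exact: (L2_Re mIcc pL2). Qed.
Let ipe : mu.-integrable setT (EFin \o pe). Proof. exact: integrable_extend. Qed.
Let mpe : measurable_fun setT pe.
Proof. by have /measurable_int/measurable_EFinP := ipe. Qed.

Let Re_coef11 g : Re (coef11 p g) = \int[mu]_(x in Icc11 R) (p x * Re (g x)).
Proof. by apply: eq_Rintegral => x _; rewrite ReZl. Qed.

Let Im_coef11 g : Im (coef11 p g) = \int[mu]_(x in Icc11 R) (p x * Im (g x)).
Proof. by apply: eq_Rintegral => x _; rewrite ImZl. Qed.

Let trig0 (E : R -> R) x : trig_transform E c (extend (fun y => 0)) x = 0.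
Proof.
rewrite /trig_transform /Rintegral (_ : (fun y => _) = cst 0%E) ?integral0//.
by apply/funext => y; rewrite /extend patchE; case: ifP; rewrite mulr0.
Qed.

Let pairing (E : R -> R) (k : R) (a : R -> R) :
  continuous E -> (forall x, `|E x| <= 1) ->
  ae_on (Icc11 R) (fun x => trig_transform E c pe x = k * p x) ->
  measurable_fun (Icc11 R) a ->
  (\int[mu]_(x in Icc11 R) (a x ^+ 2)%:E < +oo)%E ->
  mu.-integrable setT (EFin \o (fun x => pe x * trig_transform E c (extend a) x)) /\
  \int[mu]_x (pe x * trig_transform E c (extend a) x) =
    k * (\int[mu]_(x in Icc11 R) (p x * a x)).
Proof.
move=> cE E1 eig ma la; have ia := integrable_extend ma la.
have [i ->] := trig_transform_swap c cE E1 ipe ia; split => //.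
rewrite -Rintegral_extend.
have ipa := integrable_sqr_mul mIcc mp ma lp la.
rewrite -RintegralZl//; apply: ae_eq_Rintegral => //.
- apply: measurable_funM => //; apply: measurable_funTS.
  exact: measurable_trig_transform.
- by apply: measurable_funM => //; exact: measurable_funM.
- by apply: ae_imply eig => x h Ix; rewrite h//; ring.
Qed.

(** The kernel of $\mathcal{F}_c$ is symmetric, so the transform may be moved to
    the eigenfunction [p], where it is the multiplication by [m]. *)
Lemma coef11_Fc v : L2 (Icc11 R) v -> coef11 p (Fc c v) = m * coef11 p v.
Proof.
move=> vL2; have [mRe mIm _] := vL2.
have lRe := L2_Re mIcc vL2; have lIm := L2_Im mIcc vL2.
have eigC : ae_on (Icc11 R) (fun x => C pe x = Re m * p x).
  apply: ae_imply p_eigen => x h Ix; have := congr1 Re (h Ix).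
  rewrite Re_Fc// ReM /= mulr0 subr0 => <-.
  by rewrite [X in _ = _ - X]trig0 subr0.
have eigS : ae_on (Icc11 R) (fun x => S pe x = Im m * p x).
  apply: ae_imply p_eigen => x h Ix; have := congr1 Im (h Ix).
  rewrite Im_Fc// ImM /= mulr0 add0r => <-.
  by rewrite [X in _ = X + _]trig0 add0r.
have [iCr eCr] := pairing ccos cos1 eigC mRe lRe.
have [iCi eCi] := pairing ccos cos1 eigC mIm lIm.
have [iSr eSr] := pairing csin sin1 eigS mRe lRe.
have [iSi eSi] := pairing csin sin1 eigS mIm lIm.
apply: complex_eqP; rewrite (ReM, ImM) !Re_coef11 !Im_coef11.
- under eq_Rintegral do rewrite Re_Fc//.
  rewrite Rintegral_extend -eCr -eSi.
  have [_ e] := Rintegral_lin2 1 (-1) measurableT iCr iSi.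
  rewrite -[X in X - _]mul1r -mulN1r -e.
  by apply: eq_Rintegral => x _; ring.
- under eq_Rintegral do rewrite Im_Fc//.
  rewrite Rintegral_extend -eCi -eSr.
  have [_ e] := Rintegral_lin2 1 1 measurableT iCi iSr.
  rewrite -[X in X + _]mul1r -[X in _ + X]mul1r -e.
  by apply: eq_Rintegral => x _; ring.
Qed.

(** The rescaled data is known to be a transform only off the origin. *)
Lemma coef11_Fc_off0 h v : L2 (Icc11 R) v ->
  (forall x, Icc11 R x -> x != 0 -> h x = Fc c v x) ->
  coef11 p h = m * coef11 p v.
Proof.
move=> vL2 hv; rewrite -coef11_Fc// /coef11 /cintegral.
have mR : measurable_fun (Icc11 R) (fun x => Re ((p x)%:C * Fc c v x)).
  under eq_fun do rewrite ReZl.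
  by apply: measurable_funM => //; apply: measurable_funTS; exact: measurable_Re_Fc.
have mI : measurable_fun (Icc11 R) (fun x => Im ((p x)%:C * Fc c v x)).
  under eq_fun do rewrite ImZl.
  by apply: measurable_funM => //; apply: measurable_funTS; exact: measurable_Im_Fc.
congr (_ +i* _); apply: ae_eq_Rintegral => //.
- by apply: (measurable_fun_off_point mIcc mR (a := 0)) => x Ix x0; rewrite hv.
- by apply: ae_imply (ae_neq 0) => x x0 Ix; rewrite hv.
- by apply: (measurable_fun_off_point mIcc mI (a := 0)) => x Ix x0; rewrite hv.
- by apply: ae_imply (ae_neq 0) => x x0 Ix; rewrite hv.
Qed.

End eigenfunction.

(** * The eigenfunction series of the inverse *)

Section prolate_inverse.
Variable R : realType.
Notation Re := (@complex.Re R).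
Notation Im := (@complex.Im R).
Variables (c : R) (psi : nat -> R -> R) (m : nat -> R[i]).
Hypothesis psi_m : is_pswf c psi m.

Let mIcc : measurable (Icc11 R). Proof. exact: measurable_itv. Qed.

Lemma pswf_eigenvalue_neq0 j : m j != 0.
Proof.
by have /andP[m1 m2] := pswf_eigenvalues psi_m j; rewrite -normr_gt0 (lt_trans m1).
Qed.

(** The eigenvalue of [coef11_Fc] cancels the one in the series, which becomes the
    expansion of [v] in the orthonormal basis [psi]. *)
Lemma is_Fc_inv_of_Fc h v : L2 (Icc11 R) v ->
  (forall x, Icc11 R x -> x != 0 -> h x = Fc c v x) -> is_Fc_inv psi m h v.
Proof.
move=> vL2 hv; split => //.
rewrite [X in cvg_L2 _ X](_ : _ =
  (fun n x => \sum_(j < n) coef11 (psi j) v * (psi j x)%:C)).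
  exact: (pswf_basis psi_m).
apply/funext => n; apply/funext => x; apply: eq_bigr => j _.
rewrite (coef11_Fc_off0 (pswf_L2 psi_m j) (pswf_eigen psi_m j) vL2 hv).
by rewrite -mulrA [X in _ * X]mulrCA mulKf 1?mulrC// pswf_eigenvalue_neq0.
Qed.

Lemma is_Fc_inv_unique h u v : is_Fc_inv psi m h u -> is_Fc_inv psi m h v ->
  ae_on (Icc11 R) (fun x => u x = v x).
Proof.
move=> [uL2 cu] [vL2 cv]; apply: (cvg_L2_unique mIcc _ _ uL2 vL2 cu cv).
- elim=> [|n ih]; first (under eq_fun do rewrite big_ord0; exact: measurable_cst).
  under eq_fun do rewrite big_ord_recr /= ReD mulrAC ReZr.
  apply: measurable_funD => //; apply: measurable_funM => //.
  by have [] := pswf_L2 psi_m n.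
- elim=> [|n ih]; first (under eq_fun do rewrite big_ord0; exact: measurable_cst).
  under eq_fun do rewrite big_ord_recr /= ImD mulrAC ImZr.
  apply: measurable_funD => //; apply: measurable_funM => //.
  by have [] := pswf_L2 psi_m n.
Qed.

End prolate_inverse.

(** * The reconstruction formula *)

Section reconstruction.
Variable R : realType.
Notation mu := (@lebesgue_measure R).
Notation Re := (@complex.Re R).
Notation Im := (@complex.Im R).
Implicit Types (x t s z : R).
Variables (nu : nat) (sigma : R) (f u : R -> R[i]).
Hypothesis sigma_gt0 : 0 < sigma.
Hypothesis fL2 : L2 (Rplus R) f.
Hypothesis uL2 : L2 (Icc11 R) u.
Hypothesis u_source : ae_on (Icc11 R) (fun z => u z = fourier_source nu sigma f z).
Notation gr := (re_cut sigma f).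
Notation gi := (im_cut sigma f).
Notation rho := (re_expi R nu).
Notation iota := (im_expi R nu).
Notation Vr := (abel_transform nu sigma gr).
Notation Vi := (abel_transform nu sigma gi).
Notation w := (inversion_weight nu sigma).
Notation K s t := (s * (chebyshevT R nu).[t / s] / (t * Num.sqrt (t ^+ 2 - s ^+ 2))).

Let mIcc : measurable (Icc11 R). Proof. exact: measurable_itv. Qed.
Let mgr := measurable_re_cut sigma fL2.
Let mgi := measurable_im_cut sigma fL2.
Let gr_supp := @re_cut_supp R sigma f.
Let gi_supp := @im_cut_supp R sigma f.
Let gr_L2 := re_cut_L2 sigma fL2.
Let gi_L2 := im_cut_L2 sigma fL2.

(** The function [u] may be replaced by [fourier_source] at almost every
    [t / sigma]; the real and imaginary parts are then combinations of two
    Abel transforms, and each of these is inverted. *)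
Let component (U : R -> R) (a b s : R) : 0 < s <= sigma ->
  measurable_fun (Icc11 R) U ->
  ae_on (Icc11 R) (fun z => U z = pi^-1 * (a * Vr z + b * Vi z)) ->
  mu.-integrable `[s, sigma] (EFin \o (fun t => K s t * U (t / sigma))) /\
  \int[mu]_(t in `[s, sigma]) (K s t * U (t / sigma)) =
    sigma / 2 * (a * tail_integral gr s + b * tail_integral gi s).
Proof.
move=> /andP[s0 ss] mU aeU; set D := `[s, sigma]%classic.
have mD : measurable D by exact: measurable_itv.
have [ir er] := abel_transform_inversion nu sigma_gt0 mgr gr_supp gr_L2 s0.
have [ii ei] := abel_transform_inversion nu sigma_gt0 mgi gi_supp gi_L2 s0.
have [i e] := Rintegral_lin2 (pi^-1 * a) (pi^-1 * b) measurableT ir ii.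
have DI t : D t -> Icc11 R (t / sigma).
  rewrite /D /Icc11 /= !in_itv/= => /andP[st ts].
  rewrite ler_pdivlMr// ler_pdivrMr// mul1r ts andbT.
  by rewrite mulN1r (le_trans _ st)// (le_trans _ (ltW s0))// oppr_le0 ltW.
(* At [t = s] both sides are zero, since the inverse of zero is zero. *)
have KW t : D t -> t != sigma -> K s t = w s t.
  rewrite /D /= in_itv/= => /andP[st ts] tn; rewrite /inversion_weight indicE mem_setE in_itv/=.
  rewrite [t < sigma]lt_neqAle tn ts andbT.
  have [<-|] := eqVneq s t; last by move=> sn; rewrite lt_neqAle sn st mulr1.
  by rewrite ltxx subrr sqrtr0 mulr0 invr0 !mulr0.
have mUs : measurable_fun D (fun t => U (t / sigma)).
  apply: (measurable_comp mIcc _ mU); last by apply: measurable_funTS; exact: measurable_funM.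
  by move=> _ [t Dt <-]; exact: DI.
have mF : measurable_fun D (fun t => K s t * U (t / sigma)).
  apply: (@measurable_fun_off_point R D (fun t => w s t * U (t / sigma)) _ sigma) => //.
    apply: measurable_funM => //; apply: measurable_funTS.
    exact: measurable_inversion_weight.
  by move=> t Dt tn; rewrite KW.
have aeF : {ae mu, forall t, D t -> K s t * U (t / sigma) =
    pi^-1 * a * (w s t * Vr (t / sigma)) + pi^-1 * b * (w s t * Vi (t / sigma))}.
  apply: ae_imply2 (ae_scale sigma_gt0 aeU) (ae_neq sigma) => t h tn Dt.
  by rewrite KW// h; [ring|exact: DI].
have iD := @integrableS _ _ _ mu _ _ _ measurableT mD (@subsetT _ _) i.
split; first exact: ae_integrable mF aeF iD.
rewrite (ae_eq_Rintegral mD mF _ aeF); last first.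
  by move/measurable_int : iD => /measurable_EFinP.
rewrite Rintegral_out; last first.
  move=> t Dt; suff -> : w s t = 0 by rewrite !mul0r !mulr0 addr0.
  rewrite /inversion_weight indicE memNset ?mulr0// => st; apply: Dt.
  by move: st; rewrite /D /= !in_itv/= => /andP[/ltW -> /ltW ->].
rewrite e er ei; have := pi_gt0 R; move: pi => P P0.
by field; rewrite gt_eqF.
Qed.

Let componentR s : 0 < s <= sigma ->
  mu.-integrable `[s, sigma] (EFin \o (fun t => K s t * Re (u (t / sigma)))) /\
  \int[mu]_(t in `[s, sigma]) (K s t * Re (u (t / sigma))) =
    sigma / 2 * (rho * tail_integral gr s + iota * tail_integral gi s).
Proof.
move=> s0; have [mR _ _] := uL2; apply: (component s0 mR).
by apply: ae_imply u_source => z h Iz; rewrite h.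
Qed.

Let componentI s : 0 < s <= sigma ->
  mu.-integrable `[s, sigma] (EFin \o (fun t => K s t * Im (u (t / sigma)))) /\
  \int[mu]_(t in `[s, sigma]) (K s t * Im (u (t / sigma))) =
    sigma / 2 * (- iota * tail_integral gr s + rho * tail_integral gi s).
Proof.
move=> s0; have [_ mI _] := uL2; apply: (component s0 mI).
by apply: ae_imply u_source => z h Iz; rewrite h// addrC.
Qed.

Lemma cintegrable_inv_integrand s : 0 < s <= sigma ->
  cintegrable `[s, sigma]%classic (inv_integrand nu sigma u s).
Proof.
move=> s0; split.
- by have [h _] := componentR s0; apply: eq_integrable h => // t _; rewrite /= ReZl.
- by have [h _] := componentI s0; apply: eq_integrable h => // t _; rewrite /= ImZl.
Qed.

Lemma inv_integralE s : 0 < s <= sigma -> inv_integral nu sigma u s =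
  (sigma / 2 * (rho * tail_integral gr s + iota * tail_integral gi s)) +i*
  (sigma / 2 * (- iota * tail_integral gr s + rho * tail_integral gi s)).
Proof.
move=> s0; rewrite /inv_integral /cintegral; congr (_ +i* _).
- by have [_ <-] := componentR s0; apply: eq_Rintegral => t _; rewrite /inv_integrand ReZl.
- by have [_ <-] := componentI s0; apply: eq_Rintegral => t _; rewrite /inv_integrand ImZl.
Qed.

(** Near [s] the integral is $\frac{\sigma}{2 i^\nu}$ times a tail integral; the
    factor $i^\nu$ of the formula cancels $i^{-\nu}$ because
    $\Re(i^\nu)^2 + \Im(i^\nu)^2 = 1$. *)
Lemma reconstruction : ae_on `]0, sigma]%classic (fun s =>
  cderivable (inv_integral nu sigma u) s /\
  f s = - (2 * (0 +i* 1) ^+ nu / sigma%:C) * (Num.sqrt s)%:C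
        * cderive (inv_integral nu sigma u) s).
Proof.
have dr := derive_tail_integral sigma_gt0 mgr gr_supp gr_L2.
have di := derive_tail_integral sigma_gt0 mgi gi_supp gi_L2.
have := ae_imply2 (fun x a b => conj a b) dr di.
apply: ae_imply2 (ae_neq sigma) => s sn [hr hi].
rewrite /= in_itv/= => /andP[s0 ss].
have sI : 0 < s < sigma by rewrite s0 lt_neqAle sn ss.
have {}hr := hr sI; have {}hi := hi sI.
have nearI : \forall x \near s, 0 < x < sigma.
  have : s \in `]0, sigma[ by rewrite in_itv.
  move/near_in_itvoo; apply: filterS => x; by rewrite in_itv.
have deriv (a b : R) (F : R -> R) :
    (forall x, 0 < x <= sigma -> F x = sigma / 2 * (a * tail_integral gr x + b * tail_integral gi x)) ->
    is_derive s 1 (F : R -> R^o) (sigma / 2 * (a * - (gr s / Num.sqrt s) + b * - (gi s / Num.sqrt s))).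
  move=> FE.
  pose G : R -> R^o := fun x => sigma / 2 * (a * tail_integral gr x + b * tail_integral gi x).
  have dG : is_derive s 1 G (sigma / 2 * (a * - (gr s / Num.sqrt s) + b * - (gi s / Num.sqrt s))).
    have h1 := is_derive_mul (is_derive_cst a s 1) hr.
    have h2 := is_derive_mul (is_derive_cst b s 1) hi.
    have h3 := is_derive_mul (is_derive_cst (sigma / 2) s 1) (is_deriveD h1 h2).
    by apply: (is_derive_eq h3); rewrite !mul0r !add0r.
  apply: (near_eq_is_derive _ dG); apply: filterS nearI => x /andP[x0 xs].
  by rewrite /G FE// x0 ltW.
have DR := deriv rho iota _ (fun x hx => congr1 Re (inv_integralE hx)).
have DI := deriv (- iota) rho _ (fun x hx => congr1 Im (inv_integralE hx)).
split; first by split; exact: ex_derive.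
rewrite /cderive !derive1E.
rewrite (@derive_val _ _ _ _ _ _ _ DR) (@derive_val _ _ _ _ _ _ _ DI).
have q0 : Num.sqrt s != 0 by rewrite gt_eqF// sqrtr_gt0.
have fE : f s = gr s +i* gi s.
  by rewrite /re_cut /im_cut !cut_offE//; case: (f s).
have rs := re_expi_sqr R nu.
have sg0 : sigma != 0 by rewrite gt_eqF.
have cE : - (2 * (0 +i* 1) ^+ nu / sigma%:C) * (Num.sqrt s)%:C =
    (- (2 / sigma * Num.sqrt s))%:C * (rho +i* iota).
  rewrite expiE -fmorphV /= -[2](rmorph_nat (real_complex R)) /=.
  apply: complex_eqP => /=; ring.
rewrite cE fE; apply: complex_eqP; rewrite (ReM, ImM) ReZl ImZl /=.
- transitivity ((rho ^+ 2 + iota ^+ 2) * gr s); first by rewrite rs mul1r.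
  by field; rewrite sg0 q0.
- transitivity ((rho ^+ 2 + iota ^+ 2) * gi s); first by rewrite rs mul1r.
  by field; rewrite sg0 q0.
Qed.

End reconstruction.

Unset Implicit Arguments.
Set Strict Implicit.
Set Printing Implicit Defensive.

Theorem theorem1p1 (R : realType) (nu : nat) (r sigma : R)
    (psi : nat -> R -> R) (mu : nat -> R[i]) (f : R -> R[i])
    (r_gt0 : 0 < r) (sigma_gt0 : 0 < sigma)
    (psi_mu : is_pswf (r * sigma) psi mu)
    (fL2 : L2 (Rplus R) f) (f_supp : supported sigma f) :
  [/\ (forall g : R -> R[i], L2 (Rplus R) g -> supported sigma g ->
         (forall t : R, 0 <= t <= r -> hankel nu g t = hankel nu f t) ->
         ae_on (Rplus R) (fun s => g s = f s)),
      in_range_Fc (r * sigma) (h_resc r nu (hankel nu f)),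
      (exists u : R -> R[i], is_Fc_inv psi mu (h_resc r nu (hankel nu f)) u) &
      forall u : R -> R[i], is_Fc_inv psi mu (h_resc r nu (hankel nu f)) u ->
        (forall s : R, 0 < s <= sigma ->
           cintegrable `[s, sigma]%classic (inv_integrand nu sigma u s)) /\
        ae_on `]0, sigma]%classic (fun s =>
          cderivable (inv_integral nu sigma u) s /\
          f s = - (2 * (0 +i* 1) ^+ nu / sigma%:C) * (Num.sqrt s)%:C
                * cderive (inv_integral nu sigma u) s)].
Proof.
have source_L2 g : L2 (Rplus R) g -> L2 (Icc11 R) (fourier_source nu sigma g).
  by move=> gL2; exact: fourier_source_L2.
(* The function built from any [g] with the same data represents the inverse. *)
have source_inv g : L2 (Rplus R) g -> supported sigma g ->
    (forall t : R, 0 <= t <= r -> hankel nu g t = hankel nu f t) ->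
    is_Fc_inv psi mu (h_resc r nu (hankel nu f)) (fourier_source nu sigma g).
  move=> gL2 gs gf.
  apply: (is_Fc_inv_of_Fc psi_mu (source_L2 _ gL2)) => x Ix x0.
  rewrite -(h_rescE nu r_gt0 sigma_gt0 gL2 gs x0) /h_resc.
  move: Ix; rewrite /Icc11 /= in_itv/= => /andP[x1 x2].
  have scale y : 0 < y -> y <= 1 -> 0 <= r * y <= r.
    by move=> y0 y1; rewrite mulr_ge0 ?(ltW r_gt0) ?(ltW y0)//= ler_piMr// ltW.
  have [xp|xn|x00] := ltgtP 0 x; last by rewrite -x00 eqxx in x0.
  - by rewrite gf//; exact: scale.
  - by rewrite gf//; apply: scale; rewrite ?oppr_gt0// lerNl.
have f_inv := source_inv f fL2 f_supp (fun t _ => erefl).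
have rec g u : L2 (Rplus R) g -> supported sigma g ->
    (forall t : R, 0 <= t <= r -> hankel nu g t = hankel nu f t) ->
    is_Fc_inv psi mu (h_resc r nu (hankel nu f)) u ->
    L2 (Icc11 R) u /\ ae_on (Icc11 R) (fun z => u z = fourier_source nu sigma g z).
  move=> gL2 gs gf hu; split; first by case: hu.
  exact: (is_Fc_inv_unique psi_mu hu (source_inv g gL2 gs gf)).
split.
- move=> g gL2 gs gf.
  have [uL2 uf] := rec f _ fL2 f_supp (fun t _ => erefl) f_inv.
  have [_ ug] := rec g _ gL2 gs gf f_inv.
  have rf := reconstruction sigma_gt0 fL2 uL2 uf.
  have rg := reconstruction sigma_gt0 gL2 uL2 ug.
  have inside : ae_on `]0, sigma]%classic (fun s => g s = f s).
    apply: ae_imply2 rf rg => s hf hg sI.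
    by have [_ ->] := hf sI; have [_ ->] := hg sI.
  have outside : ae_on (Rplus R) (fun s => sigma < s -> g s = f s).
    by apply: ae_imply2 f_supp gs => s hf hg Rs ss; rewrite hf// hg.
  have := ae_imply2 (fun x a b => conj a b) outside (ae_neq (0 : R)).
  apply: ae_imply2 inside => s hin [hout s0] Rs.
  have [ss|ss] := ltP sigma s; first exact: hout.
  apply: hin; rewrite /= in_itv/= ss andbT lt_neqAle eq_sym s0.
  by move: Rs; rewrite /Rplus /= in_itv/= andbT.
- exact: (h_resc_in_range nu r_gt0 sigma_gt0 fL2 f_supp).
- by exists (fourier_source nu sigma f).
- move=> u hu; have [uL2 uf] := rec f u fL2 f_supp (fun t _ => erefl) hu.
  split; last exact: (reconstruction sigma_gt0 fL2 uL2 uf).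
  by move=> s s0; exact: (cintegrable_inv_integrand sigma_gt0 fL2 uL2 uf s0).
Qed.
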